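(* Fix a finite signature $\tau$ and $k\in\mathbb{N}$. The separator synthesis problem for $\mathrm{FO}(k)$ is decidable in $\mathsf{EXPTIME}$: there is an algorithm that, given finite sets $\mathit{Pos},\mathit{Neg}$ of finite $\tau$-structures and a regular tree grammar $G$ over $\Sigma_{\mathrm{FO}(k)}$, runs in time exponential in the size of the input and either outputs a sentence $\varphi\in L(G)$ such that $A\models\varphi$ for all $A\in\mathit{Pos}$ and $B\not\models\varphi$ for all $B\in\mathit{Neg}$, or correctly answers ''No'' if no such sentence exists.
   Context: A signature $\tau$ consists of relation, function and constant symbols with arities; structures are finite. $\mathrm{FO}$ denotes first-order logic with if-then-else terms: formulas $\varphi::=R(\bar t)\mid\varphi\vee\varphi\mid\varphi\wedge\varphi\mid\neg\varphi\mid\exists x.\varphi\mid\forall x.\varphi$ and terms $t::=x\mid c\mid f(\bar t)\mid \mathsf{ite}(\varphi,t,t')$, where $\mathsf{ite}(\varphi,t_1,t_2)$ denotes the value of $t_1$ if $\varphi$ holds and of $t_2$ otherwise. $\mathrm{FO}(k)$ is the fragment using only the $k$ variables $V=\{x_1,\dots,x_k\}$ (which may be requantified/reused arbitrarily often). Formulas are represented as finite ordered ranked trees over the finite ranked alphabet $\Sigma_{\mathrm{FO}(k)}=\{R^{\mathrm{ar}(R)}:R\in\tau\}\cup\{f^{\mathrm{ar}(f)}:f\in\tau\}\cup\{\mathsf{ite}^3\}\cup\{\wedge^2,\vee^2,\neg^1\}\cup\{\forall x^1,\exists x^1,x^0:x\in V\}$ (constants are nullary function symbols; superscripts are arities). A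 regular tree grammar (RTG) is $G=\langle N,\Sigma,S,P\rangle$ with finite nonterminal set $N$, ranked alphabet $\Sigma$, axiom $S\in N$, and rules $B\to t$ with $B\in N$ and $t$ a tree over $\Sigma\cup N$ (nonterminals nullary); $L(G)$ is the set of trees over $\Sigma$ derivable from $S$ by repeatedly replacing a nonterminal $B$ by the right side of a rule for $B$.
   Formalization: The sentence is output as a term graph (a tree with shared subtrees) rather than as an explicit tree, because a smallest separator in L(G) can have doubly exponential size as a tree and so could not be written out in exponential time. *)

(* Defs.v *)
From Stdlib Require List.
From Stdlib Require Import Relation_Operators.
From mathcomp Require Import all_boot.
Set Implicit Arguments.
Unset Strict Implicit.
Unset Printing Implicit Defensive.

(** * Finite ordered ranked trees and regular tree grammars *)

Inductive rtree (A : Type) (ar : A -> nat) : Type :=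
  Node (a : A) of {ffun 'I_(ar a) -> rtree ar}.

Arguments Node {A ar} a _.

(* The alphabet A extended with nonterminals of type B, which are nullary. *)
Definition sum_arity (A B : Type) (ar : A -> nat) (s : A + B) : nat :=
  match s with inl a => ar a | inr _ => 0 end.

Definition nonterm_tree (A B : Type) (ar : A -> nat) (b : B) :
    rtree (@sum_arity A B ar) :=
  @Node _ (@sum_arity A B ar) (inr b) (ffun0 (card_ord 0)).

Fixpoint lift_tree (A B : Type) (ar : A -> nat) (t : rtree ar) :
    rtree (@sum_arity A B ar) :=
  let: Node a ch := t in
  @Node _ (@sum_arity A B ar) (inl a) [ffun i => @lift_tree A B ar (ch i)].

Record rtg (A : Type) (ar : A -> nat) : Type := Rtg {
  nonterms : nat;
  axiom : 'I_nonterms;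
  rules : seq ('I_nonterms * rtree (@sum_arity A 'I_nonterms ar))
}.

Inductive derive_step (A : Type) (ar : A -> nat) (G : rtg ar) :
    rtree (@sum_arity A 'I_(nonterms G) ar) ->
    rtree (@sum_arity A 'I_(nonterms G) ar) -> Prop :=
| derive_rule B t :
    List.In (B, t) (rules G) -> derive_step (nonterm_tree ar B) t
| derive_child s (ch : {ffun 'I_(sum_arity ar s) -> _}) i u :
    derive_step (ch i) u ->
    derive_step (Node s ch) (Node s [ffun j => if j == i then u else ch j]).

Definition lang (A : Type) (ar : A -> nat) (G : rtg ar) (t : rtree ar) : Prop :=
  clos_refl_trans _ (@derive_step A ar G)
    (nonterm_tree ar (axiom G)) (lift_tree 'I_(nonterms G) t).

(** * First-order logic with if-then-else terms and k variables *)

(* Constants are function symbols of arity 0. *)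
Record signature : Type := Signature {
  rel_sym : finType;
  rel_ar : rel_sym -> nat;
  fn_sym : finType;
  fn_ar : fn_sym -> nat
}.

(* A finite structure, presented on the nonempty domain {0, ..., dom}. *)
Record structure (tau : signature) : Type := Structure {
  dom : nat;
  rel_int : forall R : rel_sym tau, {ffun 'I_(rel_ar R) -> 'I_dom.+1} -> bool;
  fn_int : forall f : fn_sym tau, {ffun 'I_(fn_ar f) -> 'I_dom.+1} -> 'I_dom.+1
}.

Inductive formula (tau : signature) (k : nat) : Type :=
| FRel (R : rel_sym tau) of {ffun 'I_(rel_ar R) -> term tau k}
| FOr of formula tau k & formula tau k
| FAnd of formula tau k & formula tau k
| FNot of formula tau k
| FEx of 'I_k & formula tau k
| FAll of 'I_k & formula tau k
with term (tau : signature) (k : nat) : Type :=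
| TVar of 'I_k
| TFun (f : fn_sym tau) of {ffun 'I_(fn_ar f) -> term tau k}
| TIte of formula tau k & term tau k & term tau k.

Definition assignment (tau : signature) (k : nat) (A : structure tau) : Type :=
  {ffun 'I_k -> 'I_(dom A).+1}.

Definition update (tau : signature) (k : nat) (A : structure tau)
    (e : assignment k A) (x : 'I_k) (d : 'I_(dom A).+1) : assignment k A :=
  [ffun y => if y == x then d else e y].

Fixpoint sat (tau : signature) (k : nat) (A : structure tau)
    (e : assignment k A) (phi : formula tau k) {struct phi} : bool :=
  match phi with
  | FRel R ts => @rel_int tau A R [ffun i => eval e (ts i)]
  | FOr p q => sat e p || sat e q
  | FAnd p q => sat e p && sat e q
  | FNot p => ~~ sat e p
  | FEx x p => [exists d, sat (update e x d) p]
  | FAll x p => [forall d, sat (update e x d) p]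
  end
with eval (tau : signature) (k : nat) (A : structure tau)
    (e : assignment k A) (t : term tau k) {struct t} : 'I_(dom A).+1 :=
  match t with
  | TVar x => e x
  | TFun f ts => @fn_int tau A f [ffun i => eval e (ts i)]
  | TIte p t1 t2 => if sat e p then eval e t1 else eval e t2
  end.

Fixpoint fv (tau : signature) (k : nat) (phi : formula tau k) : {set 'I_k} :=
  match phi with
  | FRel R ts => \bigcup_i tfv (ts i)
  | FOr p q | FAnd p q => fv p :|: fv q
  | FNot p => fv p
  | FEx x p | FAll x p => fv p :\ x
  end
with tfv (tau : signature) (k : nat) (t : term tau k) : {set 'I_k} :=
  match t with
  | TVar x => [set x]
  | TFun f ts => \bigcup_i tfv (ts i)
  | TIte p t1 t2 => fv p :|: tfv t1 :|: tfv t2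
  end.

Definition sentence (tau : signature) (k : nat) (phi : formula tau k) : Prop :=
  fv phi = set0.

(* Only used for sentences, whose truth value does not depend on e. *)
Definition models (tau : signature) (k : nat) (A : structure tau)
    (phi : formula tau k) : Prop :=
  forall e : assignment k A, sat e phi.

(** * Formulas as trees over the ranked alphabet of FO(k) *)

Inductive fo_symb (tau : signature) (k : nat) : Type :=
| SRel of rel_sym tau
| SFun of fn_sym tau
| SIte
| SAnd
| SOr
| SNot
| SAll of 'I_k
| SEx of 'I_k
| SVar of 'I_k.

Arguments SIte {tau k}.
Arguments SAnd {tau k}.
Arguments SOr {tau k}.
Arguments SNot {tau k}.

Definition fo_ar (tau : signature) (k : nat) (s : fo_symb tau k) : nat :=
  match s with
  | SRel R => rel_ar R
  | SFun f => fn_ar f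
  | SIte => 3
  | SAnd | SOr => 2
  | SNot | SAll _ | SEx _ => 1
  | SVar _ => 0
  end.

Fixpoint formula_tree (tau : signature) (k : nat) (phi : formula tau k) :
    rtree (@fo_ar tau k) :=
  match phi with
  | FRel R ts => @Node _ (@fo_ar tau k) (SRel k R) [ffun i => term_tree (ts i)]
  | FOr p q => @Node _ (@fo_ar tau k) SOr
      [ffun i => tnth [tuple formula_tree p; formula_tree q] i]
  | FAnd p q => @Node _ (@fo_ar tau k) SAnd
      [ffun i => tnth [tuple formula_tree p; formula_tree q] i]
  | FNot p => @Node _ (@fo_ar tau k) SNot [ffun=> formula_tree p]
  | FEx x p => @Node _ (@fo_ar tau k) (SEx tau x) [ffun=> formula_tree p]
  | FAll x p => @Node _ (@fo_ar tau k) (SAll tau x) [ffun=> formula_tree p]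
  end
with term_tree (tau : signature) (k : nat) (t : term tau k) :
    rtree (@fo_ar tau k) :=
  match t with
  | TVar x => @Node _ (@fo_ar tau k) (SVar tau x) (ffun0 (card_ord 0))
  | TFun f ts => @Node _ (@fo_ar tau k) (SFun k f) [ffun i => term_tree (ts i)]
  | TIte p t1 t2 => @Node _ (@fo_ar tau k) SIte
      [ffun i => tnth [tuple formula_tree p; term_tree t1; term_tree t2] i]
  end.

(** * Separator synthesis *)

Record instance (tau : signature) (k : nat) : Type := Instance {
  pos : seq (structure tau);
  neg : seq (structure tau);
  grammar : rtg (@fo_ar tau k)
}.

Definition separator (tau : signature) (k : nat) (I : instance tau k)
    (phi : formula tau k) : Prop :=
  [/\ sentence phi,
      lang (grammar I) (formula_tree phi),
      forall A, List.In A (pos I) -> models A phi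
    & forall B, List.In B (neg I) -> ~ models B phi].

(* A sentence is output as a term graph, i.e. with common subtrees shared: a
   list of nodes, each a symbol with the positions of its children in the list,
   the last node being the root. Sharing is needed because a smallest separator
   in L(G) can have doubly exponentially many nodes as an unshared tree (a
   grammar can force a complete binary tree of exponential depth by making the
   formulas run a binary counter along each branch). *)
Definition term_graph (A : Type) (ar : A -> nat) : Type :=
  seq {a : A & {ffun 'I_(ar a) -> nat}}.

(* Inductive, so a node from which a cycle or a dangling pointer can be reached
   unfolds to no tree. *)
Inductive unfolds (A : Type) (ar : A -> nat) (g : term_graph ar) :
    nat -> rtree ar -> Prop :=
| unfolds_node i a (js : {ffun 'I_(ar a) -> nat})
    (ch : {ffun 'I_(ar a) -> rtree ar}) :
    onth g i = Some (existT _ a js) ->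
    (forall c, unfolds g (js c) (ch c)) ->
    unfolds g i (Node a ch).

Definition represents (A : Type) (ar : A -> nat) (g : term_graph ar)
    (t : rtree ar) : Prop :=
  unfolds g (size g).-1 t.

(* None is the answer "No". *)
Definition correct_answer (tau : signature) (k : nat) (I : instance tau k)
    (ans : option (term_graph (@fo_ar tau k))) : Prop :=
  match ans with
  | Some g => exists phi, represents g (formula_tree phi) /\ separator I phi
  | None => ~ exists phi, separator I phi
  end.

(** * Binary encodings of inputs and outputs *)

(* Numbers are in unary: the size of an input counts domain elements,
   nonterminals and table entries, so this changes it only polynomially. *)
Definition enc_nat (n : nat) : seq bool := rcons (nseq n true) false.

Definition enc_seq (T : Type) (enc : T -> seq bool) (s : seq T) : seq bool :=
  enc_nat (size s) ++ flatten (map enc s).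

Definition enc_ord (n : nat) (i : 'I_n) : seq bool := enc_nat i.

Definition enc_fin (T : finType) (x : T) : seq bool := enc_nat (enum_rank x).

(* The graph of F : (I_m -> I_n) -> T, as a list of argument-value pairs. *)
Definition enc_table (m n : nat) (T : Type) (enc : T -> seq bool)
    (F : {ffun 'I_m -> 'I_n} -> T) : seq bool :=
  enc_seq (fun v : {ffun 'I_m -> 'I_n} =>
             flatten [seq enc_ord (v i) | i <- enum 'I_m] ++ enc (F v))
          (enum {: {ffun 'I_m -> 'I_n}}).

Definition enc_structure (tau : signature) (A : structure tau) : seq bool :=
  enc_nat (dom A)
  ++ flatten [seq enc_table (fun b => [:: b]) (@rel_int tau A R)
             | R <- enum (rel_sym tau)]
  ++ flatten [seq enc_table (@enc_ord _) (@fn_int tau A f)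
             | f <- enum (fn_sym tau)].

Definition enc_symb (tau : signature) (k : nat) (s : fo_symb tau k) : seq bool :=
  match s with
  | SRel R => enc_nat 0 ++ enc_fin R
  | SFun f => enc_nat 1 ++ enc_fin f
  | SIte => enc_nat 2
  | SAnd => enc_nat 3
  | SOr => enc_nat 4
  | SNot => enc_nat 5
  | SAll x => enc_nat 6 ++ enc_ord x
  | SEx x => enc_nat 7 ++ enc_ord x
  | SVar x => enc_nat 8 ++ enc_ord x
  end.

Definition enc_sum (A B : Type) (encA : A -> seq bool) (encB : B -> seq bool)
    (s : A + B) : seq bool :=
  match s with inl a => false :: encA a | inr b => true :: encB b end.

(* Preorder (Polish) notation. *)
Fixpoint enc_tree (A : Type) (ar : A -> nat) (enc : A -> seq bool)
    (t : rtree ar) : seq bool :=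
  let: Node a ch := t in
  enc a ++ flatten [seq enc_tree enc (ch i) | i <- enum 'I_(ar a)].

Definition enc_rtg (A : Type) (ar : A -> nat) (enc : A -> seq bool)
    (G : rtg ar) : seq bool :=
  enc_nat (nonterms G) ++ enc_ord (axiom G)
  ++ enc_seq (fun r => enc_ord r.1
                       ++ enc_tree (enc_sum enc (@enc_ord _)) r.2) (rules G).

Definition enc_instance (tau : signature) (k : nat) (I : instance tau k) :
    seq bool :=
  enc_seq (@enc_structure tau) (pos I)
  ++ enc_seq (@enc_structure tau) (neg I)
  ++ enc_rtg (@enc_symb tau k) (grammar I).

Definition enc_term_graph (A : Type) (ar : A -> nat) (enc : A -> seq bool)
    (g : term_graph ar) : seq bool :=
  enc_seq (fun n : {a : A & {ffun 'I_(ar a) -> nat}} =>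
             enc (tag n)
             ++ flatten [seq enc_nat (tagged n i) | i <- enum 'I_(ar (tag n))]) g.

Definition enc_answer (tau : signature) (k : nat)
    (ans : option (term_graph (@fo_ar tau k))) : seq bool :=
  match ans with
  | Some g => true :: enc_term_graph (@enc_symb tau k) g
  | None => [:: false]
  end.

(** * Deterministic multitape Turing machines and exponential time *)

Inductive tm_move : Type := MLeft | MStay | MRight.

(* Cell contents: None is the blank, Some (inl b) an input/output letter, and
   Some (inr x) an auxiliary work symbol. *)
Definition cell (S : Type) : Type := option (bool + S).

Record tm : Type := Tm {
  tapes : nat;    (* the machine has tapes.+1 tapes *)
  work_symb : finType;
  state : finType;
  start : state;
  halting : state -> bool;
  delta : state -> {ffun 'I_tapes.+1 -> cell work_symb} ->
          state * {ffun 'I_tapes.+1 -> cell work_symb * tm_move}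
}.

Record config (M : tm) : Type := Config {
  cstate : state M;
  hpos : 'I_(tapes M).+1 -> nat;
  content : 'I_(tapes M).+1 -> nat -> cell (work_symb M)
}.

(* Tapes are infinite to the right only; MLeft has no effect on cell 0. *)
Definition move_head (m : tm_move) (p : nat) : nat :=
  match m with MLeft => p.-1 | MStay => p | MRight => p.+1 end.

Definition tm_step (M : tm) (c : config M) : config M :=
  if halting (cstate c) then c else
  let: (q, act) :=
    delta (cstate c) [ffun i => content c i (hpos c i)] in
  @Config M q
    (fun i => move_head (act i).2 (hpos c i))
    (fun i p => if p == hpos c i then (act i).1 else content c i p).

Definition word_tape (S : Type) (w : seq bool) (p : nat) : cell S :=
  omap inl (onth w p).

(* The input is on the first tape, the others being blank. *)
Definition tm_init (M : tm) (w : seq bool) : config M :=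
  @Config M (start M) (fun=> 0)
    (fun i => word_tape _ (if i == ord0 then w else [::])).

(* M started on w halts within T steps, with v as the content of its last tape. *)
Definition tm_outputs (M : tm) (w : seq bool) (T : nat) (v : seq bool) : Prop :=
  exists t, let c := iter t (@tm_step M) (tm_init M w) in
    [/\ t <= T, halting (cstate c)
      & forall p, content c ord_max p = word_tape _ v p].

(* M solves the search problem R in time 2^(n^O(1)), where n is the length of
   the encoded input. *)
Definition solves_in_exptime (M : tm) (In Out : Type)
    (encI : In -> seq bool) (encO : Out -> seq bool)
    (R : In -> Out -> Prop) : Prop :=
  exists c d : nat, forall x : In, exists y : Out,
    tm_outputs M (encI x) (2 ^ (c * size (encI x) ^ d + c)) (encO y) /\ R x y.

(* Main.v *)
(** A tree derivable in the grammar is summarised by the subtree of a right-hand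
    side that it derives from and by its value: its sort, its free variables, and
    its denotation at every point, i.e. every input structure with an assignment
    of the k variables. The value of a tree is determined by its root symbol and
    the values of its children, and has polynomial size because k is fixed, so
    there are only 2^poly summaries. Saturation adds one summary at a time together
    with a term-graph node that points to the nodes of the summaries used for the
    children. After 2^poly steps it is closed, and then a separator exists iff some
    summary of the axiom is accepting.

    For the machine, a function on data encoded as binary trees is called
    polynomial-time when a program over a fixed number of stacks computes it in
    time polynomial in the size of the argument; such programs are run by multitape
    Turing machines. One saturation step is polynomial-time, hence so is its F-fold
    iteration on inputs that include F in unary. The number F = 2^poly is produced
    by repeated doubling, which is the only exponential step. *)
From HB Require Import structures.
Require Import Defs.
From Stdlib Require Import Relation_Operators Operators_Properties.
From mathcomp Require Import all_boot zify.
Set Implicit Arguments.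
Unset Strict Implicit.
Unset Printing Implicit Defensive.

(** * Stack programs and their Turing machines *)

(** Rules may have arbitrary trees on the right, so the subtrees of right-hand sides act as the
    nonterminals of a normal form that never has to be built. A grammar may also derive trees that
    are neither formulas nor terms; the sort in a value serves to refuse them. Adding one entry at a
    time makes every node point to older nodes only: the term graph is acyclic by construction and
    each of its prefixes is again a term graph, so cutting it at an accepting entry gives the
    answer. Polynomial time is not closed under iteration; what rescues it here is a bound on all
    iterates known in advance. By soundness every entry holds the value of an actual formula or
    term, and its pointers are below the number of entries, so that [F] entries have size polynomial
    in the instance and [F] together. The tuples of children tried in one step are polynomially many
    because the signature bounds the arity. The entries have distinct keys with codes of bounded
    length, so by counting the iteration is closed within [F] steps. *)

Inductive reg : Type := RI | RS | RT | RU | RV | RK | RO.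

Definition reg_nat (r : reg) : nat :=
  match r with
  | RI => 0 | RS => 1 | RT => 2 | RU => 3 | RV => 4 | RK => 5 | RO => 6
  end.

(** [RI] has to be tape 0 and [RO] tape 6, where the machine model places the input and expects the
    output. *)
Definition reg_tape (r : reg) : 'I_7 := inord (reg_nat r).

Record store : Type := Store {
  s_in : seq bool; s_S : seq bool; s_T : seq bool; s_U : seq bool;
  s_V : seq bool; s_K : seq bool; s_out : seq bool
}.

Definition get (r : reg) (s : store) : seq bool :=
  match r with
  | RI => s_in s | RS => s_S s | RT => s_T s | RU => s_U s
  | RV => s_V s | RK => s_K s | RO => s_out s
  end.

Definition set (r : reg) (l : seq bool) (s : store) : store :=
  let: Store i a b c d e o := s in
  match r with
  | RI => Store l a b c d e o | RS => Store i l b c d e o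
  | RT => Store i a l c d e o | RU => Store i a b l d e o
  | RV => Store i a b c l e o | RK => Store i a b c d l o
  | RO => Store i a b c d e l
  end.

(* [While r c0 c1] pops [r] until it is empty, running [c0] or [c1] according to
   the popped bit; [If r c c0 c1] pops [r] once and runs [c] if it was empty. *)
Inductive com : Type :=
| Skip
| Push of reg & bool
| Seq of com & com
| While of reg & com & com
| If of reg & com & com & com.

(* The time is only an upper bound, hence [exec_weaken]. *)
Inductive exec : com -> store -> nat -> store -> Prop :=
| exec_weaken c s m n s' : m <= n -> exec c s m s' -> exec c s n s'
| exec_skip s : exec Skip s 1 s
| exec_push r b s : r <> RI -> exec (Push r b) s 2 (set r (b :: get r s) s)
| exec_seq c1 c2 s m s' n s'' :
    exec c1 s m s' -> exec c2 s' n s'' -> exec (Seq c1 c2) s (m + n) s''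
| exec_while_nil r c0 c1 s :
    r <> RO -> get r s = [::] -> exec (While r c0 c1) s 1 s
| exec_while_cons r c0 c1 s b l m s' n s'' :
    r <> RO -> get r s = b :: l ->
    exec (if b then c1 else c0) (set r l s) m s' ->
    exec (While r c0 c1) s' n s'' -> exec (While r c0 c1) s (m + n).+1 s''
| exec_if_nil r c c0 c1 s n s' :
    r <> RO -> get r s = [::] -> exec c s n s' ->
    exec (If r c c0 c1) s n.+1 s'
| exec_if_cons r c c0 c1 s b l n s' :
    r <> RO -> get r s = b :: l ->
    exec (if b then c1 else c0) (set r l s) n s' ->
    exec (If r c c0 c1) s n.+1 s'.

(** * Compilation of stack programs into multitape machines *)

Fixpoint loc (c : com) : finType :=
  match c with
  | Skip => unit
  | Push _ _ => bool
  | Seq c1 c2 => (loc c1 + loc c2)%type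
  | While _ c0 c1 => option (loc c0 + loc c1)%type
  | If _ c c0 c1 => option (loc c + (loc c0 + loc c1))%type
  end.

Fixpoint entry_loc (c : com) : loc c :=
  match c return loc c with
  | Skip => tt
  | Push _ _ => false
  | Seq c1 c2 => inl (entry_loc c1)
  | While _ c0 c1 => None
  | If _ c c0 c1 => None
  end.

Notation tcell := (cell unit).

Definition action : Type := option (reg * (tcell * tm_move)).

Definition pop_action (r : reg) (x : tcell) : action :=
  Some (r, if r is RI then (x, MRight) else (None, MLeft)).

(** The states are program points, and a next point [None] means that control leaves the program. In
    a loop the point [None] is the test, so wrapping the exit of a body in [Some] leads back to the
    test. *)
Fixpoint trans (c : com) : loc c -> (reg -> tcell) -> option (loc c) * action :=
  match c return loc c -> (reg -> tcell) -> option (loc c) * action with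
  | Skip => fun _ _ => (None, None)
  | Push r b => fun q rd =>
      if r is RO then (None, Some (r, (Some (inl b), MRight)))
      else if q then (None, Some (r, (Some (inl b), MStay)))
      else (Some true, Some (r, (rd r, MRight)))
  | Seq c1 c2 => fun q rd =>
      match q with
      | inl q1 => let: (o, a) := trans q1 rd in
          (Some (if o is Some q' then inl q' else inr (entry_loc c2)), a)
      | inr q2 => let: (o, a) := trans q2 rd in
          (omap (fun q' => inr q') o, a)
      end
  | While r c0 c1 => fun q rd =>
      match q with
      | None =>
          match rd r with
          | Some (inl b) =>
              (Some (Some (if b then inr (entry_loc c1) else inl (entry_loc c0))),
               pop_action r (rd r))
          | _ => (None, None)
          end
      | Some (inl q0) => let: (o, a) := trans q0 rd in
          (Some (omap (fun q' => inl q') o), a)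
      | Some (inr q1) => let: (o, a) := trans q1 rd in
          (Some (omap (fun q' => inr q') o), a)
      end
  | If r c c0 c1 => fun q rd =>
      match q with
      | None =>
          match rd r with
          | Some (inl b) =>
              (Some (Some (inr (if b then inr (entry_loc c1) else inl (entry_loc c0)))),
               pop_action r (rd r))
          | _ => (Some (Some (inl (entry_loc c))), None)
          end
      | Some (inl q0) => let: (o, a) := trans q0 rd in
          (omap (fun q' => Some (inl q')) o, a)
      | Some (inr (inl q0)) => let: (o, a) := trans q0 rd in
          (omap (fun q' => Some (inr (inl q'))) o, a)
      | Some (inr (inr q1)) => let: (o, a) := trans q1 rd in
          (omap (fun q' => Some (inr (inr q'))) o, a)
      end
  end.

Definition act_fun (a : action) (rd : 'I_7 -> tcell) (i : 'I_7) :
    tcell * tm_move :=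
  if a is Some (r, x) then if i == reg_tape r then x else (rd i, MStay)
  else (rd i, MStay).

Definition com_delta (c : com) (q : option (loc c))
    (rd : {ffun 'I_7 -> tcell}) :
    option (loc c) * {ffun 'I_7 -> tcell * tm_move} :=
  if q is Some q' then
    let: (o, a) := trans q' (fun r => rd (reg_tape r)) in
    (o, [ffun i => act_fun a rd i])
  else (None, [ffun i => (rd i, MStay)]).

Definition com_tm (c : com) : tm :=
  @Tm 6 unit (option (loc c)) (Some (entry_loc c)) (fun q => ~~ isSome q)
    (@com_delta c).

Record tapestate : Type := Tapes {
  heads : 'I_7 -> nat;
  cells : 'I_7 -> nat -> tcell
}.

Definition read (t : tapestate) (r : reg) : tcell :=
  [ffun i => cells t i (heads t i)] (reg_tape r).

Definition app (a : action) (t : tapestate) : tapestate :=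
  let f := [ffun i => act_fun a [ffun i => cells t i (heads t i)] i] in
  Tapes (fun i => move_head (f i).2 (heads t i))
    (fun i p => if p == heads t i then (f i).1 else cells t i p).

(** The step that leaves the program is counted and its action is performed, so that the runs of
    consecutive programs concatenate with no extra step. *)
Inductive run (c : com) : loc c -> tapestate -> nat -> tapestate -> Prop :=
| run_exit q t a : trans q (read t) = (None, a) -> run q t 1 (app a t)
| run_step q t q' a n t' :
    trans q (read t) = (Some q', a) -> run q' (app a t) n t' ->
    run q t n.+1 t'.

Lemma run_lift c c' (h : loc c -> loc c') q t n t' :
  (forall q rd, trans (h q) rd = let: (o, a) := trans q rd in (omap h o, a)) ->
  @run c q t n t' -> run (h q) t n t'.
Proof.
move=> hh; elim=> {q t n t'} [q t a E|q t q' a n t' E _ IH].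
  by apply: run_exit; rewrite hh E.
by apply: run_step IH; rewrite hh E.
Qed.

Lemma run_seq c1 c2 q t m t' n t'' :
  @run c1 q t m t' -> @run c2 (entry_loc c2) t' n t'' ->
  @run (Seq c1 c2) (inl q) t (m + n) t''.
Proof.
move=> H1 /(run_lift (c' := Seq c1 c2) (h := fun q => inr q) (fun q rd => erefl)).
move=> H2; elim: H1 H2 => {q t m t'} [q t a E|q t q' a m t' E _ IH] H2.
  by rewrite add1n; apply: (run_step _ H2); rewrite /= E.
by apply: run_step (IH H2); rewrite /= E.
Qed.

Lemma run_while_body r c0 c1 (c : com) (h : loc c -> loc c0 + loc c1)
    q t m t' n t'' :
  (forall q rd, @trans (While r c0 c1) (Some (h q)) rd =
     let: (o, a) := trans q rd in (Some (omap h o), a)) ->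
  @run c q t m t' -> @run (While r c0 c1) None t' n t'' ->
  @run (While r c0 c1) (Some (h q)) t (m + n) t''.
Proof.
move=> hh H1 H2; elim: H1 H2 => {q t m t'} [q t a E|q t q' a m t' E _ IH] H2.
  by rewrite add1n; apply: (run_step _ H2); rewrite hh E.
by rewrite addSn; apply: run_step (IH H2); rewrite hh E.
Qed.

(* A stack occupies cells 1, 2, ... with the top under the head, so that a blank
   under the head means that the stack is empty. The input is consumed from left
   to right, and the output, held in reverse, is appended to. *)
Definition tape_ok (r : reg) (l : seq bool) (h : nat) (f : nat -> tcell) : Prop :=
  match r with
  | RI => forall j, f (h + j) = omap inl (onth l j)
  | RO => h = size l /\ forall p, f p = omap inl (onth (rev l) p)
  | _ => h = size l /\
      forall p, f p = if p is j.+1 then omap inl (onth (rev l) j) else None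
  end.

Definition tapes_ok (t : tapestate) (s : store) : Prop :=
  forall r, tape_ok r (get r s) (heads t (reg_tape r)) (cells t (reg_tape r)).

Lemma reg_tape_inj : injective reg_tape.
Proof.
move=> r r' /(congr1 (@nat_of_ord 7)).
by rewrite /reg_tape !inordK; case: r; case: r'.
Qed.

Lemma reg_eq_dec (r r' : reg) : {r = r'} + {r <> r'}.
Proof. by decide equality. Qed.

Lemma get_set_same r l s : get r (set r l s) = l.
Proof. by case: s; case: r. Qed.

Lemma get_set_other r r' l s : r <> r' -> get r (set r' l s) = get r s.
Proof. by case: s; case: r; case: r'. Qed.

Lemma onth_rev_last (T : Type) (b : T) l : onth (rev (b :: l)) (size l) = Some b.
Proof. by rewrite rev_cons -cats1 -(size_rev l) onth_cat ltnn subnn. Qed.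

(** [RO] is excluded because its head rests on the blank cell after the last output letter. *)
Lemma read_ok t s r : r <> RO -> tapes_ok t s ->
  read t r = omap inl (ohead (get r s)).
Proof.
move=> nr /(_ r); rewrite /read ffunE.
have stack l h (f : nat -> tcell) : h = size l /\ (forall p,
    f p = if p is j.+1 then omap inl (onth (rev l) j) else None) ->
    f h = omap inl (ohead l).
  by case=> -> ->; case: l => //= b l; rewrite onth_rev_last.
case: r nr => //= _; try exact: stack.
by move=> /(_ 0); rewrite addn0 => ->; case: (s_in s).
Qed.

Lemma tape_ok_ext r l h f f' : (forall p, f' p = f p) ->
  tape_ok r l h f -> tape_ok r l h f'.
Proof.
move=> e; case: r => /= [Hf j|[-> Hf]|[-> Hf]|[-> Hf]|[-> Hf]|[-> Hf]|[-> Hf]];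
  try split=> //; move=> *; rewrite e; exact: Hf.
Qed.

Lemma app_none t s : tapes_ok t s -> tapes_ok (app None t) s.
Proof.
move=> H r; move: (H r); rewrite /= !ffunE /=.
set h := heads t _; set f := cells t _.
by apply: tape_ok_ext => p; rewrite ?ffunE; case: eqP => [->|].
Qed.

Definition others_ok (r : reg) (t : tapestate) (s : store) : Prop :=
  forall r', r' <> r ->
    tape_ok r' (get r' s) (heads t (reg_tape r')) (cells t (reg_tape r')).

Lemma app_others t s r x :
  others_ok r t s -> others_ok r (app (Some (r, x)) t) s.
Proof.
move=> H r' n; move: (H r' n).
have ni : (reg_tape r' == reg_tape r) = false by apply/eqP => /reg_tape_inj.
rewrite /app /= !ffunE /= ni ?ffunE /=.
set h := heads t _; set f := cells t _.
by apply: tape_ok_ext => p; case: eqP => [->|].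
Qed.

Lemma tapes_ok_set t s r l : others_ok r t s ->
  tape_ok r l (heads t (reg_tape r)) (cells t (reg_tape r)) ->
  tapes_ok t (set r l s).
Proof.
move=> H Hr r'; case: (reg_eq_dec r' r) => [->|n]; first by rewrite get_set_same.
by rewrite get_set_other //; exact: H.
Qed.

Lemma pop_ok t s r b l : r <> RO -> tapes_ok t s -> get r s = b :: l ->
  tapes_ok (app (pop_action r (read t r)) t) (set r l s).
Proof.
move=> nr H E; apply: tapes_ok_set; first by apply: app_others => r' _; exact: H.
have := read_ok nr H; rewrite E /=; move: (H r); rewrite /read /app /= !ffunE /= eqxx.
set h := heads t _; set f := cells t _; rewrite E.
case: r nr E @h @f => [||||||] nr E h f //=.
- move=> Hf _ j; move: (Hf j.+1); rewrite /= addSnnS => <-.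
  by rewrite -[X in _ == X]addn0 eqn_add2l.
all: move=> [hE Hf] _; rewrite hE; split=> // p.
all: case: eqP => [->|ne]; first by rewrite /= ?onth_default ?size_rev.
all: rewrite Hf; case: p ne => // p ne; rewrite rev_cons -cats1 onth_cat size_rev.
all: case: ltnP => // lp; rewrite !onth_default ?size_rev //=.
all: by rewrite subn_gt0 ltn_neqAle lp andbT; apply/eqP => lp'; apply: ne; rewrite lp'.
Qed.

(** The head of a work stack is on the top symbol, so a push takes two steps: move right, then
    write. The output head already stands on a free cell and needs one. *)
Lemma push_ok r b t s : r <> RI -> tapes_ok t s ->
  exists n t', [/\ n <= 2, @run (Push r b) false t n t' &
                   tapes_ok t' (set r (b :: get r s) s)].
Proof.
move=> nr H.
have O x : others_ok r (app (Some (r, x)) t) s.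
  by apply: app_others => r' _; exact: H.
have [er|nro] := reg_eq_dec r RO.
  exists 1, (app (Some (r, (Some (inl b), MRight))) t); split=> //.
    by apply: run_exit; rewrite /= er.
  apply: tapes_ok_set => //; rewrite /app /= !ffunE /= eqxx /= {O nr}.
  move: (H RO); rewrite er /=; case=> -> Hf; split=> // p.
  rewrite rev_cons -cats1 onth_cat size_rev; case: eqP => [->|ne].
    by rewrite ltnn subnn.
  rewrite Hf; case: ltnP => // lp; rewrite !onth_default ?size_rev //=.
  by rewrite subn_gt0 ltn_neqAle lp andbT; apply/eqP => lp'; apply: ne.
set t1 := app (Some (r, (read t r, MRight))) t.
exists 2, (app (Some (r, (Some (inl b), MStay))) t1); split=> //.
  apply: (@run_step (Push r b) _ _ true (Some (r, (read t r, MRight)))).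
    by case: (r) nro.
  apply: run_exit; by case: (r) nro.
apply: tapes_ok_set; first exact: app_others (O _).
have := H r; rewrite /t1 /read /app; rewrite /= !ffunE /= !eqxx /=.
set h := heads t _; set f := cells t _.
have E : h = size (get r s) ->
  (forall p, f p = if p is j.+1 then omap inl (onth (rev (get r s)) j) else None) ->
  h.+1 = size (b :: get r s) /\ forall p,
    (if p == h.+1 then Some (inl b) else if p == h then f h else f p) =
    if p is j.+1 then omap inl (onth (rev (b :: get r s)) j) else None.
  move=> eh Hf; split; first by rewrite /= eh.
  move=> p.
  have -> : (if p == h then f h else f p) = f p by case: eqP => [->|].
  rewrite Hf; case: p => // p; rewrite eqSS rev_cons -cats1 onth_cat size_rev -eh.
  case: eqP => [->|ne]; first by rewrite ltnn subnn.
  case: ltnP => // lp; rewrite !onth_default ?size_rev -?eh //=.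
  by rewrite subn_gt0 ltn_neqAle lp andbT; apply/eqP => lp'; apply: ne.
by case: (r) nr nro E => //= _ _ E [? ?]; case: E.
Qed.

Theorem exec_run c s n s' : exec c s n s' -> forall t, tapes_ok t s ->
  exists m t', [/\ m <= n, run (entry_loc c) t m t' & tapes_ok t' s'].
Proof.
elim=> {c s n s'}.
- move=> c s m n s' lmn _ IH t /IH[p [t' [lp R ok]]].
  by exists p, t'; split=> //; exact: leq_trans lmn.
- by move=> s t ok; exists 1, (app None t); split; [|exact: run_exit|exact: app_none].
- by move=> r b s nr t ok; exact: push_ok.
- move=> c1 c2 s m s' n s'' _ IH1 _ IH2 t /IH1[m' [t' [lm R1 /IH2]]].
  case=> n' [t'' [ln R2 ok]]; exists (m' + n'), t''; split=> //.
    exact: leq_add.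
  exact: run_seq R1 R2.
- move=> r c0 c1 s nr E t ok; exists 1, (app None t); split=> //.
    by apply: run_exit; rewrite /= (read_ok nr ok) E.
  exact: app_none.
- move=> r c0 c1 s b l m s' n s'' nr E _ IH1 _ IH2 t ok.
  have /IH1[m' [t' [lm R1 /IH2[n' [t'' [ln R2 ok']]]]]] := pop_ok nr ok E.
  exists (m' + n').+1, t''; split=> //; first by rewrite ltnS leq_add.
  apply: (@run_step (While r c0 c1) _ _
    (Some (if b then inr (entry_loc c1) else inl (entry_loc c0))) (pop_action r (read t r))).
    by rewrite /= (read_ok nr ok) E.
  by case: b R1 {E IH1} => R1; apply: run_while_body R1 R2.
- move=> r c c0 c1 s n s' nr E _ IH t ok.
  have /IH[m [t' [lm R ok']]] := app_none ok.
  exists m.+1, t'; split=> //.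
  apply: (@run_step (If r c c0 c1) _ _ (Some (inl (entry_loc c))) None).
    by rewrite /= (read_ok nr ok) E.
  exact: (run_lift (c' := If r c c0 c1) (h := fun q => Some (inl q))) R.
- move=> r c c0 c1 s b l n s' nr E _ IH t ok.
  have /IH[m [t' [lm R ok']]] := pop_ok nr ok E.
  exists m.+1, t'; split=> //.
  apply: (@run_step (If r c c0 c1) _ _
    (Some (inr (if b then inr (entry_loc c1) else inl (entry_loc c0)))) (pop_action r (read t r))).
    by rewrite /= (read_ok nr ok) E.
  case: b R {E IH} => R.
  + exact: (run_lift (c' := If r c c0 c1) (h := fun q => Some (inr (inr q)))) R.
  + exact: (run_lift (c' := If r c c0 c1) (h := fun q => Some (inr (inl q)))) R.
Qed.

Lemma run_iter c q t n t' : @run c q t n t' ->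
  iter n (@tm_step (com_tm c)) (@Config (com_tm c) (Some q) (heads t) (cells t)) =
  @Config (com_tm c) None (heads t') (cells t').
Proof.
have step q0 t0 o a : trans q0 (read t0) = (o, a) ->
    tm_step (@Config (com_tm c) (Some q0) (heads t0) (cells t0)) =
    @Config (com_tm c) o (heads (app a t0)) (cells (app a t0)).
  move=> E; rewrite /tm_step /=.
  rewrite (_ : trans q0 _ = (o, a)) //.
elim=> {q t n t'} [q t a /step <- //|q t q' a n t' E _ IH].
by rewrite iterSr (step _ _ _ _ E).
Qed.

Definition init_store (w : seq bool) : store :=
  Store w [::] [::] [::] [::] [::] [::].

Theorem com_tm_outputs c w n s v : exec c (init_store w) n s ->
  s_out s = rev v -> tm_outputs (com_tm c) w n v.
Proof.
move=> ex out.
pose t := Tapes (fun=> 0)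
  (fun i => word_tape unit (if i == (ord0 : 'I_7) then w else [::])).
have ok : tapes_ok t (init_store w).
  have e0 r : (reg_tape r == ord0) = (if r is RI then true else false).
    by rewrite -val_eqE /= /reg_tape inordK; case: r.
  move=> r; have := e0 r; rewrite /t /=.
  case: r => /= ->; rewrite /word_tape; try split=> //.
  1-5: by case=> [|p] /=; rewrite ?onth_default.
have [m [t' [lm R ok']]] := exec_run ex ok.
exists m; rewrite /tm_init; move: (run_iter R) => /= ->; split=> // p.
have [_] := ok' RO; rewrite /= out revK => H; rewrite /word_tape -H.
by congr (cells _ _ _); apply: val_inj; rewrite /= /reg_tape inordK.
Qed.

(** * Binary trees on a stack *)

Lemma exec_seq_le c1 c2 s m s' n s'' t :
  exec c1 s m s' -> exec c2 s' n s'' -> m + n <= t -> exec (Seq c1 c2) s t s''.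
Proof. by move=> H1 H2 le; apply: exec_weaken le _; apply: exec_seq H1 H2. Qed.

Lemma exec_push_le r b s s' t :
  r <> RI -> s' = set r (b :: get r s) s -> 2 <= t -> exec (Push r b) s t s'.
Proof. by move=> nr -> le; apply: exec_weaken le _; exact: exec_push. Qed.

Definition move_tape (src dst : reg) : com :=
  While src (Push dst false) (Push dst true).

Lemma set_get r s : set r (get r s) s = s.
Proof. by case: s; case: r. Qed.

Lemma set_set r l l' s : set r l (set r l' s) = set r l s.
Proof. by case: s; case: r. Qed.

Lemma set_setC r r' l l' s :
  r <> r' -> set r l (set r' l' s) = set r' l' (set r l s).
Proof. by case: s; case: r; case: r'. Qed.

Lemma exec_move src dst s : src <> RO -> dst <> RI -> src <> dst ->
  exec (move_tape src dst) s (3 * size (get src s) + 1)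
    (set dst (catrev (get src s) (get dst s)) (set src [::] s)).
Proof.
move=> n1 n2 n3; move E : (get src s) => l; elim: l s E => [|b l IH] s E.
  by rewrite /= -E !set_get; exact: exec_while_nil.
set s1 := set dst (b :: get dst s) (set src l s).
have ds : dst <> src by move=> e; apply: n3.
have e1 : get src s1 = l by rewrite /s1 get_set_other // get_set_same.
have := IH s1 e1.
rewrite {2 3}/s1 get_set_same (set_setC _ _ _ n3) set_set set_set => H.
apply: (@exec_weaken _ _ (2 + (3 * size l + 1)).+1); first by rewrite /=; lia.
apply: exec_while_cons n1 E _ H.
rewrite /s1 -(get_set_other l s ds).
by case: b {s1 e1}; exact: exec_push.
Qed.

Inductive bintree : Type := BLeaf | BNode of bintree & bintree.

Fixpoint code (x : bintree) : seq bool :=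
  match x with
  | BLeaf => [:: false]
  | BNode a b => true :: code a ++ code b
  end.

(** Preorder codes are prefix-free, which is why trees can be stacked without delimiters. *)
Lemma code_prefix x y s s' : code x ++ s = code y ++ s' -> x = y /\ s = s'.
Proof.
elim: x y s s' => [|a IHa b IHb] [|a' b'] //= s s'; first by case=> ->.
by case; rewrite -!catA => /IHa[-> /IHb[-> ->]].
Qed.

Lemma code_inj : injective code.
Proof.
by move=> x y E; have [] // := @code_prefix x y [::] [::]; rewrite !cats0.
Qed.

(* Moves the code of one tree from [RS] to [dst], reversing it; [RK] holds one bit
   for each subtree still to be read. *)
Definition parse_loop (dst : reg) : com :=
  While RK Skip
    (If RS Skip (Push dst false)
       (Seq (Push dst true) (Seq (Push RK true) (Push RK true)))).

Definition parse (dst : reg) : com := Seq (Push RK true) (parse_loop dst).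

Definition scratch (r : reg) : Prop :=
  match r with RT | RU | RV => True | _ => False end.

(** In continuation form: reading one tree uses up one bit of [RK], whatever the loop does
    afterwards. This lets the induction treat the two subtrees of a node one after the other. *)
Lemma exec_parse_loop dst x s d k st n s' : scratch dst ->
  exec (parse_loop dst) (set dst (rev (code x) ++ d) (set RS s (set RK k st))) n s' ->
  exec (parse_loop dst) (set dst d (set RS (code x ++ s) (set RK (true :: k) st)))
    (n + 8 * size (code x)) s'.
Proof.
move=> sd; elim: x s d k n => [|a IHa b IHb] s d k n H.
  apply: (@exec_weaken _ _ (3 + n).+1); first by rewrite /=; lia.
  apply: exec_while_cons H => //; first by case: st; case: dst sd.
  apply: (@exec_if_cons _ _ _ _ _ false s) => //.
    by case: st; case: dst sd.
  by apply: exec_push_le => //; case: st; case: dst sd.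
apply: (@exec_weaken _ _ ((2 + (2 + 2)).+1 +
  ((n + 8 * size (code b)) + 8 * size (code a))).+1).
  by rewrite /= size_cat; lia.
pose st' k := set dst (true :: d) (set RS (code a ++ code b ++ s) (set RK k st)).
apply: (@exec_while_cons _ _ _ _ true k _ (st' [:: true, true & k])).
- by [].
- by case: {IHa IHb H} st @st'; case: dst sd.
- apply: (@exec_if_cons _ _ _ _ _ true (code a ++ code b ++ s)) => //.
    by rewrite catA; case: {IHa IHb H} st @st'; case: dst sd.
  apply: (@exec_seq _ _ _ _ (st' k)).
    by apply: exec_push_le => //; case: {IHa IHb H} st @st'; case: dst sd.
  apply: (@exec_seq _ _ _ _ (st' (true :: k)));
    by apply: exec_push_le => //; case: {IHa IHb H} st @st'; case: dst sd.
- apply: IHa; apply: IHb; move: H.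
  by rewrite /= rev_cons rev_cat cat_rcons catA.
Qed.

Lemma exec_parse dst x s st : scratch dst -> get RS st = code x ++ s ->
  get RK st = [::] ->
  exec (parse dst) st (8 * size (code x) + 3)
    (set dst (rev (code x) ++ get dst st) (set RS s st)).
Proof.
move=> sd ES EK.
apply: (@exec_seq_le _ _ _ 2 (set dst (get dst st) (set RS (code x ++ s)
  (set RK [:: true] st))) (1 + 8 * size (code x))); last by lia.
  by apply: exec_push_le => //; rewrite EK -ES; case: {ES EK} st; case: dst sd.
apply: exec_parse_loop => //.
rewrite -EK [X in exec _ _ _ X](_ : _ = set dst (rev (code x) ++ get dst st)
  (set RS s (set RK (get RK st) st))).
  by apply: exec_while_nil => //; rewrite -[RHS]EK; case: {ES EK} st; case: dst sd.
by case: {ES EK} st; case: dst sd.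
Qed.

Definition csize (x : bintree) : nat := size (code x).

Lemma csize_C x y : csize (BNode x y) = (csize x + csize y).+1.
Proof. by rewrite /csize /= size_cat. Qed.

Lemma csize_gt0 x : 0 < csize x.
Proof. by case: x. Qed.

Definition st (s : seq bool) : store := Store [::] s [::] [::] [::] [::] [::].

Definition clear (r : reg) : com := While r Skip Skip.

Lemma exec_clear r s : r <> RO ->
  exec (clear r) s (2 * size (get r s) + 1) (set r [::] s).
Proof.
move=> nr; move E : (get r s) => l; elim: l s E => [|b l IH] s E.
  by rewrite /= -E set_get; exact: exec_while_nil.
have := IH (set r l s) (get_set_same _ _ _); rewrite set_set => H.
apply: (@exec_weaken _ _ (1 + (2 * size l + 1)).+1); first by rewrite /=; lia.
apply: exec_while_cons nr E _ H.
by case: b; exact: exec_skip.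
Qed.

Definition copy_back : com :=
  While RT (Seq (Push RS false) (Push RU false)) (Seq (Push RS true) (Push RU true)).

Lemma exec_copy_back i s t u v k o :
  exec copy_back (Store i s t u v k o) (5 * size t + 1)
    (Store i (catrev t s) [::] (catrev t u) v k o).
Proof.
elim: t s u => [|b t IH] s u; first exact: exec_while_nil.
apply: (@exec_weaken _ _ ((2 + 2) + (5 * size t + 1)).+1); first by rewrite /=; lia.
apply: exec_while_cons (IH _ _) => //.
by case: b; apply: exec_seq; exact: exec_push_le.
Qed.

Definition drop_tree : com := Seq (parse RT) (clear RT).

Lemma exec_drop x s : exec drop_tree (st (code x ++ s)) (14 * csize x) (st s).
Proof.
have H := @exec_parse RT x s (st (code x ++ s)) I erefl erefl.
apply: exec_seq_le H (exec_clear _ _) _ => //.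
by rewrite /= cats0 size_rev -/(csize x); have := csize_gt0 x; lia.
Qed.

Definition dup_tree : com :=
  Seq (parse RT) (Seq copy_back (Seq (move_tape RU RT) (move_tape RT RS))).

Lemma exec_dup x s :
  exec dup_tree (st (code x ++ s)) (30 * csize x) (st (code x ++ code x ++ s)).
Proof.
have H1 := @exec_parse RT x s (st (code x ++ s)) I erefl erefl.
have H2 := exec_copy_back [::] s (rev (code x)) [::] [::] [::] [::].
have H3 := @exec_move RU RT (Store [::] (code x ++ s) [::] (code x) [::] [::] [::]).
have H4 := @exec_move RT RS (Store [::] (code x ++ s) (rev (code x)) [::] [::] [::] [::]).
move: H1 H2 H3 H4; rewrite /= !catrevE !revK !cats0 !size_rev => H1 H2 H3 H4.
apply: exec_seq_le H1 (exec_seq H2 (exec_seq (H3 _ _ _) (H4 _ _ _))) _ => //.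
by have := csize_gt0 x; rewrite -/(csize x); lia.
Qed.

Definition swap_tree : com :=
  Seq (parse RT) (Seq (parse RU) (Seq (move_tape RT RS) (move_tape RU RS))).

Lemma exec_swap x y s :
  exec swap_tree (st (code x ++ code y ++ s)) (20 * (csize x + csize y))
    (st (code y ++ code x ++ s)).
Proof.
have H1 := @exec_parse RT x _ (st (code x ++ code y ++ s)) I erefl erefl.
have H2 := @exec_parse RU y s
  (Store [::] (code y ++ s) (rev (code x)) [::] [::] [::] [::]) I erefl erefl.
have H3 := @exec_move RT RS
  (Store [::] s (rev (code x)) (rev (code y)) [::] [::] [::]).
have H4 := @exec_move RU RS
  (Store [::] (code x ++ s) [::] (rev (code y)) [::] [::] [::]).
move: H1 H2 H3 H4; rewrite /= !catrevE !revK !cats0 !size_rev => H1 H2 H3 H4.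
apply: exec_seq_le H1 (exec_seq H2 (exec_seq (H3 _ _ _) (H4 _ _ _))) _ => //.
by have := csize_gt0 x; have := csize_gt0 y; rewrite -/(csize x) -/(csize y); lia.
Qed.

(* Turns the stack h, t, a into BNode a h, t. *)
Definition rot_tree : com :=
  Seq (parse RT) (Seq (parse RU) (Seq (parse RV)
    (Seq (move_tape RU RS) (Seq (move_tape RT RS) (Seq (move_tape RV RS)
       (Push RS true)))))).

Lemma exec_rot h t a s :
  exec rot_tree (st (code h ++ code t ++ code a ++ s))
    (40 * (csize h + csize t + csize a)) (st (code (BNode a h) ++ code t ++ s)).
Proof.
have H1 := @exec_parse RT h _ (st (code h ++ code t ++ code a ++ s)) I erefl erefl.
have H2 := @exec_parse RU t _
  (Store [::] (code t ++ code a ++ s) (rev (code h)) [::] [::] [::] [::]) I erefl erefl.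
have H3 := @exec_parse RV a _
  (Store [::] (code a ++ s) (rev (code h)) (rev (code t)) [::] [::] [::]) I erefl erefl.
have H4 := @exec_move RU RS
  (Store [::] s (rev (code h)) (rev (code t)) (rev (code a)) [::] [::]).
have H5 := @exec_move RT RS
  (Store [::] (code t ++ s) (rev (code h)) [::] (rev (code a)) [::] [::]).
have H6 := @exec_move RV RS
  (Store [::] (code h ++ code t ++ s) [::] [::] (rev (code a)) [::] [::]).
have H7 : RS <> RI by [].
have {}H7 := exec_push true (st (code a ++ code h ++ code t ++ s)) H7.
move: H1 H2 H3 H4 H5 H6 H7; rewrite /= !catrevE !revK !cats0 !size_rev.
move=> H1 H2 H3 H4 H5 H6 H7; rewrite -catA.
apply: exec_seq_le H1 (exec_seq H2 (exec_seq H3 (exec_seq (H4 _ _ _)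
  (exec_seq (H5 _ _ _) (exec_seq (H6 _ _ _) H7))))) _ => //.
have := csize_gt0 h; have := csize_gt0 t; have := csize_gt0 a.
by rewrite -/(csize h) -/(csize t) -/(csize a); lia.
Qed.

(** A loop stops only on an empty stack, so a mismatch cannot end the comparison; it is recorded as
    a bit on [RV]. Bits left over on [RU] are further mismatches. *)
Definition cmp_loop : com :=
  While RT (If RU (Push RV true) Skip (Push RV true))
           (If RU (Push RV true) (Push RV true) Skip).

Lemma exec_cmp s t u v : exists u' v',
  [/\ exec cmp_loop (Store [::] s t u v [::] [::])
         (5 * size t + 1) (Store [::] s [::] u' v' [::] [::]),
      size u' <= size u, size v' <= size v + size t
    & nilp u' && nilp v' = (t == u) && nilp v].
Proof.
elim: t u v => [|b t IH] u v.
  exists u, v; split=> //; first exact: exec_while_nil.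
  by rewrite addn0.
  by case: u.
have step u1 v1 : size u1 <= size u -> size v1 <= (size v).+1 ->
    (t == u1) && nilp v1 = (b :: t == u) && nilp v ->
    exec (if b then If RU (Push RV true) (Push RV true) Skip
          else If RU (Push RV true) Skip (Push RV true))
      (Store [::] s t u v [::] [::]) 4 (Store [::] s t u1 v1 [::] [::]) ->
    exists u' v', [/\ exec cmp_loop (Store [::] s (b :: t) u v [::] [::])
         (5 * size (b :: t) + 1) (Store [::] s [::] u' v' [::] [::]),
      size u' <= size u, size v' <= size v + size (b :: t)
    & nilp u' && nilp v' = (b :: t == u) && nilp v].
  move=> lu lv e H; have [u' [v' [H' lu' lv' e']]] := IH u1 v1.
  exists u', v'; split; last by rewrite e'.
  - apply: (@exec_weaken _ _ (4 + (5 * size t + 1)).+1); first by rewrite /=; lia.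
    have HH := (@exec_while_cons RT (If RU (Push RV true) Skip (Push RV true)) (If RU (Push RV true) (Push RV true) Skip) (Store [::] s (b :: t) u v [::] [::]) b t _ _ _ _ _ erefl H H'). by apply: HH.
  - exact: leq_trans lu' lu.
  - by rewrite /=; lia.
case: u step => [|b' u] step.
  apply: (step [::] (true :: v)) => //; first by rewrite andbF.
  by case: b {step}; apply: (@exec_if_nil _ _ _ _ _ 3) => //; exact: exec_push_le.
have [eb|nb] := eqVneq b b'.
  apply: (step u v) => //; first by rewrite eqseq_cons eb eqxx.
  rewrite eb; case: b' {step eb}; apply: (@exec_if_cons _ _ _ _ _ _ u 3) => //=;
    exact: exec_weaken (exec_skip _).
apply: (step u (true :: v)) => //; first by rewrite eqseq_cons (negbTE nb) andbF.
by case: b b' nb {step} => [] [] // _; apply: (@exec_if_cons _ _ _ _ _ _ u 3) => //=;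
  exact: exec_push_le.
Qed.

Definition push_true : com := Seq (Push RS false) (Seq (Push RS false) (Push RS true)).

Lemma exec_push_true s : exec push_true (st s) 6 (st (code (BNode BLeaf BLeaf) ++ s)).
Proof.
apply: exec_seq_le (exec_push _ _ _) (exec_seq (exec_push _ _ _) (exec_push _ _ _)) _ => //.
Qed.

Definition eq_tree : com :=
  Seq (parse RT) (Seq (parse RU) (Seq cmp_loop
    (Seq (While RU (Push RV true) (Push RV true))
         (If RV push_true (Seq (clear RV) (Push RS false))
            (Seq (clear RV) (Push RS false)))))).

Definition code_bool (b : bool) : bintree := if b then BNode BLeaf BLeaf else BLeaf.

Lemma exec_eq x y s (b : bool) : (b <-> x = y) ->
  exec eq_tree (st (code x ++ code y ++ s)) (50 * (csize x + csize y))
    (st (code (code_bool b) ++ s)).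
Proof.
move=> eb.
have H1 := @exec_parse RT x _ (st (code x ++ code y ++ s)) I erefl erefl.
have H2 := @exec_parse RU y s
  (Store [::] (code y ++ s) (rev (code x)) [::] [::] [::] [::]) I erefl erefl.
move: H1 H2; rewrite /= !cats0 => H1 H2.
have [u' [v' [H3 lu lv e]]] := exec_cmp s (rev (code x)) (rev (code y)) [::].
have E4 u v : exists v'', [/\ exec (While RU (Push RV true) (Push RV true))
      (Store [::] s [::] u v [::] [::]) (3 * size u + 1)
      (Store [::] s [::] [::] v'' [::] [::]),
      size v'' <= size u + size v & nilp v'' = nilp u && nilp v].
  elim: u v => [|a u IH] v; first by exists v; split=> //; exact: exec_while_nil.
  have [v'' [H lv'' e'']] := IH (true :: v).
  exists v''; split; [|by move: lv''; rewrite /=; lia|by rewrite e'' andbF].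
  apply: (@exec_weaken _ _ (2 + (3 * size u + 1)).+1); first by rewrite /=; lia.
  apply: (@exec_while_cons RU (Push RV true) (Push RV true) (Store [::] s [::] (a :: u) v [::] [::]) a u _ _ _ _ _ erefl _ H) => //.
  by case: a; exact: exec_push_le.
have [v'' [H4 lv'' e'']] := E4 u' v'.
have H5 : exec (If RV push_true (Seq (clear RV) (Push RS false))
    (Seq (clear RV) (Push RS false))) (Store [::] s [::] [::] v'' [::] [::])
    (2 * size v'' + 8) (st (code (code_bool b) ++ s)).
  have {e} : nilp v'' = b.
    rewrite e'' e andbT; apply/idP/idP => [/eqP/(can_inj revK)/code_inj/eb //|/eb ->].
    exact: eqxx.
  case: v'' {H4 lv'' e''} => [|a v''] <-.
    apply: (@exec_if_nil _ _ _ _ _ 7) => //.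
    exact: exec_weaken (exec_push_true _).
  have Hc := @exec_clear RV (Store [::] s [::] [::] v'' [::] [::]).
  apply: (@exec_weaken _ _ ((2 * size v'' + 1) + 2).+1); first by rewrite /=; lia.
  apply: (@exec_if_cons _ _ _ _ _ a v'') => //.
  by case: a; apply: exec_seq (Hc _) (exec_push _ _ _).
apply: exec_seq_le H1 (exec_seq H2 (exec_seq H3 (exec_seq H4 H5))) _ => //.
move: lu lv lv''; rewrite !size_rev /=.
have := csize_gt0 x; have := csize_gt0 y.
by rewrite -/(csize x) -/(csize y); lia.
Qed.

(** The loop bit of [RK] is popped before the body and pushed back after [c], so that [c] runs with
    [RK] empty. Swapping brings the list to the top; popping its first bit tells the empty list from
    a head and a tail. *)
Definition fold_step (c : com) : com :=
  Seq swap_tree (If RS Skip Skip (Seq rot_tree (Seq c (Push RK true)))).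

Definition fold_tree (c : com) : com :=
  If RS Skip Skip (Seq (Push RK true)
    (While RK Skip (fold_step c))).

Definition dlist (l : seq bintree) : bintree := foldr BNode BLeaf l.

Lemma csize_dlist_cons x l : csize (dlist (x :: l)) = (csize x + csize (dlist l)).+1.
Proof. exact: csize_C. Qed.

(** A single [B] bounds the cost of a call of [c], the size of the accumulators and that of the
    list. The hypotheses concern only the accumulators of prefixes of [l]: in the applications
    nothing is known about the others. *)
Lemma exec_fold_loop (A Y : Type) (ea : A -> bintree) (ey : Y -> bintree) c
    (f : A -> Y -> A) (B : nat) a l s :
  (forall l1 x l2, l = l1 ++ x :: l2 ->
     forall s', exec c (st (code (BNode (ea (foldl f a l1)) (ey x)) ++ s')) B
                       (st (code (ea (foldl f a (rcons l1 x))) ++ s'))) ->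
  (forall l1 l2, l = l1 ++ l2 -> csize (ea (foldl f a l1)) <= B) ->
  csize (dlist (map ey l)) <= B ->
  exec (While RK Skip (fold_step c))
    (Store [::] (code (ea a) ++ code (dlist (map ey l)) ++ s) [::] [::] [::] [:: true] [::])
    (200 * (size l).+1 * B.+1) (st (code (ea (foldl f a l)) ++ s)).
Proof.
elim: l a => [|x l IH] a Hc Ha Hl.
  have la := Ha [::] [::] erefl; rewrite /= in la.
  apply: (@exec_weaken _ _ ((20 * (csize (ea a) + csize BLeaf) + 2) + 1).+1).
    by rewrite /csize /= in la *; lia.
  apply: (@exec_while_cons RK _ _ _ true [::]) => //; last exact: exec_while_nil.
  apply: exec_seq; first exact: (exec_swap (ea a) BLeaf s).
  apply: (@exec_if_cons RS _ _ _ _ false (code (ea a) ++ s)) => //; exact: exec_skip.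
have la := Ha [::] _ erefl; rewrite /= in la.
move: (Hl); rewrite [map _ _]/= csize_dlist_cons => Hl'.
apply: (@exec_weaken _ _ ((20 * (csize (ea a) + csize (dlist (map ey (x :: l)))) +
   ((40 * (csize (ey x) + csize (dlist (map ey l)) + csize (ea a))) + (B + 2)).+1) +
   (200 * (size l).+1 * B.+1)).+1).
  rewrite [size (x :: l)]/=; set z := 200 * _ * _.
  have -> : 200 * (size l).+2 * B.+1 = z + 200 * B.+1.
    by rewrite /z -mulnA -[(size l).+2]addn1 mulnDl mulnDr mul1n mulnA.
  by lia.
apply: (@exec_while_cons RK _ _ _ true [::] _
  (Store [::] (code (ea (f a x)) ++ code (dlist (map ey l)) ++ s) [::] [::] [::] [:: true] [::])) => //.
  apply: exec_seq; first exact: (exec_swap (ea a) (dlist (map ey (x :: l))) s).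
  apply: (@exec_if_cons RS _ _ _ _ true (code (ey x) ++ code (dlist (map ey l)) ++ code (ea a) ++ s)) => //.
    by rewrite /= -!catA.
  apply: exec_seq; first exact: exec_rot.
  apply: exec_seq; first exact: (Hc [::] x l erefl).
  exact: exec_push_le.
apply: IH.
- by move=> l1 y l2 e s'; apply: (Hc (x :: l1) y l2); rewrite e.
- by move=> l1 l2 e; apply: (Ha (x :: l1) l2); rewrite e.
- by lia.
Qed.

Lemma exec_fold (A Y : Type) (ea : A -> bintree) (ey : Y -> bintree) c
    (f : A -> Y -> A) (B : nat) a l s :
  (forall l1 x l2, l = l1 ++ x :: l2 ->
     forall s', exec c (st (code (BNode (ea (foldl f a l1)) (ey x)) ++ s')) B
                       (st (code (ea (foldl f a (rcons l1 x))) ++ s'))) ->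
  (forall l1 l2, l = l1 ++ l2 -> csize (ea (foldl f a l1)) <= B) ->
  csize (dlist (map ey l)) <= B ->
  exec (fold_tree c) (st (code (BNode (ea a) (dlist (map ey l))) ++ s))
    (210 * (size l).+1 * B.+1) (st (code (ea (foldl f a l)) ++ s)).
Proof.
move=> Hc Ha Hl.
apply: (@exec_weaken _ _ (2 + 200 * (size l).+1 * B.+1).+1).
  by rewrite -!mulnA; have : 0 < (size l).+1 * B.+1 by []; set z := _ * _; lia.
apply: (@exec_if_cons _ _ _ _ _ true (code (ea a) ++ code (dlist (map ey l)) ++ s)) => //.
  by rewrite /= -catA.
apply: exec_seq; first exact: exec_push_le.
exact: exec_fold_loop.
Qed.

(** * Polynomial-time functions *)

Class Enc (X : Type) : Type := enc : X -> bintree.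

Instance enc_unit : Enc unit := fun=> BLeaf.
Instance enc_boolD : Enc bool := code_bool.
(** Unary, so that a number of iterations is bounded by the size of its code. *)
Instance enc_natD : Enc nat := fun n => dlist (nseq n BLeaf).
Instance enc_seqD (X : Type) (EX : Enc X) : Enc (seq X) :=
  fun l => dlist (map enc l).
Instance enc_pairD (X Y : Type) (EX : Enc X) (EY : Enc Y) : Enc (X * Y) :=
  fun p => BNode (enc p.1) (enc p.2).

Definition sz (X : Type) (EX : Enc X) (x : X) : nat := csize (enc x).
Arguments sz {X EX} x.

(** Expressions with natural coefficients are monotone and closed under substitution, as the
    composition of time bounds requires. *)
Inductive pexp : Type := PX | PC of nat | PAdd of pexp & pexp | PMul of pexp & pexp.

Fixpoint peval (e : pexp) (n : nat) : nat :=
  match e with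
  | PX => n
  | PC c => c
  | PAdd e1 e2 => peval e1 n + peval e2 n
  | PMul e1 e2 => peval e1 n * peval e2 n
  end.

Lemma peval_mono e m n : m <= n -> peval e m <= peval e n.
Proof. by move=> le; elim: e => //= e1 H1 e2 H2; [exact: leq_add|exact: leq_mul]. Qed.

Fixpoint psubst (e e' : pexp) : pexp :=
  match e with
  | PX => e'
  | PC c => PC c
  | PAdd e1 e2 => PAdd (psubst e1 e') (psubst e2 e')
  | PMul e1 e2 => PMul (psubst e1 e') (psubst e2 e')
  end.

Lemma peval_subst e e' n : peval (psubst e e') n = peval e (peval e' n).
Proof. by elim: e => //= e1 -> e2 ->. Qed.

(** * Polynomial bounds and closure properties *)

Section Bounds.
Variables (X : Type) (EX : Enc X).

Definition pbound (t : X -> nat) : Prop := exists e, forall x, t x <= peval e (sz x).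

Lemma pbound_le t t' : (forall x, t x <= t' x) -> pbound t' -> pbound t.
Proof. by move=> le [e He]; exists e => x; exact: leq_trans (le x) (He x). Qed.

Lemma pbound_const n : pbound (fun=> n).
Proof. by exists (PC n). Qed.

Lemma pbound_sz : pbound sz.
Proof. by exists PX. Qed.

Lemma pbound_add t t' : pbound t -> pbound t' -> pbound (fun x => t x + t' x).
Proof. by case=> e H [e' H']; exists (PAdd e e') => x; exact: leq_add. Qed.

Lemma pbound_mul t t' : pbound t -> pbound t' -> pbound (fun x => t x * t' x).
Proof. by case=> e H [e' H']; exists (PMul e e') => x; exact: leq_mul. Qed.

Lemma pbound_succ t : pbound t -> pbound (fun x => (t x).+1).
Proof. by case=> e H; exists (PAdd (PC 1) e) => x; rewrite /= add1n ltnS. Qed.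

Lemma pbound_peval e t : pbound t -> pbound (fun x => peval e (t x)).
Proof.
case=> e' H; exists (psubst e e') => x.
by rewrite peval_subst; exact: peval_mono.
Qed.

(** The stack below the argument is arbitrary and preserved, so a program can run in the middle of
    another one with intermediate results parked underneath. *)
Definition PT (Y : Type) (EY : Enc Y) (f : X -> Y) : Prop :=
  exists (c : com) (t : X -> nat), pbound t /\
    forall x s, exec c (st (code (enc x) ++ s)) (t x) (st (code (enc (f x)) ++ s)).

End Bounds.

Arguments PT {X EX Y EY} f.
Arguments pbound {X EX} t.

Create HintDb pb.
Hint Resolve pbound_const pbound_sz pbound_add pbound_mul pbound_succ pbound_peval : pb.

Definition store_size (s : store) : nat :=
  size (s_in s) + size (s_S s) + size (s_T s) + size (s_U s) + size (s_V s)
  + size (s_K s) + size (s_out s).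

Lemma store_size_set r l s :
  store_size (set r l s) + size (get r s) = store_size s + size l.
Proof. by case: s; case: r => *; rewrite /store_size /=; lia. Qed.

(** Each unit of time writes at most one bit. Hence the size of a result needs no analysis of its
    own: [PT_size] reads it off the running time. *)
Lemma exec_size c s n s' : exec c s n s' -> store_size s' <= store_size s + n.
Proof.
elim=> {c s n s'} /=; try by intros; lia.
- by move=> r b s _; have := store_size_set r (b :: get r s) s; rewrite /=; lia.
- move=> r c0 c1 s b l m s' n s'' _ E _ IH1 _ IH2.
  by have := store_size_set r l s; rewrite E /=; lia.
- move=> r c c0 c1 s b l n s' _ E _ IH.
  by have := store_size_set r l s; rewrite E /=; lia.
Qed.

Lemma PT_le (X Y : Type) (EX : Enc X) (EY : Enc Y) c (f : X -> Y) t : pbound t ->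
  (forall x s, exec c (st (code (enc x) ++ s)) (t x) (st (code (enc (f x)) ++ s))) ->
  PT f.
Proof. by exists c, t. Qed.

Lemma PT_size (X Y : Type) (EX : Enc X) (EY : Enc Y) (f : X -> Y) : PT f -> pbound (fun x => sz (f x)).
Proof.
case=> c [t [bt H]]; apply: (pbound_le (t' := fun x => sz x + t x)); last by auto with pb.
move=> x; have := exec_size (H x [::]).
by rewrite /store_size /= !cats0 /sz /csize; lia.
Qed.

Lemma pbound_comp (X Y : Type) (EX : Enc X) (EY : Enc Y) (f : X -> Y) t :
  pbound (fun x => sz (f x)) -> pbound t -> pbound (fun x => t (f x)).
Proof.
move=> bf [e H]; apply: (pbound_le (t' := fun x => peval e (sz (f x)))) => //.
exact: pbound_peval.
Qed.

Section Closure.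
Variables (X Y Z : Type) (EX : Enc X) (EY : Enc Y) (EZ : Enc Z).

Lemma PT_id : PT (fun x : X => x).
Proof. by apply: (PT_le (c := Skip) (t := fun=> 1)); auto with pb; move=> *; exact: exec_skip. Qed.

Lemma PT_comp (f : X -> Y) (g : Y -> Z) : PT f -> PT g -> PT (fun x => g (f x)).
Proof.
move=> Pf; have := PT_size Pf; case: Pf => c [t [bt H]] bs [c' [t' [bt' H']]].
apply: (PT_le (c := (Seq c c')) (t := fun x => t x + t' (f x))).
  by apply: pbound_add => //; exact: pbound_comp.
by move=> x s; apply: exec_seq (H x s) (H' (f x) s).
Qed.

Fixpoint push_word (w : seq bool) : com :=
  if w is b :: w' then Seq (push_word w') (Push RS b) else Skip.

Lemma exec_push_word w s : exec (push_word w) (st s) (2 * size w + 1) (st (w ++ s)).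
Proof.
elim: w => [|b w IH]; first exact: exec_skip.
by apply: exec_seq_le IH (exec_push _ _ _) _ => //=; lia.
Qed.

Lemma PT_const (y : Y) : PT (fun _ : X => y).
Proof.
apply: (PT_le (c := Seq drop_tree (push_word (code (enc y))))
  (t := fun x => 14 * sz x + (2 * sz y + 1))); first by auto 10 with pb.
by move=> x s; apply: exec_seq (exec_drop _ _) (exec_push_word _ _).
Qed.

Lemma PT_pair (f : X -> Y) (g : X -> Z) : PT f -> PT g -> PT (fun x => (f x, g x)).
Proof.
move=> Pf Pg; have := PT_size Pg.
case: Pf => c [t [bt H]]; case: Pg => c' [t' [bt' H']] bs.
apply: (PT_le (c := Seq dup_tree (Seq c' (Seq swap_tree (Seq c (Push RS true)))))
  (t := fun x => 30 * sz x + (t' x + (20 * (sz (g x) + sz x) + (t x + 2))))).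
  by auto 20 with pb.
move=> x s; apply: exec_seq (exec_dup _ _) _.
apply: exec_seq (H' x _) _; apply: exec_seq (exec_swap _ _ _) _.
apply: exec_seq (H x _) _.
by apply: exec_push_le => //=; rewrite /st -catA.
Qed.

(** Programs see only codes, so one program serves every function that acts in the same way on
    codes, whatever its types. *)
Lemma PT_cast (X' Y' : Type) (EX' : Enc X') (EY' : Enc Y') (h : X' -> X)
    (f : X -> Y) (g : X' -> Y') :
  (forall x, enc x = enc (h x)) -> (forall x, enc (g x) = enc (f (h x))) ->
  PT f -> PT g.
Proof.
move=> eh eg [c [t [bt H]]]; apply: (@ex_intro _ _ c).
exists (fun x => t (h x)); split.
  by case: bt => e He; exists e => x; rewrite /sz eh; exact: He.
by move=> x s; rewrite eh eg.
Qed.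

Lemma PT_castr (Y' : Type) (EY' : Enc Y') (f : X -> Y) (g : X -> Y') :
  (forall x, enc (g x) = enc (f x)) -> PT f -> PT g.
Proof.
by move=> e [c [t [bt H]]]; exists c, t; split=> // x s; rewrite e.
Qed.

Lemma PT_fstP : PT (fun p : X * Y => p.1).
Proof.
apply: (PT_le (c := (If RS Skip Skip (Seq swap_tree drop_tree))) (t := fun p => (20 * sz p + 14 * sz p).+1)); first by auto 10 with pb.
case=> x y s.
have -> : sz (x, y) = (csize (enc x) + csize (enc y)).+1 by exact: csize_C.
apply: (@exec_if_cons RS _ _ _ _ true (code (enc x) ++ code (enc y) ++ s)) => //.
  by rewrite /= -catA.
by apply: exec_seq_le (exec_swap _ _ _) (exec_drop _ _) _ => //; lia.
Qed.

Lemma PT_sndP : PT (fun p : X * Y => p.2).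
Proof.
apply: (PT_le (c := (If RS Skip Skip drop_tree)) (t := fun p => (14 * sz p).+1)); first by auto 10 with pb.
case=> x y s.
have -> : sz (x, y) = (csize (enc x) + csize (enc y)).+1 by exact: csize_C.
apply: (@exec_if_cons RS _ _ _ _ true (code (enc x) ++ code (enc y) ++ s)) => //.
  by rewrite /= -catA.
by apply: exec_weaken (exec_drop _ _) => //; lia.
Qed.

Lemma PT_if (b : X -> bool) (f g : X -> Y) :
  PT b -> PT f -> PT g -> PT (fun x => if b x then f x else g x).
Proof.
case=> cb [tb [btb Hb]] [c [t [bt H]]] [c' [t' [bt' H']]].
apply: (PT_le (c := Seq dup_tree (Seq cb (If RS Skip c'
  (Seq drop_tree (Seq drop_tree c)))))
  (t := fun x => 30 * sz x + (tb x + (28 + t x + t' x).+1))); first by auto 20 with pb.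
move=> x s; apply: exec_seq (exec_dup _ _) _; apply: exec_seq (Hb x _) _.
rewrite /enc /enc_boolD; case: (b x).
  (* The code of [true] is a node over two leaves. The test pops the node bit, and dropping both
     leaves at 14 each accounts for the 28. *)
  apply: (@exec_if_cons RS _ _ _ _ true (code BLeaf ++ code BLeaf ++ code (enc x) ++ s)) => //.
  by apply: exec_seq_le (exec_drop _ _) (exec_seq (exec_drop _ _) (H x s)) _;
     rewrite /csize /=; lia.
apply: (@exec_if_cons RS _ _ _ _ false (code (enc x) ++ s)) => //.
by apply: exec_weaken (H' x s); lia.
Qed.

End Closure.

Section Primitives.
Variables (X Y Z : Type) (EX : Enc X) (EY : Enc Y) (EZ : Enc Z).

Lemma PT_fst (f : X -> Y * Z) : PT f -> PT (fun x => (f x).1).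
Proof. by move=> Pf; apply: PT_comp Pf (PT_fstP _ _). Qed.

Lemma PT_snd (f : X -> Y * Z) : PT f -> PT (fun x => (f x).2).
Proof. by move=> Pf; apply: PT_comp Pf (PT_sndP _ _). Qed.

Lemma PT_cons (f : X -> Y) (l : X -> seq Y) :
  PT f -> PT l -> PT (fun x => f x :: l x).
Proof. by move=> Pf Pl; apply: PT_castr (PT_pair Pf Pl). Qed.

Lemma PT_nilp (l : X -> seq Y) : PT l -> PT (fun x => nilp (l x)).
Proof.
move=> Pl; apply: (PT_comp (g := @nilp Y)) Pl _.
apply: (PT_le (c := If RS Skip push_true (Seq drop_tree (Seq drop_tree (Push RS false))))
  (t := fun l => 10 + 30 * sz l)); first by auto 10 with pb.
case=> [|y {}l] s.
  apply: (@exec_weaken _ _ 7); first by lia.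
  by apply: (@exec_if_cons RS _ _ _ _ false s) => //; exact: exec_push_true.
apply: (@exec_weaken _ _ (14 * csize (enc y) + (14 * csize (enc l) + 2)).+1).
  by rewrite /sz /enc /enc_seqD /= csize_C /enc; lia.
apply: (@exec_if_cons RS _ _ _ _ true (code (enc y) ++ code (enc l) ++ s)) => //.
  by rewrite /= -catA.
apply: exec_seq (exec_drop _ _) _; apply: exec_seq (exec_drop _ _) _.
exact: exec_push.
Qed.

Lemma PT_head y0 (l : X -> seq Y) : PT l -> PT (fun x => head y0 (l x)).
Proof.
move=> Pl; apply: (PT_comp (g := @head Y y0)) Pl _.
apply: (PT_le (c := If RS Skip (push_word (code (enc y0))) (Seq swap_tree drop_tree))
  (t := fun l => (2 * sz y0 + 1 + 34 * sz l).+1)); first by auto 10 with pb.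
case=> [|y {}l] s.
  apply: (@exec_if_cons RS _ _ _ _ false s) => //.
  by apply: exec_weaken (exec_push_word _ _); rewrite /sz /csize; lia.
have -> : sz (y :: l) = (csize (enc y) + csize (enc l)).+1 by exact: csize_C.
apply: (@exec_if_cons RS _ _ _ _ true (code (enc y) ++ code (enc l) ++ s)) => //.
  by rewrite /= -catA.
by apply: exec_seq_le (exec_swap _ _ _) (exec_drop _ _) _; lia.
Qed.

Lemma PT_behead (l : X -> seq Y) : PT l -> PT (fun x => behead (l x)).
Proof.
move=> Pl; apply: (PT_comp (g := @behead Y)) Pl _.
apply: (PT_le (c := If RS Skip (Push RS false) drop_tree)
  (t := fun l => (2 + 14 * sz l).+1)); first by auto 10 with pb.
case=> [|y {}l] s.
  apply: (@exec_if_cons RS _ _ _ _ false s) => //.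
  by apply: exec_push_le => //; lia.
have -> : sz (y :: l) = (csize (enc y) + csize (enc l)).+1 by exact: csize_C.
apply: (@exec_if_cons RS _ _ _ _ true (code (enc y) ++ code (enc l) ++ s)) => //.
  by rewrite /= -catA.
by apply: exec_weaken (exec_drop _ _); lia.
Qed.

End Primitives.

Lemma PT_eq (X : Type) (EX : Enc X) (Y : eqType) (EY : Enc Y) (f g : X -> Y) :
  injective (enc : Y -> bintree) -> PT f -> PT g -> PT (fun x => f x == g x).
Proof.
move=> inj Pf Pg.
apply: (PT_comp (g := fun p : Y * Y => p.1 == p.2) (PT_pair Pf Pg)).
apply: (PT_le (c := If RS Skip Skip eq_tree) (t := fun p => (50 * sz p).+1)).
  by auto 10 with pb.
case=> x y s.
have -> : sz (x, y) = (csize (enc x) + csize (enc y)).+1 by exact: csize_C.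
apply: (@exec_if_cons RS _ _ _ _ true (code (enc x) ++ code (enc y) ++ s)) => //.
  by rewrite /= -catA.
apply: (exec_weaken (m := 50 * (csize (enc x) + csize (enc y)))); first by lia.
by apply: exec_eq; split=> [/eqP/= ->|/inj ->].
Qed.

Lemma sz_pair {X Y : Type} {EX : Enc X} (EY : Enc Y) (x : X) (y : Y) :
  sz (x, y) = (sz x + sz y).+1.
Proof. exact: csize_C. Qed.

Lemma sz_cons {X : Type} {EX : Enc X} (x : X) l : sz (x :: l) = (sz x + sz l).+1.
Proof. exact: csize_C. Qed.

Lemma sz_gt0 {X : Type} {EX : Enc X} (x : X) : 0 < sz x.
Proof. exact: csize_gt0. Qed.

Lemma sz_nat n : sz n = n.*2.+1.
Proof.
rewrite /sz /enc /enc_natD; elim: n => // n IH.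
by rewrite [nseq _ _]/= csize_dlist_cons IH /csize /=; lia.
Qed.

Lemma sz_cat {X : Type} {EX : Enc X} (l1 l2 : seq X) :
  (sz (l1 ++ l2)).+1 = sz l1 + sz l2.
Proof. by elim: l1 => //= x l1 IH; rewrite !sz_cons; lia. Qed.

Lemma size_sz {X : Type} {EX : Enc X} (l : seq X) : (size l).*2 < sz l.
Proof. by elim: l => //= x l IH; rewrite sz_cons; pose proof (sz_gt0 x); lia. Qed.

(** Without the first hypothesis this fails: repeated doubling makes an accumulator exponential. One
    polynomial in the size of [x] must bound the accumulator after every prefix of the list. *)
Lemma PT_foldl (X A Y : Type) (EX : Enc X) (EA : Enc A) (EY : Enc Y)
    (g : X -> A -> Y -> A) (a : X -> A) (l : X -> seq Y) :
  (exists e, forall x l1 l2, l x = l1 ++ l2 ->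
     sz (foldl (g x) (a x) l1) <= peval e (sz x)) ->
  PT (fun p : X * A * Y => g p.1.1 p.1.2 p.2) -> PT a -> PT l ->
  PT (fun x => foldl (g x) (a x) (l x)).
Proof.
move=> [e He] [c [t [[et Ht] Hc]]] Pa Pl.
have bl := PT_size Pl.
(* The loop body sees only the accumulator and the current element, so [x] travels inside the
   accumulator. *)
pose f (xa : X * A) y := (xa.1, g xa.1 xa.2 y).
have fE x (a0 : A) l0 : foldl f (x, a0) l0 = (x, foldl (g x) a0 l0).
  by elim: l0 a0 => //= y l0 IH a0; rewrite IH.
have [c' [t' [[et' Ht'] Hc']]] :
    PT (fun p : (X * A) * Y => (p.1.1, g p.1.1 p.1.2 p.2)).
  apply: PT_pair; last by exists c, t; split=> //; exists et.
  by apply: PT_fst; apply: PT_fst; exact: PT_id.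
have [c0 [t0 [bt0 Hc0]]] : PT (fun x => ((x, a x), l x)).
  by apply: PT_pair => //; apply: PT_pair => //; exact: PT_id.
pose (b := fun x : X => (sz x + peval e (sz x)).+1).
pose (B := fun x : X => peval et' (b x + sz (l x)).+1 + (b x + sz (l x))).
have main : PT (fun x => foldl f (x, a x) (l x)).
  apply: (PT_le (c := Seq c0 (fold_tree c'))
    (t := fun x => t0 x + 210 * (sz (l x)).+1 * (B x).+1)).
    by apply: pbound_add => //; apply: pbound_mul; rewrite /B /b; auto 20 with pb.
  move=> x s; apply: exec_seq (Hc0 x s) _.
  have szf l1 l2 : l x = l1 ++ l2 -> sz (foldl f (x, a x) l1) <= b x.
    by move=> el; rewrite fE sz_pair /b ltnS leq_add2l; exact: He el.
  apply: (exec_weaken (m := 210 * (size (l x)).+1 * (B x).+1)).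
    by rewrite leq_pmul2r // leq_pmul2l //; pose proof (size_sz (l x)); lia.
  apply: (exec_fold (ea := enc) (a := (x, a x)) (l := l x)) => [l1 y l2 el s'|l1 l2 el|].
  - rewrite -cats1 foldl_cat /=.
    apply: exec_weaken (Hc' (foldl f (x, a x) l1, y) s').
    apply: leq_trans (Ht' _) _; apply: leq_trans (leq_addr _ _).
    apply: peval_mono; rewrite sz_pair ltnS leq_add ?(szf _ _ el) //.
    pose proof (H := sz_cat l1 (y :: l2)); rewrite -el sz_cons in H.
    by pose proof (sz_gt0 l1); pose proof (sz_gt0 l2); lia.
  - by apply: leq_trans (szf _ _ el) _; rewrite /B; lia.
  - have -> : csize (dlist [seq enc i | i <- l x]) = sz (l x) by [].
    by rewrite /B; lia.
apply: PT_castr (PT_snd main) => x.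
by rewrite fE.
Qed.

Create HintDb pt.
Hint Opaque orb andb negb addn subn muln has all map filter flatten iota nth drop take
  cat catrev rev size nseq nilp head behead eq_op in_mem foldl iter fst snd predn : pt.
Hint Resolve PT_id PT_pair PT_fst PT_snd PT_if PT_const PT_cons PT_nilp PT_head
  PT_behead PT_eq : pt.

Ltac pt := solve [eauto 100 with pt nocore].

Lemma sz_mem {Y : Type} {EY : Enc Y} (l l1 l2 : seq Y) y :
  l = l1 ++ y :: l2 -> sz y <= sz l.
Proof.
move=> ->; pose proof (H := sz_cat l1 (y :: l2)); rewrite sz_cons in H.
by pose proof (sz_gt0 l1); pose proof (sz_gt0 l2); lia.
Qed.

Lemma sz_prefix {Y : Type} {EY : Enc Y} (l l1 l2 : seq Y) :
  l = l1 ++ l2 -> sz l1 <= sz l.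
Proof.
by move=> ->; pose proof (sz_cat l1 l2); pose proof (sz_gt0 l2); lia.
Qed.

Lemma sz_suffix {Y : Type} {EY : Enc Y} (l l1 l2 : seq Y) :
  l = l1 ++ l2 -> sz l2 <= sz l.
Proof.
by move=> ->; pose proof (sz_cat l1 l2); pose proof (sz_gt0 l1); lia.
Qed.

Lemma size_prefix (Y : Type) (l l1 l2 : seq Y) : l = l1 ++ l2 -> size l1 <= size l.
Proof. by move=> ->; rewrite size_cat leq_addr. Qed.

Lemma sz_rev {Y : Type} {EY : Enc Y} (l : seq Y) : sz (rev l) = sz l.
Proof.
elim: l => // y l IH; rewrite rev_cons -cats1 sz_cons.
by pose proof (sz_cat (rev l) [:: y]); rewrite sz_cons in H;
   have : sz [::] = 1 by []; lia.
Qed.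

Lemma sz_map_le {Y Z : Type} {EZ : Enc Z} (h : Y -> Z) l B :
  (forall l1 y l2, l = l1 ++ y :: l2 -> sz (h y) <= B) ->
  sz (map h l) <= (size l * B.+1).+1.
Proof.
elim: l => //= y l IH H; rewrite sz_cons.
have := H [::] y l erefl.
have : sz (map h l) <= (size l * B.+1).+1.
  by apply: IH => l1 z l2 e; apply: (H (y :: l1) z l2); rewrite e.
by rewrite mulSn; lia.
Qed.

(** * Lists, iteration and arithmetic in polynomial time *)

Section Reversal.
Variables (X Y Z : Type) (EX : Enc X) (EY : Enc Y) (EZ : Enc Z).
Implicit Types l : X -> seq Y.

Lemma PT_catrev l (a : X -> seq Y) : PT l -> PT a -> PT (fun x => catrev (l x) (a x)).
Proof.
move=> Pl Pa; have bl := PT_size Pl; have ba := PT_size Pa.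
have E s t : foldl (fun acc y => y :: acc) t s = catrev s t :> seq Y.
  by elim: s t => //= y s IH t; rewrite IH.
have H : PT (fun x => foldl (fun acc y => y :: acc) (a x) (l x)).
  apply: PT_foldl => //; last by pt.
  have [e He] := pbound_add bl ba.
  exists e => x l1 l2 el; apply: leq_trans (He x); rewrite E catrevE.
  by pose proof (sz_cat (rev l1) (a x)); pose proof (sz_prefix el);
     pose proof (sz_rev l1); lia.
by apply: PT_castr H => x; rewrite E.
Qed.

Lemma PT_rev l : PT l -> PT (fun x => rev (l x)).
Proof. by move=> Pl; apply: PT_catrev => //; pt. Qed.

End Reversal.
Hint Resolve PT_catrev PT_rev : pt.

Section MapFilter.
Variables (X Y Z : Type) (EX : Enc X) (EY : Enc Y) (EZ : Enc Z).
Implicit Types l : X -> seq Y.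

Lemma PT_cat l (l' : X -> seq Y) : PT l -> PT l' -> PT (fun x => l x ++ l' x).
Proof.
move=> Pl Pl'; apply: (PT_castr (f := fun x => catrev (rev (l x)) (l' x))).
  by move=> x; rewrite catrevE revK.
by pt.
Qed.

Lemma PT_map (h : X -> Y -> Z) l :
  PT (fun p : X * Y => h p.1 p.2) -> PT l -> PT (fun x => map (h x) (l x)).
Proof.
move=> Ph Pl; have bl := PT_size Pl; have [e He] := PT_size Ph.
have E (f : Y -> Z) s t : foldl (fun acc y => f y :: acc) t s = catrev (map f s) t.
  by elim: s t => //= y s IH t; rewrite IH.
have H : PT (fun x => foldl (fun acc y => h x y :: acc) [::] (l x)).
  apply: PT_foldl => //; try by pt.
    pose (B := fun x => peval e (sz x + sz (l x)).+1).
    have [e' He'] : pbound (fun x => (sz (l x) * (B x).+1).+1).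
      by rewrite /B; auto 20 with pb.
    exists e' => x l1 l2 el; apply: leq_trans (He' x); rewrite E catrevE cats0 sz_rev.
    apply: leq_trans (@sz_map_le _ _ _ _ _ (B x) _) _.
      move=> l3 y l4 el'; apply: leq_trans (He (x, y)) _; apply: peval_mono.
      rewrite sz_pair ltnS leq_add2l; apply: sz_mem.
      by rewrite el el' -catA.
    rewrite ltnS leq_mul2r; apply/orP; right.
    by pose proof (size_sz l1); pose proof (sz_prefix el); lia.
  apply: PT_cons; last by pt.
  by apply: (PT_comp (f := fun p : X * seq Z * Y => (p.1.1, p.2))) Ph; pt.
apply: (PT_castr (f := fun x => rev (foldl (fun acc y => h x y :: acc) [::] (l x)))).
  by move=> x; rewrite E catrevE cats0 revK.
exact: PT_rev.
Qed.

Lemma PT_filter (h : X -> Y -> bool) l :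
  PT (fun p : X * Y => h p.1 p.2) -> PT l -> PT (fun x => filter (h x) (l x)).
Proof.
move=> Ph Pl; have [e He] := PT_size Pl.
have E (f : pred Y) s t :
    foldl (fun acc y => if f y then y :: acc else acc) t s = catrev (filter f s) t.
  by elim: s t => //= y s IH t; rewrite IH; case: (f y).
have H : PT (fun x => foldl (fun acc y => if h x y then y :: acc else acc) [::] (l x)).
  apply: PT_foldl => //; try by pt.
    exists e => x l1 l2 el; apply: leq_trans (He x); rewrite E catrevE cats0 sz_rev.
    apply: leq_trans (sz_prefix el) => {el}.
    elim: l1 => //= y l1 IH; rewrite sz_cons.
    by case: ifP => _; rewrite ?sz_cons; pose proof (sz_gt0 y); lia.
  apply: PT_if; try by pt.
  by apply: (PT_comp (f := fun p : X * seq Y * Y => (p.1.1, p.2))) Ph; pt.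
apply: (PT_castr (f := fun x => rev (foldl (fun acc y => if h x y then y :: acc else acc)
   [::] (l x)))).
  by move=> x; rewrite E catrevE cats0 revK.
exact: PT_rev.
Qed.

Lemma PT_or (b b' : X -> bool) : PT b -> PT b' -> PT (fun x => b x || b' x).
Proof. by move=> Pb Pb'; exact: (PT_if Pb (PT_const _ _ true) Pb'). Qed.

Lemma PT_and (b b' : X -> bool) : PT b -> PT b' -> PT (fun x => b x && b' x).
Proof. by move=> Pb Pb'; exact: (PT_if Pb Pb' (PT_const _ _ false)). Qed.

Lemma PT_neg (b : X -> bool) : PT b -> PT (fun x => ~~ b x).
Proof. by move=> Pb; exact: (PT_if Pb (PT_const _ _ false) (PT_const _ _ true)). Qed.

End MapFilter.
Hint Resolve PT_cat PT_map PT_filter PT_or PT_and PT_neg : pt.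

Section Iteration.
Variables (X Y Z : Type) (EX : Enc X) (EY : Enc Y) (EZ : Enc Z).
Implicit Types l : X -> seq Y.

Lemma PT_has (h : X -> Y -> bool) l :
  PT (fun p : X * Y => h p.1 p.2) -> PT l -> PT (fun x => has (h x) (l x)).
Proof.
move=> Ph Pl; apply: (PT_castr (f := fun x => ~~ nilp (filter (h x) (l x)))).
  by move=> x; rewrite has_count -size_filter /nilp lt0n.
by pt.
Qed.

Lemma PT_all (h : X -> Y -> bool) l :
  PT (fun p : X * Y => h p.1 p.2) -> PT l -> PT (fun x => all (h x) (l x)).
Proof.
move=> Ph Pl; apply: (PT_castr (f := fun x => ~~ has (fun y => ~~ h x y) (l x))).
  move=> x; congr enc.
  by elim: (l x) => //= y s ->; rewrite negb_or negbK.
by apply: PT_neg; apply: PT_has => //; apply: PT_neg.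
Qed.

Lemma PT_flatten (l : X -> seq (seq Y)) : PT l -> PT (fun x => flatten (l x)).
Proof.
move=> Pl; have [e He] := PT_size Pl.
have E s t : foldl cat t s = t ++ flatten s :> seq Y.
  by elim: s t => [|y s IH] t /=; rewrite ?cats0 // IH catA.
apply: (PT_castr (f := fun x => foldl (fun a b => a ++ b) [::] (l x))).
  by move=> x; rewrite E.
apply: PT_foldl; try by pt.
exists e => x l1 l2 el; apply: leq_trans (He x); rewrite E cat0s.
apply: leq_trans (sz_prefix el) => {el}.
elim: l1 => //= y l1 IH; rewrite sz_cons.
by pose proof (sz_cat y (flatten l1)); lia.
Qed.

Lemma PT_succ (n : X -> nat) : PT n -> PT (fun x => (n x).+1).
Proof. by move=> Pn; apply: PT_castr (PT_pair (PT_const _ _ tt) Pn). Qed.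

Lemma PT_nseq_tt (n : X -> nat) : PT n -> PT (fun x => nseq (n x) tt).
Proof. by apply: PT_castr => x; rewrite /enc /enc_seqD map_nseq. Qed.

Lemma PT_size_seq l : PT l -> PT (fun x => size (l x)).
Proof.
move=> Pl.
apply: (PT_castr (f := fun x => map (fun=> tt) (l x))); last by apply: PT_map; pt.
by move=> x; rewrite /enc /enc_seqD /enc_natD; elim: (l x) => //= y s ->.
Qed.

Lemma PT_iter (A : Type) (EA : Enc A) (n : X -> nat) (g : X -> A -> A) (a : X -> A) :
  (exists e, forall x j, j <= n x -> sz (iter j (g x) (a x)) <= peval e (sz x)) ->
  PT (fun p : X * A => g p.1 p.2) -> PT n -> PT a ->
  PT (fun x => iter (n x) (g x) (a x)).
Proof.
move=> [e He] Pg Pn Pa.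
have E f s (b : A) : foldl (fun a (_ : unit) => f a) b s = iter (size s) f b.
  by elim: s b => //= y s IH b; rewrite IH -iterSr.
apply: (PT_castr (f := fun x => foldl (fun a (_ : unit) => g x a) (a x) (nseq (n x) tt))).
  by move=> x; rewrite E size_nseq.
apply: PT_foldl => //; last exact: PT_nseq_tt.
  exists e => x l1 l2 el; rewrite E; apply: He.
  by have := size_prefix el; rewrite size_nseq.
by apply: (PT_comp (f := fun p : X * A * unit => p.1)) Pg; pt.
Qed.

End Iteration.
Hint Resolve PT_has PT_all PT_flatten PT_succ PT_size_seq : pt.

Section Indexing.
Variables (X Y Z : Type) (EX : Enc X) (EY : Enc Y) (EZ : Enc Z).
Implicit Types l : X -> seq Y.

Lemma PT_pred (n : X -> nat) : PT n -> PT (fun x => (n x).-1).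
Proof.
move=> Pn; apply: (PT_castr (f := fun x => size (behead (nseq (n x) tt)))).
  by move=> x; rewrite size_behead size_nseq.
by apply: PT_size_seq; apply: PT_behead; exact: PT_nseq_tt.
Qed.

Lemma PT_drop (n : X -> nat) l : PT n -> PT l -> PT (fun x => drop (n x) (l x)).
Proof.
move=> Pn Pl; have [e He] := PT_size Pl.
have E j s : iter j behead s = drop j s :> seq Y.
  by elim: j => [|j IH]; rewrite ?drop0 //= IH -drop1 drop_drop add1n.
apply: (PT_castr (f := fun x => iter (n x) behead (l x))) => [x|]; first by rewrite E.
apply: PT_iter => //; try by pt.
exists e => x j _; apply: leq_trans (He x); rewrite E.
by apply: (@sz_suffix _ _ _ (take j (l x))); rewrite cat_take_drop.
Qed.

Lemma PT_nth (y0 : Y) l (n : X -> nat) : PT l -> PT n -> PT (fun x => nth y0 (l x) (n x)).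
Proof.
move=> Pl Pn; apply: (PT_castr (f := fun x => head y0 (drop (n x) (l x)))).
  by move=> x; rewrite -nth0 nth_drop addn0.
by apply: PT_head; exact: PT_drop.
Qed.

Lemma PT_take (y0 : Y) (n : X -> nat) l : PT n -> PT l -> PT (fun x => take (n x) (l x)).
Proof.
move=> Pn Pl; have [e He] := PT_size Pl.
pose g (p : seq Y * seq Y) :=
  if nilp p.1 then p else (behead p.1, head y0 p.1 :: p.2).
have E j s : iter j g (s, [::]) = (drop j s, rev (take j s)).
  elim: j => [|j IH]; first by rewrite drop0 take0.
  rewrite iterS IH /g /= /nilp size_drop subn_eq0.
  case: leqP => le; first by rewrite !drop_oversize ?take_oversize // leqW.
  by rewrite -drop1 drop_drop add1n -nth0 nth_drop addn0 (take_nth y0 le) rev_rcons.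
apply: (PT_castr (f := fun x => rev (iter (n x) g (l x, [::])).2)) => [x|].
  by rewrite E revK.
apply: PT_rev; apply: PT_snd; apply: PT_iter => //; try by rewrite /g; pt.
have [e' He'] : pbound (fun x => (sz (l x)).*2.+2).
  apply: (@pbound_le _ _ _ (fun x => (sz (l x) + sz (l x)).+2)).
    by move=> x; rewrite addnn.
  by apply: pbound_succ; apply: pbound_succ; apply: pbound_add; exists e.
exists e' => x j _; apply: leq_trans (He' x); rewrite E sz_pair sz_rev.
pose proof (sz_cat (take j (l x)) (drop j (l x))); rewrite cat_take_drop in H.
by lia.
Qed.

Lemma PT_add (m n : X -> nat) : PT m -> PT n -> PT (fun x => m x + n x).
Proof.
move=> Pm Pn.
apply: (PT_castr (f := fun x => size (nseq (m x) tt ++ nseq (n x) tt))).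
  by move=> x; rewrite size_cat !size_nseq.
by apply: PT_size_seq; apply: PT_cat; exact: PT_nseq_tt.
Qed.

Lemma PT_nseq (n : X -> nat) (f : X -> Y) :
  PT n -> PT f -> PT (fun x => nseq (n x) (f x)).
Proof.
move=> Pn Pf; apply: (PT_castr (f := fun x => map (fun=> f x) (nseq (n x) tt))).
  by move=> x; rewrite map_nseq.
apply: PT_map; last exact: PT_nseq_tt.
by apply: (PT_comp (f := fun p : X * unit => p.1)) Pf; pt.
Qed.

End Indexing.

Section Arithmetic.
Variables (X : Type) (EX : Enc X).

Lemma PT_mul (m n : X -> nat) : PT m -> PT n -> PT (fun x => m x * n x).
Proof.
move=> Pm Pn.
apply: (PT_castr (f := fun x => size (flatten (nseq (m x) (nseq (n x) tt))))).
  move=> x; congr enc; rewrite size_flatten /shape map_nseq size_nseq.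
  by rewrite sumn_nseq mulnC.
by apply: PT_size_seq; apply: PT_flatten; apply: PT_nseq => //; exact: PT_nseq_tt.
Qed.

Lemma PT_iota (n : X -> nat) : PT n -> PT (fun x => iota 0 (n x)).
Proof.
move=> Pn; have bn := PT_size Pn.
pose g (s : seq nat) := size s :: s.
have E j : iter j g [::] = rev (iota 0 j).
  elim: j => // j IH.
  by rewrite iterS IH /g size_rev size_iota -[j.+1]addn1 iotaD rev_cat.
apply: (PT_castr (f := fun x => rev (iter (n x) g [::]))) => [x|].
  by rewrite E revK.
apply: PT_rev; apply: PT_iter => //; try by rewrite /g; pt.
have [e He] : pbound (fun x => (sz (n x) * (sz (n x)).+1).+1) by auto 10 with pb.
exists e => x j lj; apply: leq_trans (He x); rewrite E sz_rev -[iota 0 j]map_id.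
apply: leq_trans (@sz_map_le _ _ _ _ _ (sz (n x)) _) _.
  move=> l1 y l2 el; rewrite !sz_nat ltnS leq_double.
  have : y \in iota 0 j by rewrite el mem_cat inE eqxx orbT.
  by rewrite mem_iota; lia.
by rewrite ltnS size_iota leq_mul2r sz_nat; apply/orP; right; lia.
Qed.

End Arithmetic.
Hint Resolve PT_pred PT_drop PT_nth PT_add PT_mul PT_nseq PT_iota : pt.

Lemma enc_inj_nat : injective (enc : nat -> bintree).
Proof.
by move=> m n /(congr1 csize); rewrite -![csize _]/(sz _) !sz_nat => -[]; lia.
Qed.

Lemma enc_inj_seq (Y : Type) (EY : Enc Y) :
  injective (enc : Y -> bintree) -> injective (enc : seq Y -> bintree).
Proof.
move=> inj; elim=> [|x l IH] [|y l'] //= [/inj -> e]; congr (_ :: _).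
exact: IH.
Qed.

Lemma enc_inj_pair (Y Z : Type) (EY : Enc Y) (EZ : Enc Z) :
  injective (enc : Y -> bintree) -> injective (enc : Z -> bintree) ->
  injective (enc : Y * Z -> bintree).
Proof. by move=> injY injZ [y z] [y' z'] [/injY /= -> /injZ /= ->]. Qed.
Hint Extern 1 (injective _) => solve [exact: enc_inj_nat] : pt.
Hint Extern 2 (injective _) => apply: enc_inj_seq : pt.
Hint Extern 2 (injective _) => apply: enc_inj_pair : pt.

Lemma PT_mem (X : Type) (EX : Enc X) (Y : eqType) (EY : Enc Y) (f : X -> Y)
    (l : X -> seq Y) :
  injective (enc : Y -> bintree) -> PT f -> PT l -> PT (fun x => f x \in l x).
Proof.
move=> inj Pf Pl; apply: (PT_castr (f := fun x => has (fun y => y == f x) (l x))).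
  by move=> x; rewrite has_pred1.
apply: PT_has => //; apply: PT_eq => //; first by pt.
by apply: (PT_comp (f := fun p : X * Y => p.1)) Pf; pt.
Qed.
Hint Resolve PT_mem : pt.

(** * Values of formulas and terms *)

HB.instance Definition _ := Equality.copy bintree (inj_type code_inj).

(** Grammar trees without dependent types. The first number of a label is 2 for a symbol of the
    alphabet and 1 for a nonterminal; the list is the code of the symbol or the index of the
    nonterminal. *)
Inductive rt : Type := RNode of nat * seq nat & seq rt.

Definition lab (t : rt) : nat * seq nat := let: RNode l _ := t in l.
Definition sub (t : rt) : seq rt := let: RNode _ s := t in s.

Fixpoint enc_rt (t : rt) : bintree := let: RNode l s := t in BNode (enc l) (dlist (map enc_rt s)).
Instance enc_rtD : Enc rt := enc_rt.

(** Subtrees are located by splitting the list, since list membership would need the decidable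
    equality that is derived with the help of this principle. *)
Lemma rt_ind' (P : rt -> Prop) :
  (forall l s, (forall s1 t s2, s = s1 ++ t :: s2 -> P t) -> P (RNode l s)) ->
  forall t, P t.
Proof.
move=> H; fix IH 1 => -[l s]; apply: H.
pose fix all_sub (s : seq rt) : foldr (fun t Q => P t /\ Q) True s :=
  if s is t :: s' return foldr (fun t Q => P t /\ Q) True s
  then conj (IH t) (all_sub s') else I.
move: (all_sub s) => {all_sub} all_s s1 t s2 es; rewrite {}es in all_s.
by elim: s1 all_s => [|u s1 IHs] [].
Qed.

Lemma enc_inj_rt : injective (enc : rt -> bintree).
Proof.
have inj : injective (enc : nat * seq nat -> bintree).
  by apply: enc_inj_pair; [|apply: enc_inj_seq]; exact: enc_inj_nat.
elim/rt_ind' => l s IH [l' s'] E.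
have /inj -> : enc l = enc l' := congr1 (fun d => if d is BNode a _ then a else BLeaf) E.
have {E} := congr1 (fun d => if d is BNode _ b then b else BLeaf) E.
rewrite [LHS]/= [RHS]/= => e; congr RNode.
elim: s s' IH e => [|t s IHs] [|t' s'] //= IH [e1 e2].
congr (_ :: _); first exact: (IH [::] t s).
by apply: IHs => // s1 u s2 es; apply: (IH (t :: s1) u s2); rewrite es.
Qed.
Hint Extern 1 (injective _) => solve [exact: enc_inj_rt] : pt.

HB.instance Definition _ := Equality.copy rt (inj_type enc_inj_rt).

Section RT_PT.
Variables (X : Type) (EX : Enc X).

Lemma PT_lab (t : X -> rt) : PT t -> PT (fun x => lab (t x)).
Proof.
move=> Pt; apply: (PT_comp (g := lab)) Pt _.
apply: (PT_cast (h := fun t => (lab t, sub t))) (PT_fstP _ _) => [[]|] //.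
Qed.

Lemma PT_sub (t : X -> rt) : PT t -> PT (fun x => sub (t x)).
Proof.
move=> Pt; apply: (PT_comp (g := sub)) Pt _.
apply: (PT_cast (h := fun t => (lab t, sub t))) (PT_sndP _ _) => [[]|] //.
Qed.

Lemma PT_RT (l : X -> nat * seq nat) (s : X -> seq rt) :
  PT l -> PT s -> PT (fun x => RNode (l x) (s x)).
Proof. by move=> Pl Ps; apply: PT_castr (PT_pair Pl Ps). Qed.

End RT_PT.
Hint Resolve PT_lab PT_sub PT_RT : pt.

(* A structure is its greatest element with a table of all its relations and
   functions, keyed by symbol code and arguments; a value is the sort (0 for
   formulas, 1 for terms), the free variables, and the denotation at each point;
   an entry of the saturation is a tree of the grammar, a value derivable from it
   and a node of the term graph. *)
Notation rstruct := (nat * seq (seq nat * nat))%type.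
Notation point := (rstruct * seq nat)%type.
Notation value := ((nat * seq nat) * seq (point * nat))%type.
Notation node := (seq nat * seq nat)%type.
Notation entry := ((rt * value) * node)%type.

Definition lookup (K : eqType) (k0 k : K) (l : seq (K * nat)) : nat :=
  (head (k0, 0) [seq q <- l | q.1 == k]).2.

Lemma PT_lookup (X : Type) (EX : Enc X) (K : eqType) (EK : Enc K) (k0 : K)
    (k : X -> K) (l : X -> seq (K * nat)) :
  injective (enc : K -> bintree) -> PT k -> PT l -> PT (fun x => lookup k0 (k x) (l x)).
Proof.
move=> inj Pk Pl; rewrite /lookup; apply: PT_snd; apply: PT_head.
apply: PT_filter => //; apply: PT_eq => //; first by pt.
by apply: (PT_comp (f := fun p : X * (K * nat) => p.1)) Pk; pt.
Qed.

Lemma PT_lookup_table (X : Type) (EX : Enc X) (k0 : seq nat)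
    (k : X -> seq nat) (l : X -> seq (seq nat * nat)) :
  PT k -> PT l -> PT (fun x => lookup k0 (k x) (l x)).
Proof. by apply: PT_lookup; apply: enc_inj_seq; exact: enc_inj_nat. Qed.
Hint Resolve PT_lookup_table : pt.

Definition point0 : point := ((0, [::]), [::]).
Definition value0 : value := ((0, [::]), [::]).
Definition vget (p : point) (v : value) : nat := lookup point0 p v.2.

Section Algebra.
Variable k : nat.

Fixpoint asg (j d : nat) : seq (seq nat) :=
  if j is j'.+1 then flatten [seq [seq i :: e | e <- asg j' d] | i <- iota 0 d.+1]
  else [:: [::]].

Definition points (As : seq rstruct) : seq point :=
  flatten [seq [seq (A, e) | e <- asg k A.1] | A <- As].

Definition upd (e : seq nat) (x d : nat) : seq nat :=
  [seq if y == x then d else nth 0 e y | y <- iota 0 k].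

(** Tags are numbered as in [enc_symb], and truth values are 0 and 1. Relations and functions need
    no distinction: [c] followed by the arguments is the key of the table in either case. *)
Definition gval (c : seq nat) (vs : seq value) (p : point) : nat :=
  if (head 0 c == 0) || (head 0 c == 1) then
    lookup [::] (c ++ [seq vget p v | v <- vs]) p.1.2
  else if head 0 c == 2 then
    if vget p (nth value0 vs 0) == 1 then vget p (nth value0 vs 1)
    else vget p (nth value0 vs 2)
  else if head 0 c == 3 then
    if vget p (nth value0 vs 0) == 1 then vget p (nth value0 vs 1) else 0
  else if head 0 c == 4 then
    if vget p (nth value0 vs 0) == 1 then 1 else vget p (nth value0 vs 1)
  else if head 0 c == 5 then
    if vget p (nth value0 vs 0) == 1 then 0 else 1
  else if head 0 c == 6 then
    if all (fun d => vget (p.1, upd p.2 (nth 0 c 1) d) (nth value0 vs 0) == 1)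
         (iota 0 p.1.1.+1) then 1 else 0
  else if head 0 c == 7 then
    if has (fun d => vget (p.1, upd p.2 (nth 0 c 1) d) (nth value0 vs 0) == 1)
         (iota 0 p.1.1.+1) then 1 else 0
  else nth 0 p.2 (nth 0 c 1).

Definition gfv (c : seq nat) (vs : seq value) : seq nat :=
  [seq y <- iota 0 k |
    if head 0 c == 8 then y == nth 0 c 1
    else has (fun v : value => y \in v.1.2) vs
         && ~~ (((head 0 c == 6) || (head 0 c == 7)) && (y == nth 0 c 1))].

Definition rsort (tag : nat) : nat :=
  if [|| tag == 1, tag == 2 | tag == 8] then 1 else 0.

Definition esorts (tag n : nat) : seq nat :=
  if (tag == 0) || (tag == 1) then nseq n 1
  else nth [::] [:: [::]; [::]; [:: 0; 1; 1]; [:: 0; 0]; [:: 0; 0]; [:: 0];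
                   [:: 0]; [:: 0]; [::]] tag.

(** The test that keeps ill-sorted trees of the grammar from receiving a value. *)
Definition okc (c : seq nat) (vs : seq value) : bool :=
  [seq v.1.1 | v : value <- vs] == esorts (head 0 c) (size vs).

Definition combine (pts : seq point) (c : seq nat) (vs : seq value) : value :=
  ((rsort (head 0 c), gfv c vs), [seq (p, gval c vs p) | p <- pts]).

(** The induction on [j] builds a separate program for each [j], with a bound whose degree may grow
    with [j]; this is where [k] has to be fixed. *)
Lemma PT_asg (X : Type) (EX : Enc X) j (d : X -> nat) : PT d -> PT (fun x => asg j (d x)).
Proof.
move=> Pd; apply: (PT_comp (g := asg j)) Pd _.
elim: j => [|j IH]; first by rewrite /=; pt.
apply: (PT_castr (f := fun d =>
  flatten [seq [seq i :: e | e <- asg j d] | i <- iota 0 d.+1])) => //.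
apply: PT_flatten; apply: PT_map; last by pt.
apply: PT_map; first by pt.
by apply: (PT_comp (f := fun p : nat * nat => p.1)) IH; pt.
Qed.
Hint Resolve PT_asg : pt.

Lemma PT_points (X : Type) (EX : Enc X) (As : X -> seq rstruct) :
  PT As -> PT (fun x => points (As x)).
Proof. by move=> PA; apply: (PT_comp (g := points)) PA _; rewrite /points; pt. Qed.
Hint Resolve PT_points : pt.

Lemma PT_vget (X : Type) (EX : Enc X) (p : X -> point) (v : X -> value) :
  PT p -> PT v -> PT (fun x => vget (p x) (v x)).
Proof.
move=> Pp Pv; apply: PT_lookup => //; last by pt.
have iS := enc_inj_seq enc_inj_nat.
exact: enc_inj_pair (enc_inj_pair enc_inj_nat
  (enc_inj_seq (enc_inj_pair iS enc_inj_nat))) iS.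
Qed.
Hint Resolve PT_vget : pt.

Lemma PT_upd (X : Type) (EX : Enc X) (e : X -> seq nat) (y d : X -> nat) :
  PT e -> PT y -> PT d -> PT (fun x => upd (e x) (y x) (d x)).
Proof.
move=> Pe Py Pd.
apply: (PT_comp (g := fun p => upd p.1.1 p.1.2 p.2) (PT_pair (PT_pair Pe Py) Pd)).
by rewrite /upd; pt.
Qed.
Hint Resolve PT_upd : pt.

Lemma PT_gval (X : Type) (EX : Enc X) (c : X -> seq nat) (vs : X -> seq value)
    (p : X -> point) :
  PT c -> PT vs -> PT p -> PT (fun x => gval (c x) (vs x) (p x)).
Proof.
move=> Pc Pvs Pp.
apply: (PT_comp (g := fun q => gval q.1.1 q.1.2 q.2) (PT_pair (PT_pair Pc Pvs) Pp)).
by rewrite /gval; repeat (apply: PT_if; first by pt); pt.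
Qed.
Hint Resolve PT_gval : pt.

Lemma PT_combine (X : Type) (EX : Enc X) (pts : X -> seq point) (c : X -> seq nat)
    (vs : X -> seq value) :
  PT pts -> PT c -> PT vs -> PT (fun x => combine (pts x) (c x) (vs x)).
Proof.
move=> Pp Pc Pvs.
apply: (PT_comp (g := fun q => combine q.1.1 q.1.2 q.2) (PT_pair (PT_pair Pp Pc) Pvs)).
by rewrite /combine /gfv /rsort; pt.
Qed.
Hint Resolve PT_combine : pt.

Lemma PT_okc (X : Type) (EX : Enc X) (c : X -> seq nat) (vs : X -> seq value) :
  PT c -> PT vs -> PT (fun x => okc (c x) (vs x)).
Proof.
move=> Pc Pvs.
apply: (PT_comp (g := fun q => okc q.1 q.2) (PT_pair Pc Pvs)).
by rewrite /okc /esorts; pt.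
Qed.
Hint Resolve PT_okc : pt.

End Algebra.

(** * Saturation *)

Hint Opaque lookup vget asg points upd gval gfv combine rsort esorts okc : pt.

(* Entries are numbered from the oldest, which is last in the list. *)
Fixpoint numbered (W : seq entry) : seq (entry * nat) :=
  if W is en :: W' then (en, size W') :: numbered W' else [::].

Lemma size_numbered W : size (numbered W) = size W.
Proof. by elim: W => //= en W ->. Qed.

Lemma PT_numbered (X : Type) (EX : Enc X) (W : X -> seq entry) :
  PT W -> PT (fun x => numbered (W x)).
Proof.
move=> PW; have bW := PT_size PW.
have E W1 W2 : foldl (fun acc (en : entry) => (en, size acc) :: acc) (numbered W2) W1 =
    numbered (catrev W1 W2).
  elim: W1 W2 => //= en W1 IH W2.
  by rewrite -IH /= size_numbered.
apply: (PT_castr (f := fun x =>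
    foldl (fun acc (en : entry) => (en, size acc) :: acc) [::] (rev (W x)))).
  by move=> x; rewrite (E _ [::]) catrevE revK cats0.
apply: PT_foldl; try by pt.
have szn W1 : sz (numbered W1) <= (sz W1).+1 * (sz W1).+1.
  elim: W1 => // en W1 IH; rewrite [numbered _]/= !sz_cons sz_pair sz_nat.
  by pose proof (size_sz W1); nia.
have [e He] : pbound (fun x => (sz (W x)).+1 * (sz (W x)).+1) by auto 10 with pb.
exists e => x l1 l2 el; apply: leq_trans (He x).
rewrite (E _ [::]) catrevE cats0; apply: leq_trans (szn _) _.
have le : sz (rev l1) <= sz (W x).
  by rewrite sz_rev; apply: leq_trans (sz_prefix el) _; rewrite sz_rev.
by apply: leq_mul.
Qed.
Hint Resolve PT_numbered : pt.

(** The recursion is on a bound [m] for the number of children rather than on [ts], so that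
    [PT_tuples] can build one program for each [m]. There are at most [size WI ^ m] tuples, and [m]
    will be a bound on the arities. *)
Fixpoint tuples (m : nat) (ts : seq rt) (WI : seq (entry * nat)) :
    seq (seq (value * nat)) :=
  if nilp ts then [:: [::]] else
  if m is m'.+1 then
    flatten [seq [seq (wi.1.1.2, wi.2) :: tp | tp <- tuples m' (behead ts) WI]
            | wi <- [seq wi : entry * nat <- WI | wi.1.1.1 == head (RNode (0, [::]) [::]) ts]]
  else [::].

Hint Opaque numbered tuples : pt.

Lemma PT_tuples (X : Type) (EX : Enc X) m (ts : X -> seq rt) (WI : X -> seq (entry * nat)) :
  PT ts -> PT WI -> PT (fun x => tuples m (ts x) (WI x)).
Proof.
move=> Pt PW.
apply: (PT_comp (g := fun p => tuples m p.1 p.2) (PT_pair Pt PW)).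
elim: m {ts WI Pt PW} => [|m IH] /=; first by pt.
apply: PT_if; [by pt|by pt|].
apply: PT_flatten; apply: PT_map; last by pt.
apply: PT_map; first by pt.
apply: (PT_comp (f := fun p : (seq rt * seq (entry * nat)) * (entry * nat) =>
  (behead p.1.1, p.1.2))) IH; by pt.
Qed.
Hint Resolve PT_tuples : pt.

Section Saturation.
Variables (k m : nat).

Definition leaf_rt (b : nat) : rt := RNode (1, [:: b]) [::].

(** Nonterminals leave no trace in a term graph, so the entry for a left-hand side repeats the node
    of the entry for the right-hand side instead of pointing to it. *)
Definition chain_cands (rules : seq (nat * rt)) (W : seq entry) : seq entry :=
  flatten [seq [seq ((leaf_rt r.1, en.1.2), en.2) | en : entry <- W & en.1.1 == r.2]
          | r : nat * rt <- rules].

Definition node_cands (pts : seq point) (subs : seq rt) (W : seq entry) : seq entry :=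
  flatten [seq [seq ((t, combine k pts (lab t).2 [seq q.1 | q <- tp]),
                     ((lab t).2, [seq q.2 | q <- tp]))
               | tp <- tuples m (sub t) (numbered W) & okc (lab t).2 [seq q.1 | q <- tp]]
          | t <- subs & (lab t).1 == 2].

(** Novelty is judged by the tree and the value alone: entries that differ only in their nodes are
    interchangeable, and counting nodes as well would destroy the bound on the number of entries. *)
Definition sat_step (pts : seq point) (G : seq (nat * rt) * seq rt) (W : seq entry) :
    seq entry :=
  let new := [seq en : entry <- chain_cands G.1 W ++ node_cands pts G.2 W
             | ~~ has (fun en' : entry => en'.1 == en.1) W] in
  if nilp new then W else head ((leaf_rt 0, value0), ([::], [::])) new :: W.

Hint Opaque chain_cands node_cands sat_step : pt.

Lemma PT_chain_cands (X : Type) (EX : Enc X) (r : X -> seq (nat * rt)) (W : X -> seq entry) :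
  PT r -> PT W -> PT (fun x => chain_cands (r x) (W x)).
Proof.
move=> Pr PW.
apply: (PT_comp (g := fun p => chain_cands p.1 p.2) (PT_pair Pr PW)).
by rewrite /chain_cands /leaf_rt; pt.
Qed.
Hint Resolve PT_chain_cands : pt.

Hint Resolve PT_okc PT_combine : pt.

Lemma PT_node_cands (X : Type) (EX : Enc X) (pts : X -> seq point) (subs : X -> seq rt)
    (W : X -> seq entry) :
  PT pts -> PT subs -> PT W -> PT (fun x => node_cands (pts x) (subs x) (W x)).
Proof.
move=> Pp Ps PW.
apply: (PT_comp (g := fun p => node_cands p.1.1 p.1.2 p.2) (PT_pair (PT_pair Pp Ps) PW)).
rewrite /node_cands; apply: PT_flatten; apply: PT_map; last by pt.
apply: PT_map; last by pt.
by pt.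
Qed.
Hint Resolve PT_node_cands : pt.

Lemma PT_sat_step (X : Type) (EX : Enc X) (pts : X -> seq point)
    (G : X -> seq (nat * rt) * seq rt) (W : X -> seq entry) :
  PT pts -> PT G -> PT W -> PT (fun x => sat_step (pts x) (G x) (W x)).
Proof.
move=> Pp PG PW.
apply: (PT_comp (g := fun p => sat_step p.1.1 p.1.2 p.2) (PT_pair (PT_pair Pp PG) PW)).
have P : PT (fun p : seq point * (seq (nat * rt) * seq rt) * seq entry =>
    [seq en : entry <- chain_cands p.1.2.1 p.2 ++ node_cands p.1.1 p.1.2.2 p.2
    | ~~ has (fun en' : entry => en'.1 == en.1) p.2]).
  apply: PT_filter; last by pt.
  by pt.
by apply: PT_if; [apply: PT_nilp|pt|apply: PT_cons; [apply: PT_head|pt]].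
Qed.
Hint Resolve PT_sat_step : pt.

(** Not being a model means that some assignment falsifies, hence [has] over the points of each
    negative structure separately. *)
Definition accepting (pos neg : seq rstruct) (b : nat) (en : entry) : bool :=
  [&& en.1.1 == leaf_rt b, en.1.2.1.1 == 0, nilp en.1.2.1.2,
      all (fun p => vget p en.1.2 == 1) (points k pos)
    & all (fun B => has (fun p => vget p en.1.2 == 0) (points k [:: B])) neg].

(** Discarding the entries newer than the accepting one makes its node the last of the graph, that
    is, the root; the nodes that remain never point to discarded ones. *)
Fixpoint drop_until (a : pred entry) (W : seq entry) : seq entry :=
  if W is en :: W' then if a en then W else drop_until a W' else [::].

Definition enc_node (nd : node) : seq bool :=
  flatten [seq enc_nat n | n <- nd.1 ++ nd.2].

Definition answer (pos neg : seq rstruct) (b : nat) (W : seq entry) : seq bool :=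
  let W' := drop_until (accepting pos neg b) W in
  if nilp W' then [:: false]
  else true :: enc_nat (size W') ++ flatten [seq enc_node en.2 | en : entry <- rev W'].

Hint Resolve PT_points PT_vget : pt.
Hint Opaque accepting drop_until enc_node enc_nat answer : pt.

Lemma PT_accepting (X : Type) (EX : Enc X) (pos neg : X -> seq rstruct) (b : X -> nat)
    (en : X -> entry) :
  PT pos -> PT neg -> PT b -> PT en ->
  PT (fun x => accepting (pos x) (neg x) (b x) (en x)).
Proof.
move=> Pp Pn Pb Pe.
apply: (PT_comp (g := fun p => accepting p.1.1.1 p.1.1.2 p.1.2 p.2)
  (PT_pair (PT_pair (PT_pair Pp Pn) Pb) Pe)).
by rewrite /accepting /leaf_rt; repeat (apply: PT_and; first by pt); pt.
Qed.
Hint Resolve PT_accepting : pt.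

Lemma PT_enc_nat (X : Type) (EX : Enc X) (n : X -> nat) :
  PT n -> PT (fun x => enc_nat (n x)).
Proof.
move=> Pn; apply: (PT_castr (f := fun x => nseq (n x) true ++ [:: false])); last by pt.
by move=> x; rewrite cats1.
Qed.
Hint Resolve PT_enc_nat : pt.

Lemma drop_until_suffix a W : exists W1, W = W1 ++ drop_until a W.
Proof.
elim: W => [|en W [W1 E]]; first by exists [::].
rewrite [drop_until _ _]/=; case: ifP => _; first by exists [::].
by exists (en :: W1); rewrite {1}E.
Qed.

Lemma PT_drop_until (X : Type) (EX : Enc X) (a : X -> pred entry) (W : X -> seq entry) :
  PT (fun p : X * entry => a p.1 p.2) -> PT W -> PT (fun x => drop_until (a x) (W x)).
Proof.
move=> Pa PW; have bW := PT_size PW.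
pose g (a : pred entry) W1 := if nilp W1 then W1 else
  if a (head ((leaf_rt 0, value0), ([::], [::])) W1) then W1 else behead W1.
have E a0 n W1 : size W1 <= n -> iter n (g a0) W1 = drop_until a0 W1.
  have fixp n1 W2 : g a0 W2 = W2 -> iter n1 (g a0) W2 = W2.
    by move=> h; elim: n1 => //= n1 ->.
  elim: n W1 => [|n IH] [|en W1] //= le.
    by rewrite -iterS fixp.
  rewrite -iterS iterSr {2}/g /=; case: ifP => h; last exact: IH.
  by rewrite fixp // /g /= h.
have suf a0 n W1 : exists W2, W1 = W2 ++ iter n (g a0) W1.
  elim: n => [|n [W2 IH]]; first by exists [::].
  rewrite iterS; move: (iter n (g a0) W1) IH => [|en W3] ->.
    by exists W2; rewrite /g.
  rewrite /g /=; case: ifP => _; first by exists W2.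
  by exists (rcons W2 en); rewrite cat_rcons.
apply: (PT_castr (f := fun x => iter (size (W x)) (g (a x)) (W x))).
  by move=> x; rewrite E.
apply: PT_iter => //; last by pt.
  have [e He] := bW; exists e => x j _; apply: leq_trans (He x).
  by have [W2 /sz_suffix] := suf (a x) j (W x).
apply: PT_if; [by pt|by pt|].
apply: PT_if; [|by pt|by pt].
by apply: (PT_comp (f := fun p : X * seq entry =>
  (p.1, head ((leaf_rt 0, value0), ([::], [::])) p.2))) Pa; pt.
Qed.

Lemma PT_answer (X : Type) (EX : Enc X) (pos neg : X -> seq rstruct) (b : X -> nat)
    (W : X -> seq entry) :
  PT pos -> PT neg -> PT b -> PT W ->
  PT (fun x => answer (pos x) (neg x) (b x) (W x)).
Proof.
move=> Pp Pn Pb PW.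
apply: (PT_comp (g := fun p => answer p.1.1.1 p.1.1.2 p.1.2 p.2)
  (PT_pair (PT_pair (PT_pair Pp Pn) Pb) PW)).
have P : PT (fun p : seq rstruct * seq rstruct * nat * seq entry =>
    drop_until (accepting p.1.1.1 p.1.1.2 p.1.2) p.2).
  by apply: PT_drop_until; pt.
have P' : PT (fun p : seq rstruct * seq rstruct * nat * seq entry =>
    rev (drop_until (accepting p.1.1.1 p.1.1.2 p.1.2) p.2)) by exact: PT_rev.
apply: PT_if; [exact: PT_nilp|by pt|].
apply: PT_cons; first by pt.
apply: PT_cat; first by apply: PT_enc_nat; exact: PT_size_seq.
by apply: PT_flatten; apply: PT_map => //; rewrite /enc_node; pt.
Qed.

End Saturation.

(** * Decoding the input *)

(* Reading the input as a list of unary numbers; a bit that stands alone merges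
   with the number that follows it, which is undone by [pbit]. *)
Fixpoint tok (w : seq bool) : seq nat :=
  if w is b :: w' then
    if b then (head 0 (tok w')).+1 :: behead (tok w') else 0 :: tok w'
  else [::].

Lemma tok_nat n w : tok (enc_nat n ++ w) = n :: tok w.
Proof. by elim: n => //= n ->. Qed.

Lemma tok_nil w : (tok w == [::]) = (w == [::]).
Proof. by case: w => [|[] w]. Qed.

Lemma PT_tok (X : Type) (EX : Enc X) (w : X -> seq bool) :
  PT w -> PT (fun x => tok (w x)).
Proof.
move=> Pw; have bw := PT_size Pw.
pose g (l : seq nat) (b : bool) := if b then (head 0 l).+1 :: behead l else 0 :: l.
have E w1 w2 : foldl g (tok w2) w1 = tok (catrev w1 w2).
  by elim: w1 w2 => //= b w1 IH w2; rewrite -IH.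
apply: (PT_castr (f := fun x => foldl g [::] (rev (w x)))).
  by move=> x; rewrite (E _ [::]) catrevE revK cats0.
apply: PT_foldl; try by rewrite /g; pt.
have szt w1 : sz (tok w1) <= 3 * sz w1.
  elim: w1 => // b w1 IH; rewrite sz_cons [tok _]/=.
  have : 0 < sz b by exact: sz_gt0.
  case: b => _.
    case: (tok w1) IH => [|n l] /=; rewrite !sz_cons !sz_nat ?doubleS.
      by have -> : sz ([::] : seq nat) = 1 by []; lia.
    by lia.
  by rewrite sz_cons sz_nat; lia.
have [e He] : pbound (fun x => 3 * sz (w x)) by auto with pb.
exists e => x l1 l2 el; apply: leq_trans (He x).
rewrite (E _ [::]) catrevE cats0; apply: leq_trans (szt _) _.
rewrite leq_pmul2l // sz_rev; apply: leq_trans (sz_prefix el) _.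
by rewrite sz_rev.
Qed.

(** * Parsers with controlled sizes *)

Notation parser Y := (seq nat -> Y * seq nat).

(* The inequality charges the size of the result to the part of the stream that was
   read; it keeps the intermediate results of an iterated parser polynomial. *)
Definition tame (Y : Type) (EY : Enc Y) (p : parser Y) : Prop :=
  PT p /\ exists K d, forall s,
    sz (p s).1 + K * sz (p s).2 <= K * sz s + d /\ sz (p s).2 <= sz s.
Arguments tame {Y EY} p.

(** Progress in every round bounds how often an iterated parser can incur the additive constant of
    [tame]. *)
Definition strict (Y : Type) (p : parser Y) : Prop :=
  forall s, s <> [::] -> sz (p s).2 < sz s.

Definition pnum : parser nat := fun s => (head 0 s, behead s).

Definition pbit : parser nat := fun s =>
  if head 0 s == 0 then (0, behead s) else (1, (head 0 s).-1 :: behead s).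

Definition pret (Y : Type) (y : Y) : parser Y := fun s => (y, s).

Definition ppair (Y Z : Type) (p : parser Y) (q : parser Z) : parser (Y * Z) :=
  fun s => (((p s).1, (q (p s).2).1), (q (p s).2).2).

Definition pfmap (Y Z : Type) (f : Y -> Z) (p : parser Y) : parser Z :=
  fun s => (f (p s).1, (p s).2).

(** The header gives the number of rounds. A round on an empty stream does nothing, because a strict
    parser makes progress only on nonempty ones and the bounds must hold on streams that encode
    nothing. *)
Definition pseq (Y : Type) (p : parser Y) : parser (seq Y) := fun s =>
  let r := iter (head 0 s) (fun st : seq Y * seq nat =>
    if nilp st.2 then st else ((p st.2).1 :: st.1, (p st.2).2)) ([::], behead s) in
  (rev r.1, r.2).

Lemma sz_nil (Y : Type) (EY : Enc Y) : sz ([::] : seq Y) = 1.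
Proof. by []. Qed.

Lemma sz_behead (s : seq nat) : sz (head 0 s) + sz (behead s) <= (sz s).+1.
Proof. by case: s => //= n s; rewrite sz_cons; lia. Qed.

Lemma sz_nonnil (s : seq nat) : s <> [::] -> 1 < sz s.
Proof. by case: s => // n s _; rewrite sz_cons; pose proof (sz_gt0 s); lia. Qed.

Lemma pnum_tame : tame pnum.
Proof.
split; first by rewrite /pnum; pt.
by exists 1, 1 => s /=; have := sz_behead s; pose proof (sz_gt0 (head 0 s)); lia.
Qed.

Lemma pnum_strict : strict pnum.
Proof. by case=> // n s _ /=; rewrite sz_cons; pose proof (sz_gt0 n); lia. Qed.

Lemma pbit_tame : tame pbit.
Proof.
split; first by rewrite /pbit; pt.
exists 1, 5 => -[|[|n] s] //; rewrite /= sz_cons !sz_nat ?sz_cons ?sz_nat;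
  by lia.
Qed.

Lemma pbit_strict : strict pbit.
Proof.
by case=> // -[|n] s _; rewrite /= !sz_cons !sz_nat; lia.
Qed.

Lemma pret_tame (Y : Type) (EY : Enc Y) (y : Y) : tame (pret y).
Proof.
split; first by rewrite /pret; pt.
by exists 1, (sz y) => s /=; lia.
Qed.

Section Combinators.
Variables (Y Z : Type) (EY : Enc Y) (EZ : Enc Z).

Lemma ppair_tame (p : parser Y) (q : parser Z) : tame p -> tame q -> tame (ppair p q).
Proof.
move=> [Pp [K [d H]]] [Pq [K' [d' H']]]; split.
  have Pp2 : PT (fun s => (p s).2) by pt.
  have Pq2 := PT_comp Pp2 Pq.
  by rewrite /ppair; pt.
exists (K + K'), (d + d' + 1) => s; rewrite /= sz_pair.
by have [h1 h2] := H s; have [h3 h4] := H' (p s).2; split; nia.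
Qed.

Lemma ppair_strictr (p : parser Y) (q : parser Z) :
  tame p -> tame q -> strict q -> strict (ppair p q).
Proof.
move=> [_ [K [d H]]] [_ [K' [d' H']]] Hq s ns /=; have [_ le] := H s.
have [e|ne] := eqVneq (p s).2 [::]; last by apply: leq_trans (Hq _ _) le; apply/eqP.
by rewrite e; have [_ le'] := H' [::]; apply: leq_ltn_trans le' (sz_nonnil ns).
Qed.

Lemma ppair_strictl (p : parser Y) (q : parser Z) :
  strict p -> tame q -> strict (ppair p q).
Proof.
move=> Hp [_ [K [d H]]] s ns /=; have [_ le] := H (p s).2.
exact: leq_ltn_trans le (Hp s ns).
Qed.

Lemma pfmap_tame (p : parser Y) (f : Y -> Z) c : PT f ->
  (forall y, sz (f y) <= sz y + c) -> tame p -> tame (pfmap f p).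
Proof.
move=> Pf Hf [Pp [K [d H]]]; split.
  have Pp1 : PT (fun s => (p s).1) by pt.
  have Pf1 := PT_comp Pp1 Pf.
  by rewrite /pfmap; pt.
by exists K, (d + c) => s /=; have [h1 h2] := H s; have := Hf (p s).1; lia.
Qed.

Lemma pfmap_strict (p : parser Y) (f : Y -> Z) : strict p -> strict (pfmap f p).
Proof. by []. Qed.

Definition pseq_step (p : parser Y) (st : seq Y * seq nat) : seq Y * seq nat :=
  if nilp st.2 then st else ((p st.2).1 :: st.1, (p st.2).2).

Lemma pseq_step_inv (p : parser Y) : tame p -> strict p -> exists K, forall n s,
  let r := iter n (pseq_step p) ([::], s) in
  sz r.1 + K * sz r.2 <= K * sz s + 1 /\ sz r.2 <= sz s.
Proof.
(* A round adds the constant [d] and a list constructor; the stream shrinks by at least one in each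
   round, which pays for both. *)
move=> [Pp [K [d H]]] Hp; exists (K + d + 2) => n s.
elim: n => [|n]; first by rewrite /= sz_nil addnC.
rewrite iterS; move: (iter n _ _) => [l r] /= [IH1 IH2].
rewrite /pseq_step /=; case: r IH1 IH2 => //= a r IH1 IH2.
have [h1 _] := H (a :: r).
have h2 : sz (p (a :: r)).2 < sz (a :: r) by exact: Hp.
by rewrite sz_cons; split; nia.
Qed.

Lemma pseq_tame (p : parser Y) : tame p -> strict p -> tame (pseq p).
Proof.
move=> Tp Sp; have [K inv] := pseq_step_inv Tp Sp; case: Tp => Pp _.
have P : PT (fun s : seq nat => iter (head 0 s) (pseq_step p) ([::], behead s)).
  apply: PT_iter; try by pt.
    have [e He] : pbound (fun s : seq nat => (K + 1) * sz s + 3) by auto 10 with pb.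
    exists e => s j _; apply: leq_trans (He s).
    have := inv j (behead s); case: (iter _ _ _) => l r /= [h1 h2].
    have := sz_behead s; pose proof (sz_gt0 (head 0 s)).
    by rewrite sz_pair; nia.
  have Pp' : PT (fun q : seq nat * (seq Y * seq nat) => p q.2.2).
    by apply: (PT_comp (f := fun q : seq nat * (seq Y * seq nat) => q.2.2)) Pp; pt.
  by rewrite /pseq_step; pt.
split; first by rewrite /pseq -/(pseq_step p); pt.
exists K, 1 => s; rewrite /pseq -/(pseq_step p) [(_, _).1]/= [(_, _).2]/= sz_rev.
have [h1 h2] := inv (head 0 s) (behead s).
by have := sz_behead s; pose proof (sz_gt0 (head 0 s)); split; nia.
Qed.

(** Something must follow the sequence, or the stop on an empty stream could come too early. In an
    instance the grammar comes last, so the sequences of structures are always followed by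
    something. *)
Lemma pseq_ok (U : Type) (e : U -> seq bool) (raw : U -> Y) (p : parser Y) l w :
  (forall u w, w <> [::] -> p (tok (e u ++ w)) = (raw u, tok w)) -> w <> [::] ->
  pseq p (tok (enc_seq e l ++ w)) = (map raw l, tok w).
Proof.
move=> H nw; rewrite /pseq /enc_seq -catA tok_nat [head _ _]/= [behead _]/=.
set g := fun st => _.
have E l0 acc : iter (size l0) g (acc, tok (flatten (map e l0) ++ w)) =
    (catrev (map raw l0) acc, tok w).
  elim: l0 acc => // u l0 IH acc.
  rewrite [size _]/= iterSr -(IH (raw u :: acc)) {2}/g.
  have nw' : flatten (map e l0) ++ w <> [::] by case: (flatten _).
  rewrite [flatten _]/= -catA [(_, _).2]/= /nilp size_eq0 tok_nil.
  rewrite H //; case: eqP => // /(congr1 size)/eqP.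
  by rewrite size_cat addn_eq0 !size_eq0 => /andP[_ /eqP].
by rewrite E /= catrevE cats0 revK.
Qed.

End Combinators.

Fixpoint pvec (r : nat) : parser (seq nat) :=
  if r is r'.+1 then pfmap (fun p => p.1 :: p.2) (ppair pnum (pvec r')) else pret [::].

Definition ptable (tag i r : nat) (pv : parser nat) : parser (seq (seq nat * nat)) :=
  pseq (pfmap (fun e => (tag :: i :: e.1, e.2)) (ppair (pvec r) pv)).

Definition pcats (Y : Type) (ps : seq (parser (seq Y))) : parser (seq Y) :=
  foldr (fun p q => pfmap (fun ab => ab.1 ++ ab.2) (ppair p q)) (pret [::]) ps.

Lemma pvec_tame r : tame (pvec r).
Proof.
elim: r => [|r IH] /=; first exact: pret_tame.
apply: (@pfmap_tame _ _ _ _ _ _ 0); [by pt| |exact: ppair_tame pnum_tame IH].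
by case=> a l; rewrite sz_cons sz_pair addn0.
Qed.

Lemma pvec_ok l w : pvec (size l) (tok (flatten [seq enc_nat n | n <- l] ++ w)) =
  (l, tok w).
Proof.
elim: l => //= n l IH; rewrite -catA /pfmap /ppair /pnum.
by rewrite !tok_nat /= IH.
Qed.

Lemma prow_tame tag i r pv : tame pv ->
  tame (pfmap (fun e : seq nat * nat => (tag :: i :: e.1, e.2)) (ppair (pvec r) pv)).
Proof.
move=> Tv; apply: (@pfmap_tame _ _ _ _ _ _ (sz tag + sz i + 2)); first by pt.
  by case=> l n; rewrite [(_, _).1]/= [(_, _).2]/= !sz_pair !sz_cons; lia.
exact: ppair_tame (pvec_tame r) Tv.
Qed.

Lemma ptable_tame tag i r pv : tame pv -> strict pv -> tame (ptable tag i r pv).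
Proof.
move=> Tv Sv; apply: pseq_tame; first exact: prow_tame.
by apply: pfmap_strict; apply: ppair_strictr Sv => //; exact: pvec_tame.
Qed.

Lemma pcats_tame (Y : Type) (EY : Enc Y) (ps : seq (parser (seq Y))) :
  foldr (fun p P => tame p /\ P) True ps -> tame (pcats ps).
Proof.
elim: ps => [|p ps IH] /=; first by move=> _; exact: pret_tame.
move=> [Tp /IH Tps]; apply: (@pfmap_tame _ _ _ _ _ _ 0); [by pt| |exact: ppair_tame].
by case=> a b; rewrite sz_pair /=; pose proof (sz_cat a b); lia.
Qed.

Lemma pcats_ok (Y U : Type) (P : U -> parser (seq Y)) (e : U -> seq bool)
    (raw : U -> seq Y) us w :
  (forall u w, w <> [::] -> P u (tok (e u ++ w)) = (raw u, tok w)) -> w <> [::] ->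
  pcats [seq P u | u <- us] (tok (flatten [seq e u | u <- us] ++ w)) =
  (flatten [seq raw u | u <- us], tok w).
Proof.
move=> H nw; elim: us => //= u us IH; rewrite -catA /pfmap /ppair.
have -> : P u (tok (e u ++ flatten (map e us) ++ w)) =
    (raw u, tok (flatten (map e us) ++ w)) by apply: H; case: (flatten _).
by rewrite /= IH.
Qed.

(** * Parsing of structures *)

Section Structures.
Variable tau : signature.

Definition pstruct : parser rstruct :=
  ppair pnum (pfmap (fun ab => ab.1 ++ ab.2) (ppair
    (pcats [seq ptable 0 (enum_rank R) (rel_ar R) pbit | R <- enum (rel_sym tau)])
    (pcats [seq ptable 1 (enum_rank f) (fn_ar f) pnum | f <- enum (fn_sym tau)]))).

Lemma pstruct_tame_strict : tame pstruct /\ strict pstruct.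
Proof.
rewrite /pstruct; set q := pfmap _ _.
have Tq : tame q.
  apply: (@pfmap_tame _ _ _ _ _ _ 0); first by pt.
    by case=> a b; rewrite sz_pair /=; pose proof (sz_cat a b); lia.
  apply: ppair_tame; apply: pcats_tame; elim: (enum _) => //= x xs IH; split=> //;
    apply: ptable_tame; [exact: pbit_tame|exact: pbit_strict|exact: pnum_tame|
    exact: pnum_strict].
by split; [exact: ppair_tame pnum_tame Tq|exact: ppair_strictl pnum_strict Tq].
Qed.

Definition raw_table (m n : nat) (tag i : nat) (F : {ffun 'I_m -> 'I_n} -> nat) :
    seq (seq nat * nat) :=
  [seq (tag :: i :: [seq nat_of_ord (v j) | j <- enum 'I_m], F v)
  | v : {ffun 'I_m -> 'I_n} <- enum {: {ffun 'I_m -> 'I_n}}].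

Definition raw_struct (A : structure tau) : rstruct :=
  (dom A,
   flatten [seq raw_table 0 (enum_rank R) (fun v => nat_of_bool (@rel_int tau A R v))
           | R <- enum (rel_sym tau)] ++
   flatten [seq raw_table 1 (enum_rank f) (fun v => nat_of_ord (@fn_int tau A f v))
           | f <- enum (fn_sym tau)]).

Lemma ptable_ok m n T (e : T -> seq bool) (raw : T -> nat) (pv : parser nat)
    (F : {ffun 'I_m -> 'I_n} -> T) tag i w :
  (forall x w, w <> [::] -> pv (tok (e x ++ w)) = (raw x, tok w)) -> w <> [::] ->
  ptable tag i m pv (tok (enc_table e F ++ w)) =
  (raw_table tag i (fun v => raw (F v)), tok w).
Proof.
move=> H nw; apply: pseq_ok nw => v {}w nw.
rewrite -catA /pfmap /ppair.
pose l := [seq nat_of_ord (v j) | j <- enum 'I_m].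
have -> : flatten [seq enc_ord (v j) | j <- enum 'I_m] =
    flatten [seq enc_nat x | x <- l] by rewrite /l -map_comp.
have El : size l = m by rewrite /l size_map size_enum_ord.
have := pvec_ok l (e (F v) ++ w); rewrite El => ->.
by rewrite /= H.
Qed.

Lemma pstruct_ok A w : w <> [::] ->
  pstruct (tok (enc_structure A ++ w)) = (raw_struct A, tok w).
Proof.
move=> nw; rewrite /pstruct /enc_structure {1}/ppair -!catA /pnum tok_nat.
rewrite [(_, _).1]/= [(_, _).2]/=.
have H2 := pcats_ok (P := fun f => ptable 1 (enum_rank f) (fn_ar f) pnum)
  (e := fun f => enc_table (@enc_ord _) (@fn_int tau A f))
  (raw := fun f => raw_table 1 (enum_rank f) (fun v => nat_of_ord (@fn_int tau A f v)))
  (enum (fn_sym tau)) (w := w) _ nw.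
have nw' : flatten [seq enc_table (@enc_ord _) (@fn_int tau A f) | f <- enum (fn_sym tau)]
    ++ w <> [::] by case: (flatten _).
have H1 := pcats_ok (P := fun R => ptable 0 (enum_rank R) (rel_ar R) pbit)
  (e := fun R => enc_table (fun b => [:: b]) (@rel_int tau A R))
  (raw := fun R => raw_table 0 (enum_rank R) (fun v => nat_of_bool (@rel_int tau A R v)))
  (enum (rel_sym tau)) _ nw'.
rewrite /pfmap /ppair {}H1; last first.
  move=> R w1 nw1; apply: ptable_ok nw1 => b w2 nw2.
  (* A bit [true] has merged with the next number, which exists because [w2] is nonempty. *)
  case: b => //; rewrite /pbit /=.
  by case: (tok w2) (tok_nil w2) => //= /esym/eqP.
rewrite [(_, _).1]/= [(_, _).2]/= {}H2 //.
move=> f w1 nw1; apply: ptable_ok nw1 => x w2 nw2.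
by rewrite /pnum /enc_ord tok_nat.
Qed.

End Structures.

Lemma rtree_ind' (A : Type) (ar : A -> nat) (P : rtree ar -> Prop) :
  (forall a (ch : {ffun 'I_(ar a) -> rtree ar}), (forall i, P (ch i)) -> P (Node a ch)) ->
  forall t, P t.
Proof. by move=> H; fix IH 1 => -[a ch]; apply: H => i; exact: IH. Qed.

(** * Parsing of grammar rules *)

Notation token := (nat * seq nat)%type.
Notation rule_state := (seq rt * (seq (nat * rt) * seq rt))%type.

Section Rules.
Variables (tau : signature) (k : nat).

Definition sym_ar (tag idx : nat) : nat :=
  if tag == 0 then nth 0 [seq rel_ar R | R <- enum (rel_sym tau)] idx
  else if tag == 1 then nth 0 [seq fn_ar f | f <- enum (fn_sym tau)] idx
  else nth 0 [:: 0; 0; 3; 2; 2; 1; 1; 1; 0] tag.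

Definition scode (s : fo_symb tau k) : seq nat :=
  match s with
  | SRel R => [:: 0; nat_of_ord (enum_rank R)]
  | SFun f => [:: 1; nat_of_ord (enum_rank f)]
  | SIte => [:: 2]
  | SAnd => [:: 3]
  | SOr => [:: 4]
  | SNot => [:: 5]
  | SAll x => [:: 6; nat_of_ord x]
  | SEx x => [:: 7; nat_of_ord x]
  | SVar x => [:: 8; nat_of_ord x]
  end.

Lemma scode_ar s : sym_ar (head 0 (scode s)) (nth 0 (scode s) 1) = fo_ar s.
Proof.
case: s => //= x; rewrite /sym_ar /=.
  by rewrite (nth_map x) ?nth_enum_rank // -cardE ltn_ord.
by rewrite (nth_map x) ?nth_enum_rank // -cardE ltn_ord.
Qed.

Lemma enc_scode s : enc_symb s = flatten [seq enc_nat n | n <- scode s].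
Proof. by case: s => * /=; rewrite ?cats0. Qed.

Lemma scode_inj : injective scode.
Proof.
by case=> [R|f|||||x|x|x] [R'|f'|||||x'|x'|x'] //= [];
  try (by move=> /ord_inj/enum_rank_inj->); move=> /ord_inj->.
Qed.

Definition lbl (n : nat) (s : fo_symb tau k + 'I_n) : token :=
  match s with inl a => (2, scode a) | inr b => (1, [:: nat_of_ord b]) end.

(** The bit [false] in front of an alphabet symbol reads as a separate 0, while the bit [true] in
    front of a nonterminal merges with its index into a successor. *)
Definition tok_nums (l : token) : seq nat :=
  if l.1 == 2 then 0 :: l.2 else [:: (head 0 l.2).+1].

Notation gtree n := (rtree (@sum_arity _ 'I_n (@fo_ar tau k))).

Fixpoint raw_tree (n : nat) (t : gtree n) : rt :=
  let: Node s ch := t in RNode (lbl s) [seq raw_tree (ch i) | i <- enum 'I_(sum_arity _ s)].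

Fixpoint tree_toks (n : nat) (t : gtree n) : seq token :=
  let: Node s ch := t in
  lbl s :: flatten [seq tree_toks (ch i) | i <- enum 'I_(sum_arity _ s)].

Definition has_idx (tag : nat) : bool := tag \in [:: 0; 1; 6; 7; 8].

(** The state consists of the numbers left, the number of subtrees still to be read, and the tokens
    found, in reverse. When no subtree is pending a new rule begins, and its left-hand side becomes
    a token of kind 0. *)
Definition scan_step (st : seq nat * (nat * seq token)) : seq nat * (nat * seq token) :=
  if nilp st.1 then st
  else if st.2.1 == 0 then
    (behead st.1, (1, (0, [:: head 0 st.1]) :: st.2.2))
  else if head 0 st.1 == 0 then
    if has_idx (head 0 (behead st.1)) then
      (behead (behead (behead st.1)),
       (st.2.1.-1 + sym_ar (head 0 (behead st.1)) (head 0 (behead (behead st.1))),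
        (2, [:: head 0 (behead st.1); head 0 (behead (behead st.1))]) :: st.2.2))
    else
      (behead (behead st.1),
       (st.2.1.-1 + sym_ar (head 0 (behead st.1)) 0,
        (2, [:: head 0 (behead st.1)]) :: st.2.2))
  else (behead st.1, (st.2.1.-1, (1, [:: (head 0 st.1).-1]) :: st.2.2)).

(** As many rounds as numbers suffice, since a round that does anything consumes at least one. *)
Definition scan (s : seq nat) : seq token :=
  (iter (size s) scan_step (s, (0, [::]))).2.2.

Definition tok_ar (l : token) : nat :=
  if l.1 == 2 then sym_ar (head 0 l.2) (nth 0 l.2 1) else 0.

(** Polish notation read from right to left: the children of a symbol are the topmost trees of the
    stack. The scanner delivers the tokens in just this order. Every tree built is also recorded as
    a subtree. *)
Definition build_step (st : rule_state) (l : token) : rule_state :=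
  if l.1 == 0 then
    (behead st.1, ((head 0 l.2, head (leaf_rt 0) st.1) :: st.2.1, st.2.2))
  else
    (RNode l (take (tok_ar l) st.1) :: drop (tok_ar l) st.1,
     (st.2.1, RNode l (take (tok_ar l) st.1) :: st.2.2)).

Definition build (ls : seq token) : seq (nat * rt) * seq rt :=
  (foldl build_step ([::], ([::], [::])) ls).2.

Lemma nth_sumn (l : seq nat) i : nth 0 l i <= sumn l.
Proof.
elim: l i => [|a l IH] [|i] //=; first exact: leq_addr.
exact: leq_trans (IH i) (leq_addl _ _).
Qed.

Lemma sym_ar_le : exists M, forall tag idx, sym_ar tag idx <= M.
Proof.
exists (sumn [seq rel_ar R | R <- enum (rel_sym tau)]
        + sumn [seq fn_ar f | f <- enum (fn_sym tau)] + 12) => tag idx.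
rewrite /sym_ar; case: ifP => _.
  by apply: leq_trans (nth_sumn _ _) _; lia.
case: ifP => _; first by apply: leq_trans (nth_sumn _ _) _; lia.
by apply: leq_trans (nth_sumn _ _) _; rewrite /=; lia.
Qed.

Lemma PT_sym_ar (X : Type) (EX : Enc X) (t i : X -> nat) :
  PT t -> PT i -> PT (fun x => sym_ar (t x) (i x)).
Proof. by move=> Pt Pi; rewrite /sym_ar; pt. Qed.
Hint Resolve PT_sym_ar : pt.
Hint Opaque sym_ar has_idx tok_ar scan build : pt.

Lemma PT_scan_step : PT scan_step.
Proof.
rewrite /scan_step.
apply: PT_if; [by pt|by pt|].
apply: PT_if; [by pt|by pt|].
apply: PT_if; [by pt| |by pt].
by apply: PT_if; [rewrite /has_idx| |]; pt.
Qed.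

Lemma scan_step_sz : exists c, forall st, sz (scan_step st) <= sz st + c.
Proof.
have [M HM] := sym_ar_le; exists (2 * M + 100) => -[s [p acc]].
rewrite /scan_step [(s, _).1]/= [(s, _).2]/= [(p, _).1]/= [(p, _).2]/=.
case: ifP => _; first by lia.
have h1 := sz_behead s; have h2 := sz_behead (behead s).
have h3 := sz_behead (behead (behead s)).
pose proof (g1 := sz_gt0 (head 0 s)).
rewrite !sz_nat in h1 h2 h3 g1 *.
case: ifP => _; first by rewrite !(sz_pair, sz_cons, sz_nil, sz_nat); lia.
case: ifP => _; last by rewrite !(sz_pair, sz_cons, sz_nil, sz_nat); lia.
case: ifP => _; rewrite !(sz_pair, sz_cons, sz_nil, sz_nat).
  by have := HM (head 0 (behead s)) (head 0 (behead (behead s))); lia.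
by have := HM (head 0 (behead s)) 0; lia.
Qed.

Lemma PT_scan (X : Type) (EX : Enc X) (s : X -> seq nat) :
  PT s -> PT (fun x => scan (s x)).
Proof.
move=> Ps; have bs := PT_size Ps; have [c Hc] := scan_step_sz.
rewrite /scan; apply: PT_snd; apply: PT_snd; apply: PT_iter; try by pt.
  have [e He] : pbound (fun x => sz (s x) + 10 + c * sz (s x)) by auto 10 with pb.
  exists e => x j lj; apply: leq_trans (He x).
  have : sz (iter j scan_step (s x, (0, [::]))) <= sz (s x, (0, [::] : seq token)) + c * j.
    elim: j {lj} => [|j IH]; first by rewrite muln0 addn0.
    by rewrite iterS mulnS; apply: leq_trans (Hc _) _; lia.
  rewrite !(sz_pair, sz_nat, sz_nil); pose proof (size_sz (s x)).
  by nia.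
by apply: (PT_comp (f := fun p : X * _ => p.2)) PT_scan_step; pt.
Qed.
Hint Resolve PT_scan : pt.

Lemma PT_build_step : PT (fun p : rule_state * token => build_step p.1 p.2).
Proof.
rewrite /build_step /tok_ar /leaf_rt.
have Pa : PT (fun p : rule_state * token =>
   if p.2.1 == 2 then sym_ar (head 0 p.2.2) (nth 0 p.2.2 1) else 0) by pt.
have Pt := PT_take (leaf_rt 0) Pa (PT_fst (PT_fst (PT_id _))).
have Pd := PT_drop Pa (PT_fst (PT_fst (PT_id _))).
have PR := PT_RT (PT_snd (PT_id _)) Pt.
apply: PT_if; [by pt|by pt|].
apply: PT_pair; first by apply: PT_cons.
by apply: PT_pair; [pt|apply: PT_cons => //; pt].
Qed.

(** The stack grows by little more than the token, but the new tree is also copied into the list of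
    subtrees, so the total is quadratic in the number and size of the tokens. *)
Lemma build_step_sz st l :
  sz (build_step st l).1 <= sz st.1 + sz l + 3 /\
  sz (build_step st l).2 <= sz st.2 + sz (build_step st l).1 + sz st.1 + sz l + 12.
Proof.
have sRT l0 s : sz (RNode l0 s) = (sz l0 + sz s).+1 by exact: csize_C.
case: st l => stk [rs sb] [t w]; rewrite /build_step [(_, _).1]/= [(_, _).2]/=.
case: ifP => _.
  have hw := sz_behead w; pose proof (sz_gt0 (behead w)).
  rewrite [(_, _).1]/= [(_, _).2]/= [(_, _).2]/= !sz_pair !sz_cons !sz_pair.
  case: stk => [|t0 stk]; rewrite [behead _]/= [head (leaf_rt 0) _]/=.
    have -> : sz (leaf_rt 0) = 9 by [].
    by rewrite sz_nil; split; lia.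
  by rewrite !sz_cons; pose proof (sz_gt0 t0); split; lia.
rewrite [(_, _).1]/= [(_, _).2]/= !sz_pair [(_, _).1]/= !sz_cons sRT !sz_pair.
pose proof (H := sz_cat (take (tok_ar (t, w)) stk) (drop (tok_ar (t, w)) stk)).
rewrite cat_take_drop in H; split; lia.
Qed.

Lemma PT_build (X : Type) (EX : Enc X) (ls : X -> seq token) :
  PT ls -> PT (fun x => build (ls x)).
Proof.
move=> Pl; have bl := PT_size Pl.
rewrite /build; apply: PT_snd; apply: PT_foldl => //; try by pt.
  have [e He] : pbound (fun x => 16 * sz (ls x) + 50 * sz (ls x) * sz (ls x) + 1).
    by auto 10 with pb.
  exists e => x l1 l2 el; apply: leq_trans (He x).
  pose proof (le := sz_prefix el); move: (sz (ls x)) le => N le {el}.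
  have : sz (foldl build_step ([::], ([::], [::])) l1).1 <= 16 * sz l1 /\
         sz (foldl build_step ([::], ([::], [::])) l1).2 <= 50 * sz l1 * sz l1.
    elim/last_ind: l1 {le} => [|l1 l IH]; first by [].
    rewrite foldl_rcons; move: (foldl _ _ _) IH => st [IH1 IH2].
    have [h1 h2] := build_step_sz st l.
    pose proof (H := sz_cat l1 [:: l]); rewrite cats1 sz_cons sz_nil in H.
    have -> : sz (rcons l1 l) = sz l1 + sz l + 1 by lia.
    pose proof (sz_gt0 l1); pose proof (sz_gt0 l); move: IH1 IH2 h1 h2.
    move: (sz st.1) (sz st.2) (sz (build_step st l).1) (sz (build_step st l).2).
    by move: (sz l1) (sz l) H H0 H1 => a b *; split; nia.
  case: (foldl _ _ _) => a b [/= h1 h2]; rewrite sz_pair addn1 ltnS leq_add //.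
    by apply: leq_trans h1 _; rewrite leq_pmul2l.
  by apply: leq_trans h2 _; rewrite -!mulnA leq_pmul2l // leq_mul.
by apply: (PT_comp (f := fun p : X * rule_state * token => (p.1.2, p.2))) PT_build_step; pt.
Qed.

Section Correct.
Variable n : nat.
Implicit Types (s : fo_symb tau k + 'I_n) (t : gtree n).

Lemma tok_symb s w :
  tok (enc_sum (@enc_symb tau k) (@enc_ord _) s ++ w) = tok_nums (lbl s) ++ tok w.
Proof.
case: s => [a|b]; last by exact: (tok_nat (nat_of_ord b).+1).
rewrite /= enc_scode; congr (_ :: _).
by elim: (scode a) => //= c l IH; rewrite -catA tok_nat IH.
Qed.

Lemma flatten_map_cons (S T : Type) (f : S -> seq T) x l :
  flatten (map f (x :: l)) = f x ++ flatten (map f l).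
Proof. by []. Qed.

Lemma tree_toksE s (ch : {ffun 'I_(sum_arity (@fo_ar tau k) s) -> gtree n}) :
  tree_toks (@Node _ (@sum_arity _ 'I_n (@fo_ar tau k)) s ch) =
  lbl s :: flatten [seq tree_toks (ch i) | i <- enum 'I_(sum_arity _ s)].
Proof. by []. Qed.

Lemma tok_tree t w :
  tok (enc_tree (enc_sum (@enc_symb tau k) (@enc_ord _)) t ++ w) =
  flatten [seq tok_nums l | l <- tree_toks t] ++ tok w.
Proof.
elim/rtree_ind': t w => s ch IH w; rewrite [enc_tree _ _]/= -catA tok_symb.
rewrite tree_toksE flatten_map_cons -catA; congr (_ ++ _).
elim: (enum _) => [|i js IHj] //; rewrite !flatten_map_cons -catA IH IHj.
by rewrite map_cat flatten_cat -catA.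
Qed.

Lemma scan_step_symb s r p acc :
  scan_step (tok_nums (lbl s) ++ r, (p.+1, acc)) =
  (r, (p + sum_arity (@fo_ar tau k) s, lbl s :: acc)).
Proof.
case: s => [a|b]; last by rewrite /scan_step /= addn0.
have := scode_ar a; rewrite /scan_step /=.
by case: a => * /=; congr (_, (_ + _, _)).
Qed.

Lemma scan_tree t r p acc :
  iter (size (tree_toks t)) scan_step
    (flatten [seq tok_nums l | l <- tree_toks t] ++ r, (p.+1, acc)) =
  (r, (p, catrev (tree_toks t) acc)).
Proof.
elim/rtree_ind': t r p acc => s ch IH r p acc.
rewrite tree_toksE [size _]/= iterSr flatten_map_cons -catA scan_step_symb.
rewrite [catrev _ _]/=; move: (lbl s :: acc) => {}acc.
have F (js : seq 'I_(sum_arity (@fo_ar tau k) s)) :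
    iter (size (flatten [seq tree_toks (ch i) | i <- js])) scan_step
      (flatten [seq tok_nums l | l <- flatten [seq tree_toks (ch i) | i <- js]] ++ r,
       (p + size js, acc)) =
    (r, (p, catrev (flatten [seq tree_toks (ch i) | i <- js]) acc)).
  elim: js acc => [|i js IHj] acc; first by rewrite /= addn0.
  rewrite flatten_map_cons size_cat addnC iterD map_cat flatten_cat -catA.
  by rewrite [size (i :: js)]/= addnS IH IHj !catrevE rev_cat catA.
by have := F (enum 'I_(sum_arity (@fo_ar tau k) s)); rewrite size_enum_ord.
Qed.

Lemma scan_nil m p acc : iter m scan_step ([::], (p, acc)) = ([::], (p, acc)).
Proof. by elim: m => //= m ->. Qed.

Definition rule_toks (r : 'I_n * gtree n) : seq token :=
  (0, [:: nat_of_ord r.1]) :: tree_toks r.2.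

Definition rule_nums (r : 'I_n * gtree n) : seq nat :=
  nat_of_ord r.1 :: flatten [seq tok_nums l | l <- tree_toks r.2].

Lemma scan_rules (rs : seq ('I_n * gtree n)) :
  scan (flatten [seq rule_nums r | r <- rs]) = rev (flatten [seq rule_toks r | r <- rs]).
Proof.
have E acc : iter (size (flatten [seq rule_toks r | r <- rs])) scan_step
    (flatten [seq rule_nums r | r <- rs], (0, acc)) =
    ([::], (0, catrev (flatten [seq rule_toks r | r <- rs]) acc)).
  elim: rs acc => [|[B t] rs IH] acc //.
  rewrite !flatten_map_cons /rule_toks /rule_nums !cat_cons -/rule_toks -/rule_nums.
  rewrite [size _]/= size_cat iterSr addnC iterD scan_tree IH.
  by rewrite [RHS]/= !catrevE rev_cat -!catA.
have le : size (flatten [seq rule_toks r | r <- rs]) <=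
          size (flatten [seq rule_nums r | r <- rs]).
  have le1 (ls : seq token) : size ls <= size (flatten [seq tok_nums l | l <- ls]).
    elim: ls => [|l ls IH] //; rewrite flatten_map_cons size_cat /=.
    have : 0 < size (tok_nums l) by rewrite /tok_nums; case: ifP.
    by lia.
  by elim: rs {E} => [|r rs IH] //; rewrite !flatten_map_cons !size_cat /= ltnS leq_add.
rewrite /scan -(subnK le) iterD E scan_nil.
by rewrite /= catrevE cats0.
Qed.

Fixpoint raw_subs (m : nat) (t : gtree m) : seq rt :=
  let: Node s ch := t in
  raw_tree t :: flatten [seq raw_subs (ch i) | i <- enum 'I_(sum_arity _ s)].

Lemma tok_ar_lbl s : tok_ar (lbl s) = sum_arity (@fo_ar tau k) s.
Proof. by case: s => // a; exact: scode_ar. Qed.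

Lemma build_tree t stk rs sb :
  foldl build_step (stk, (rs, sb)) (rev (tree_toks t)) =
  (raw_tree t :: stk, (rs, raw_subs t ++ sb)).
Proof.
elim/rtree_ind': t stk rs sb => s ch IH stk rs sb.
rewrite [tree_toks _]/= rev_cons foldl_rcons.
have F (js : seq 'I_(sum_arity (@fo_ar tau k) s)) :
    foldl build_step (stk, (rs, sb)) (rev (flatten [seq tree_toks (ch i) | i <- js])) =
    ([seq raw_tree (ch i) | i <- js] ++ stk,
     (rs, flatten [seq raw_subs (ch i) | i <- js] ++ sb)).
  elim: js => //= j js IHj; rewrite rev_cat foldl_cat IHj IH.
  by rewrite catA.
have sz_ch : size [seq raw_tree (ch i) | i <- enum 'I_(sum_arity (@fo_ar tau k) s)] =
    tok_ar (lbl s) by rewrite size_map size_enum_ord tok_ar_lbl.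
rewrite F /build_step.
have -> : (lbl s).1 == 0 = false by case: (s).
rewrite [(_, _).1]/= [(_, _).2]/= -sz_ch take_size_cat // drop_size_cat //.
Qed.

Lemma build_rules (rs : seq ('I_n * gtree n)) :
  build (rev (flatten [seq rule_toks r | r <- rs])) =
  ([seq (nat_of_ord r.1, raw_tree r.2) | r <- rs], flatten [seq raw_subs r.2 | r <- rs]).
Proof.
rewrite /build.
suff -> : foldl build_step ([::], ([::], [::]))
    (rev (flatten [seq rule_toks r | r <- rs])) =
    ([::], ([seq (nat_of_ord r.1, raw_tree r.2) | r <- rs],
            flatten [seq raw_subs r.2 | r <- rs])) by [].
elim: rs => //= -[B t] rs IH.
by rewrite rev_cons rev_cat foldl_rcons foldl_cat IH build_tree.
Qed.

End Correct.

End Rules.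

(** * The components of an encoded instance *)

Section Input.
Variables (tau : signature) (k : nat).

Definition in_pos (w : seq bool) : seq rstruct * seq nat := pseq (pstruct tau) (tok w).
Definition in_neg (w : seq bool) : seq rstruct * seq nat :=
  pseq (pstruct tau) (in_pos w).2.
(** Behind the structures the stream holds the number of nonterminals, the axiom and the number of
    rules, then the rules; hence position 1 here and offset 3 below. *)
Definition in_axiom (w : seq bool) : nat := nth 0 (in_neg w).2 1.
Definition in_rules (w : seq bool) : seq (nat * rt) * seq rt :=
  build tau (scan tau (drop 3 (in_neg w).2)).

Lemma PT_pseq : PT (pseq (pstruct tau)).
Proof. by have [T S] := pstruct_tame_strict tau; have [] := pseq_tame T S. Qed.

Lemma PT_in_pos : PT in_pos.
Proof. by apply: PT_comp PT_pseq; apply: PT_tok; pt. Qed.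

Lemma PT_in_neg : PT in_neg.
Proof. by apply: PT_comp PT_pseq; apply: PT_snd; exact: PT_in_pos. Qed.

Lemma PT_in_axiom : PT in_axiom.
Proof. by apply: PT_nth; [apply: PT_snd; exact: PT_in_neg|pt]. Qed.

Lemma PT_in_rules : PT in_rules.
Proof.
apply: PT_build; apply: PT_scan; apply: PT_drop; first by pt.
by apply: PT_snd; exact: PT_in_neg.
Qed.

Variable I : instance tau k.
Let w := enc_instance I.
Let G := grammar I.

Lemma enc_rtg_nonnil : enc_rtg (@enc_symb tau k) G <> [::].
Proof. by rewrite /enc_rtg /enc_nat; case: (nseq _ _). Qed.

Lemma in_posE : in_pos w = (map (@raw_struct tau) (pos I),
  tok (enc_seq (@enc_structure tau) (neg I) ++ enc_rtg (@enc_symb tau k) G)).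
Proof.
apply: pseq_ok; first exact: pstruct_ok.
by have := enc_rtg_nonnil; case: (enc_seq _ _).
Qed.

Lemma in_negE : in_neg w = (map (@raw_struct tau) (neg I), tok (enc_rtg (@enc_symb tau k) G)).
Proof.
rewrite /in_neg in_posE -[enc_rtg _ _]cats0 [(_, _).2]/= cats0.
apply: pseq_ok; [exact: pstruct_ok|exact: enc_rtg_nonnil].
Qed.

Lemma in_rest : tok (enc_rtg (@enc_symb tau k) G) =
  [:: nonterms G, nat_of_ord (axiom G), size (rules G)
    & flatten [seq rule_nums r | r <- rules G]].
Proof.
rewrite /enc_rtg tok_nat /enc_ord tok_nat -[enc_seq _ _]cats0 /enc_seq -catA tok_nat.
congr [:: _, _, _ & _]; rewrite -[RHS]cats0 -[in RHS](_ : tok [::] = [::]) //.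
elim: (rules G) => [|[B t] rs IH] //.
by rewrite !flatten_map_cons -!catA tok_nat tok_tree IH.
Qed.

Lemma in_axiomE : in_axiom w = axiom G.
Proof. by rewrite /in_axiom in_negE in_rest. Qed.

Lemma in_rulesE : in_rules w =
  ([seq (nat_of_ord r.1, raw_tree r.2) | r <- rules G],
   flatten [seq raw_subs r.2 | r <- rules G]).
Proof.
have D3 a b c (l : seq nat) : drop 3 [:: a, b, c & l] = l by rewrite /= drop0.
by rewrite /in_rules in_negE in_rest D3 scan_rules build_rules.
Qed.

End Input.

(** * Correctness of the values *)

Lemma nth_map_ord (T : Type) (x0 : T) n (f : 'I_n -> T) (i : 'I_n) :
  nth x0 [seq f j | j <- enum 'I_n] i = f i.
Proof. by rewrite (nth_map i) ?size_enum_ord // nth_ord_enum. Qed.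

Lemma map_enum_inj (T : Type) n (f g : 'I_n -> T) :
  [seq f i | i <- enum 'I_n] = [seq g i | i <- enum 'I_n] -> f =1 g.
Proof.
move=> e i; have := congr1 (fun s => nth (f i) s i) e.
by rewrite !nth_map_ord.
Qed.

Lemma asgP j d (e : seq nat) :
  (e \in asg j d) = (size e == j) && all (fun i => i <= d) e.
Proof.
elim: j e => [|j IH] e.
  by rewrite inE; case: e.
apply/flatten_mapP/idP => [[i]|].
  rewrite mem_iota => li /mapP[e' e'in ->] /=.
  by move: e'in; rewrite IH eqSS => /andP[-> ->]; rewrite andbT; lia.
case: e => //= i e; rewrite eqSS => /and3P[se li le].
exists i; first by rewrite inE mem_iota; case: i li => // i li; rewrite add1n ltnS.
by apply/mapP; exists e => //; rewrite IH se.
Qed.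

Lemma lookup_fun (K : eqType) (k0 k1 : K) (l : seq (K * nat)) n :
  (k1, n) \in l -> (forall m, (k1, m) \in l -> m = n) -> lookup k0 k1 l = n.
Proof.
move=> inl fn; rewrite /lookup.
have : (k1, n) \in [seq q <- l | q.1 == k1] by rewrite mem_filter eqxx.
case E : [seq q <- l | q.1 == k1] => [|[k2 m] l'] // _ /=.
have : (k2, m) \in [seq q <- l | q.1 == k1] by rewrite E inE eqxx.
by rewrite mem_filter /= => /andP[/eqP -> /fn].
Qed.

Section Semantics.
Variables (tau : signature) (k : nat).
Notation formula := (formula tau k).
Notation term := (term tau k).
Notation obj := (formula + term)%type.

Definition obj_sort (o : obj) : nat := if o is inl _ then 0 else 1.

Definition obj_tree (o : obj) : rtree (@fo_ar tau k) :=
  match o with inl p => formula_tree p | inr t => term_tree t end.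

Definition obj_fv (o : obj) : {set 'I_k} :=
  match o with inl p => fv p | inr t => tfv t end.

Definition obj_val (A : structure tau) (e : assignment k A) (o : obj) : nat :=
  match o with inl p => nat_of_bool (sat e p) | inr t => nat_of_ord (eval e t) end.

Definition raw_asg (A : structure tau) (e : assignment k A) : seq nat :=
  [seq nat_of_ord (e x) | x <- enum 'I_k].

Definition raw_point (A : structure tau) (e : assignment k A) : point :=
  (raw_struct A, raw_asg e).

Definition fv_nat (o : obj) (y : nat) : bool :=
  y \in [seq nat_of_ord x | x <- enum (obj_fv o)].

Lemma fv_nat_ord o (x : 'I_k) : fv_nat o x = (x \in obj_fv o).
Proof. by rewrite /fv_nat mem_map ?mem_enum //; exact: val_inj. Qed.

Definition fv_list (o : obj) : seq nat := [seq y <- iota 0 k | fv_nat o y].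

(** The third clause makes the table canonical, with one row for each listed point in order. It
    bounds the size of a value, which the denotation alone would not. *)
Definition is_value (As : seq (structure tau)) (o : obj) (v : value) : Prop :=
  [/\ v.1.1 = obj_sort o, v.1.2 = fv_list o,
      v.2 = [seq (p, vget p v) | p <- points k (map (@raw_struct tau) As)]
    & forall A (e : assignment k A), List.In A As -> vget (raw_point e) v = obj_val e o].

Lemma raw_asg_in A (e : assignment k A) : raw_asg e \in asg k (dom A).
Proof.
rewrite asgP size_map size_enum_ord eqxx /=; apply/allP => i /mapP[x _ ->].
by rewrite -ltnS ltn_ord.
Qed.

Lemma asg_raw A e' : e' \in asg k (dom A) -> exists e : assignment k A, e' = raw_asg e.
Proof.
rewrite asgP => /andP[/eqP se /allP le].
exists [ffun x : 'I_k => inord (nth 0 e' x)].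
apply: (@eq_from_nth _ 0); first by rewrite se size_map size_enum_ord.
move=> i; rewrite se => li; rewrite (@nth_map_ord _ _ _ _ (Ordinal li)) ffunE inordK //.
by rewrite ltnS; apply: le; apply: mem_nth; rewrite se.
Qed.

Lemma in_raw A (As : seq (structure tau)) : List.In A As ->
  raw_struct A \in map (@raw_struct tau) As.
Proof.
elim: As => //= B As IH [->|/IH h]; first by rewrite inE eqxx.
by rewrite inE h orbT.
Qed.

Lemma raw_in As r : r \in map (@raw_struct tau) As ->
  exists2 A : structure tau, List.In A As & r = raw_struct A.
Proof.
elim: As => //= B As IH; rewrite inE => /orP[/eqP ->|/IH[A iA ->]].
  by exists B => //; left.
by exists A => //; right.
Qed.

Lemma pointsP As p : p \in points k (map (@raw_struct tau) As) ->
  exists A (e : assignment k A), List.In A As /\ p = raw_point e.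
Proof.
case/flatten_mapP=> r /raw_in[A iA ->] /mapP[e' /asg_raw[e ->] ->].
by exists A, e.
Qed.

Lemma points_raw As A (e : assignment k A) : List.In A As ->
  raw_point e \in points k (map (@raw_struct tau) As).
Proof.
move=> iA; apply/flatten_mapP; exists (raw_struct A); first exact: in_raw.
by apply/mapP; exists (raw_asg e) => //; exact: raw_asg_in.
Qed.

Lemma upd_raw A (e : assignment k A) (x : 'I_k) (d : 'I_(dom A).+1) :
  upd k (raw_asg e) x d = raw_asg (update e x d).
Proof.
rewrite /upd -val_enum_ord -map_comp; apply: eq_map => y /=.
by rewrite ffunE -val_eqE /=; case: eqP => // _; rewrite nth_map_ord.
Qed.

Lemma raw_table_mem m n tag i (F : {ffun 'I_m -> 'I_n} -> nat) q :
  reflect (exists v : {ffun 'I_m -> 'I_n}, q = (tag :: i :: [seq nat_of_ord (v j) | j <- enum 'I_m], F v))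
    (q \in raw_table tag i F).
Proof.
apply: (iffP mapP) => [[v _ ->]|[v ->]]; first by exists v.
by exists v => //; rewrite mem_enum.
Qed.

Lemma lookup_rel A (R : rel_sym tau) (v : {ffun 'I_(rel_ar R) -> 'I_(dom A).+1}) :
  lookup [::] (0 :: nat_of_ord (enum_rank R) ::
    [seq nat_of_ord (v j) | j <- enum 'I_(rel_ar R)]) (raw_struct A).2 =
  rel_int v.
Proof.
apply: lookup_fun.
  rewrite mem_cat; apply/orP; left; apply/flatten_mapP; exists R; first by rewrite mem_enum.
  by apply/raw_table_mem; exists v.
move=> m; rewrite mem_cat => /orP[] /flatten_mapP[R' _ /raw_table_mem[v']]; last by case.
case=> /ord_inj/enum_rank_inj eR; subst R' => /map_enum_inj ev ->.
by congr (nat_of_bool (rel_int _)); apply/ffunP => j; apply: ord_inj; rewrite ev.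
Qed.

Lemma lookup_fn A (f : fn_sym tau) (v : {ffun 'I_(fn_ar f) -> 'I_(dom A).+1}) :
  lookup [::] (1 :: nat_of_ord (enum_rank f) ::
    [seq nat_of_ord (v j) | j <- enum 'I_(fn_ar f)]) (raw_struct A).2 =
  fn_int v.
Proof.
apply: lookup_fun.
  rewrite mem_cat; apply/orP; right; apply/flatten_mapP; exists f; first by rewrite mem_enum.
  by apply/raw_table_mem; exists v.
move=> m; rewrite mem_cat => /orP[] /flatten_mapP[f' _ /raw_table_mem[v']]; first by case.
case=> /ord_inj/enum_rank_inj ef; subst f' => /map_enum_inj ev ->.
by congr (nat_of_ord (fn_int _)); apply/ffunP => j; apply: ord_inj; rewrite ev.
Qed.

(** A relation, because children of the wrong sorts build nothing. It presents all constructors of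
    formulas and terms uniformly as a symbol with a family of children. *)
Inductive built : forall a : fo_symb tau k, {ffun 'I_(fo_ar a) -> obj} -> obj -> Prop :=
| built_rel R (ts : {ffun 'I_(rel_ar R) -> term}) : @built (SRel k R) [ffun i => inr (ts i)] (inl (FRel ts))
| built_fun f (ts : {ffun 'I_(fn_ar f) -> term}) : @built (SFun k f) [ffun i => inr (ts i)] (inr (TFun ts))
| built_ite p t1 t2 : @built SIte
    [ffun i => tnth [tuple inl p; inr t1; inr t2] i] (inr (TIte p t1 t2))
| built_and p q : @built SAnd [ffun i => tnth [tuple inl p; inl q] i] (inl (FAnd p q))
| built_or p q : @built SOr [ffun i => tnth [tuple inl p; inl q] i] (inl (FOr p q))
| built_not p : @built SNot [ffun=> inl p] (inl (FNot p))
| built_all x p : @built (SAll tau x) [ffun=> inl p] (inl (FAll x p))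
| built_ex x p : @built (SEx tau x) [ffun=> inl p] (inl (FEx x p))
| built_var x : @built (SVar tau x) (ffun0 (card_ord 0)) (inr (TVar tau x)).

Lemma obj_built o : exists a os, @built a os o.
Proof.
case: o => [[R ts|p q|p q|p|x p|x p]|[x|f ts|p t1 t2]]; do 2!eexists;
  [exact: built_rel|exact: built_or|exact: built_and|exact: built_not|
   exact: built_ex|exact: built_all|exact: built_var|exact: built_fun|exact: built_ite].
Qed.

Lemma built_tree a os o : @built a os o ->
  obj_tree o = Node a [ffun i => obj_tree (os i)].
Proof.
case=> {a os o} [R ts|f ts|p t1 t2|p q|p q|p|x p|x p|x] /=; congr Node;
  apply/ffunP => i; rewrite ?ffunE //; by case: i => [[|[|[|]]]].
Qed.

Lemma built_sorts a os o : @built a os o ->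
  [seq obj_sort (os i) | i <- enum 'I_(fo_ar a)] = esorts (head 0 (scode a)) (fo_ar a)
  /\ obj_sort o = rsort (head 0 (scode a)).
Proof.
have E n (f : 'I_n -> nat) s : size s = n -> (forall i : 'I_n, f i = nth 0 s i) ->
    [seq f i | i <- enum 'I_n] = s.
  move=> ss h; apply: (@eq_from_nth _ 0); first by rewrite size_map size_enum_ord.
  by move=> i; rewrite size_map size_enum_ord => li;
     rewrite (@nth_map_ord _ _ _ _ (Ordinal li)) h.
case=> {a os o} [R ts|f ts|p t1 t2|p q|p q|p|x p|x p|x]; split=> //;
  apply: E; rewrite ?size_nseq // => i; rewrite ?ffunE /= ?nth_nseq ?ltn_ord //;
  by case: i => [[|[|[|]]]].
Qed.

Definition as_formula (o : obj) : obj_sort o = 0 -> formula :=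
  match o return obj_sort o = 0 -> formula with
  | inl p => fun=> p
  | inr t => fun H => match O_S 0 (esym H) with end
  end.

Definition as_term (o : obj) : obj_sort o = 1 -> term :=
  match o return obj_sort o = 1 -> term with
  | inl p => fun H => match O_S 0 H with end
  | inr t => fun=> t
  end.

Lemma as_formulaE o (H : obj_sort o = 0) : o = inl (as_formula H).
Proof. by case: o H. Qed.

Lemma as_termE o (H : obj_sort o = 1) : o = inr (as_term H).
Proof. by case: o H. Qed.

(** Soundness of the sort test: once the sorts fit, the children found by the saturation can be
    assembled into a formula or term. *)
Lemma sorts_built a (os : {ffun 'I_(fo_ar a) -> obj}) :
  [seq obj_sort (os i) | i <- enum 'I_(fo_ar a)] = esorts (head 0 (scode a)) (fo_ar a) ->
  exists o, built os o.
Proof.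
move=> E.
have {E} S (i : 'I_(fo_ar a)) :
    obj_sort (os i) = nth 0 (esorts (head 0 (scode a)) (fo_ar a)) i.
  by rewrite -E nth_map_ord.
have F (e : {ffun 'I_(fo_ar a) -> obj}) o : built e o -> os =1 e -> exists o, built os o.
  by move=> b /ffunP ->; exists o.
case: a os S F => [R|f||||| x|x|x] os S F.
- have S1 (i : 'I_(rel_ar R)) : obj_sort (os i) = 1 by rewrite S /= nth_nseq ltn_ord.
  apply: (F _ _ (built_rel [ffun i => as_term (S1 i)])) => i.
  by rewrite !ffunE -as_termE.
- have S1 (i : 'I_(fn_ar f)) : obj_sort (os i) = 1 by rewrite S /= nth_nseq ltn_ord.
  apply: (F _ _ (built_fun [ffun i => as_term (S1 i)])) => i.
  by rewrite !ffunE -as_termE.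
- have S0 := S (@Ordinal 3 0 isT); have S1 := S (@Ordinal 3 1 isT).
  have S2 := S (@Ordinal 3 2 isT).
  apply: (F _ _ (built_ite (as_formula S0) (as_term S1) (as_term S2))) => i.
  rewrite ffunE; case: i => [[|[|[|]]]] //= li; rewrite /tnth /= -?as_formulaE -?as_termE;
    by congr (os _); apply: val_inj.
- have S0 := S (@Ordinal 2 0 isT); have S1 := S (@Ordinal 2 1 isT).
  apply: (F _ _ (built_and (as_formula S0) (as_formula S1))) => i.
  rewrite ffunE; case: i => [[|[|]]] //= li; rewrite /tnth /= -?as_formulaE;
    by congr (os _); apply: val_inj.
- have S0 := S (@Ordinal 2 0 isT); have S1 := S (@Ordinal 2 1 isT).
  apply: (F _ _ (built_or (as_formula S0) (as_formula S1))) => i.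
  rewrite ffunE; case: i => [[|[|]]] //= li; rewrite /tnth /= -?as_formulaE;
    by congr (os _); apply: val_inj.
- have S0 := S (@Ordinal 1 0 isT).
  apply: (F _ _ (built_not (as_formula S0))) => i.
  by rewrite ffunE -as_formulaE; congr (os _); apply: val_inj; case: i => [[|]].
- have S0 := S (@Ordinal 1 0 isT).
  apply: (F _ _ (built_all x (as_formula S0))) => i.
  by rewrite ffunE -as_formulaE; congr (os _); apply: val_inj; case: i => [[|]].
- have S0 := S (@Ordinal 1 0 isT).
  apply: (F _ _ (built_ex x (as_formula S0))) => i.
  by rewrite ffunE -as_formulaE; congr (os _); apply: val_inj; case: i => [[|]].
- by apply: (F _ _ (built_var x)) => -[].
Qed.

Lemma vget_map (g : point -> nat) s fvs (pts : seq point) p :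
  p \in pts -> vget p ((s, fvs), [seq (q, g q) | q <- pts]) = g p.
Proof.
move=> pin; apply: lookup_fun; first by apply/mapP; exists p.
by move=> m /mapP[q _ [-> ->]].
Qed.

Section Combine.
Variables (As : seq (structure tau)).
Let pts := points k (map (@raw_struct tau) As).

Lemma built_fv a os o (x : 'I_k) : @built a os o ->
  (x \in obj_fv o) =
  if head 0 (scode a) == 8 then nat_of_ord x == nth 0 (scode a) 1
  else [exists i, x \in obj_fv (os i)] &&
    ~~ (((head 0 (scode a) == 6) || (head 0 (scode a) == 7))
        && (nat_of_ord x == nth 0 (scode a) 1)).
Proof.
have E1 (P : pred 'I_1) : [exists i, P i] = P ord0.
  by apply/existsP/idP => [[i]|h]; [rewrite (ord1 i)|exists ord0].
have E2 (P : pred 'I_2) : [exists i, P i] = P (@Ordinal 2 0 isT) || P (@Ordinal 2 1 isT).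
  apply/existsP/orP => [[[[|[|]]] // li]|[h|h]]; [| |by eexists; exact: h|by eexists; exact: h].
    by rewrite (bool_irrelevance li isT); left.
  by rewrite (bool_irrelevance li isT); right.
have E3 (P : pred 'I_3) : [exists i, P i] =
    P (@Ordinal 3 0 isT) || P (@Ordinal 3 1 isT) || P (@Ordinal 3 2 isT).
  apply/existsP/idP => [[[[|[|[|]]]] // li]|/orP[/orP[h|h]|h]];
    try (by eexists; exact: h); by rewrite (bool_irrelevance li isT) => ->; rewrite ?orbT.
case=> {a os o} [R ts|f ts|p t1 t2|p q|p q|p|y p|y p|y] /=; rewrite ?andbT.
- by apply/bigcupP/existsP => [[i _]|[i]]; [|rewrite ffunE /=]; exists i => //; rewrite ffunE.
- by apply/bigcupP/existsP => [[i _]|[i]]; [|rewrite ffunE /=]; exists i => //; rewrite ffunE.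
- by rewrite E3 !ffunE !inE.
- by rewrite E2 !ffunE !inE.
- by rewrite E2 !ffunE !inE.
- by rewrite E1 ffunE.
- by rewrite E1 ffunE !inE andbC.
- by rewrite E1 ffunE !inE andbC.
- by rewrite inE.
Qed.

(** Compositionality. The denotation at a point refers to the children at the same point or, for a
    quantifier, at points over the same structure with one coordinate changed, and the tables
    contain all of these. *)
Lemma combine_ok a os o (vs : 'I_(fo_ar a) -> value) : @built a os o ->
  (forall i, is_value As (os i) (vs i)) ->
  is_value As o (combine k pts (scode a) [seq vs i | i <- enum 'I_(fo_ar a)]).
Proof.
move=> b V; split.
- by have [_ ->] := built_sorts b.
- apply: eq_in_filter => y; rewrite mem_iota add0n => ly; pose x := Ordinal (ly : y < k).
  rewrite -[y]/(nat_of_ord x) fv_nat_ord (built_fv x b); congr (if _ then _ else _ && _).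
  rewrite has_map; apply/hasP/existsP => [[i _]|[i h]] /=.
    by have [_ -> _ _] := V i; rewrite mem_filter => /andP[h _]; exists i; rewrite -fv_nat_ord.
  exists i; first by rewrite mem_enum.
  have [_ e _ _] := V i; move: h; rewrite -fv_nat_ord /= e mem_filter mem_iota add0n ly andbT.
  by [].
- apply/eq_in_map => p pin; congr (_, _).
  by rewrite vget_map.
move=> A e iA; rewrite vget_map; last exact: points_raw.
have G i (e' : assignment k A) : vget (raw_point e') (vs i) = obj_val e' (os i).
  by have [_ _ _ h] := V i; exact: h.
have Gn i (e' : assignment k A) : vget (raw_point e') (nth value0 [seq vs i | i <- enum 'I_(fo_ar a)]
     (nat_of_ord i)) = obj_val e' (os i) by rewrite nth_map_ord.
have Gm : [seq vget (raw_point e) v | v <- [seq vs i | i <- enum 'I_(fo_ar a)]] =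
    [seq obj_val e (os i) | i <- enum 'I_(fo_ar a)].
  by rewrite -map_comp; apply: eq_map => i /=.
case: b vs V G Gn Gm => {a os o} [R ts|f ts|p t1 t2|p q|p q|p|x p|x p|x] vs V G Gn Gm.
- rewrite /gval /= Gm -(lookup_rel [ffun i => eval e (ts i)]) /=.
  by congr (lookup _ [:: _, _ & _] _); apply: eq_map => i; rewrite !ffunE.
- rewrite /gval /= Gm -(lookup_fn [ffun i => eval e (ts i)]) /=.
  by congr (lookup _ [:: _, _ & _] _); apply: eq_map => i; rewrite !ffunE.
- have := Gn (@Ordinal 3 0 isT) e; have := Gn (@Ordinal 3 1 isT) e.
  have := Gn (@Ordinal 3 2 isT) e.
  by rewrite /gval !ffunE [obj_val]lock /= => -> -> ->; rewrite -lock /tnth /=; case: (sat _ _).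
- have := Gn (@Ordinal 2 0 isT) e; have := Gn (@Ordinal 2 1 isT) e.
  by rewrite /gval !ffunE [obj_val]lock /= => -> ->; rewrite -lock /tnth /=; case: (sat _ _).
- have := Gn (@Ordinal 2 0 isT) e; have := Gn (@Ordinal 2 1 isT) e.
  by rewrite /gval !ffunE [obj_val]lock /= => -> ->; rewrite -lock /tnth /=; case: (sat _ _).
- have := Gn (@Ordinal 1 0 isT) e.
  by rewrite /gval !ffunE [obj_val]lock /= => ->; rewrite -lock /=; case: (sat _ _).
- rewrite /gval.
  have Q : all (fun d => vget (raw_struct A, upd k (raw_asg e) x d)
      (nth value0 [seq vs i | i <- enum 'I_1] 0) == 1) (iota 0 (dom A).+1) =
      [forall d, sat (update e x d) p].
    rewrite -val_enum_ord all_map; apply/allP/forallP => [h d|h d _] /=.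
      have /= := h d (mem_enum _ d); rewrite upd_raw.
      by have /= -> := Gn (@Ordinal 1 0 isT) (update e x d); rewrite ffunE /=; case: (sat _ _).
    by rewrite upd_raw; have /= -> := Gn (@Ordinal 1 0 isT) (update e x d); rewrite ffunE /= h.
  by move: Q => /= ->; case: [forall _, _].
- rewrite /gval.
  have Q : has (fun d => vget (raw_struct A, upd k (raw_asg e) x d)
      (nth value0 [seq vs i | i <- enum 'I_1] 0) == 1) (iota 0 (dom A).+1) =
      [exists d, sat (update e x d) p].
    rewrite -val_enum_ord has_map; apply/hasP/existsP => [[d _]|[d h]] /=.
      rewrite upd_raw; have /= -> := Gn (@Ordinal 1 0 isT) (update e x d).
      by rewrite ffunE /= => h; exists d; move: h; case: (sat _ _).
    exists d; first by rewrite mem_enum.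
    by rewrite /= upd_raw; have /= -> := Gn (@Ordinal 1 0 isT) (update e x d); rewrite ffunE /= h.
  by move: Q => /= ->; case: [exists _, _].
- by rewrite /gval /= nth_map_ord.
Qed.

End Combine.
End Semantics.

(** * Derivations *)

Section Derivations.
Variables (A : Type) (ar : A -> nat) (G : rtg ar).
Notation stree := (rtree (@sum_arity A 'I_(nonterms G) ar)).
Notation derives := (clos_refl_trans stree (@derive_step A ar G)).

(** Rewriting is context-free: the children of a node evolve independently. Derivability of a
    terminal tree therefore has this inductive form, whose two clauses match the two kinds of
    candidates of a saturation step. *)
Inductive gen : stree -> rtree ar -> Prop :=
| gen_node a (ch : {ffun 'I_(ar a) -> stree}) (ch' : {ffun 'I_(ar a) -> rtree ar}) :
    (forall i, gen (ch i) (ch' i)) ->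
    gen (@Node _ (@sum_arity A _ ar) (inl a) ch) (Node a ch')
| gen_rule B t u : List.In (B, t) (rules G) -> gen t u -> gen (nonterm_tree ar B) u.

(** Inversion of [gen] by a match on the root, which avoids equations between dependent pairs. *)
Definition gen_cases (T : stree) (u : rtree ar) : Prop :=
  match T with
  | Node s ch =>
      match s return {ffun 'I_(sum_arity ar s) -> stree} -> Prop with
      | inl a => fun ch => exists2 ch' : {ffun 'I_(ar a) -> rtree ar},
          u = Node a ch' & forall i, gen (ch i) (ch' i)
      | inr B => fun _ => exists2 t, List.In (B, t) (rules G) & gen t u
      end ch
  end.

Lemma gen_inv T u : gen T u -> gen_cases T u.
Proof. by case=> [a ch ch' H|B t v H1 H2]; [exists ch'|exists t]. Qed.

Lemma derives_child s (ch : {ffun 'I_(sum_arity ar s) -> stree}) i u :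
  derives (ch i) u ->
  derives (@Node _ (@sum_arity A _ ar) s ch)
    (@Node _ (@sum_arity A _ ar) s [ffun j => if j == i then u else ch j]).
Proof.
move=> H; move E : (ch i) H => t /(clos_rt_rt1n _ _ _ _) H.
elim: H ch E => {t u} [t|t u v st _ IH] ch E.
  suff -> : [ffun j => if j == i then t else ch j] = ch by exact: rt_refl.
  by apply/ffunP => j; rewrite ffunE; case: eqP => // ->.
apply: rt_trans.
  by apply: rt_step; apply: (derive_child (i := i)); rewrite E; exact: st.
have /IH : [ffun j => if j == i then u else ch j] i = u by rewrite ffunE eqxx.
congr (derives _ (Node _ _)); apply/ffunP => j; rewrite !ffunE.
by case: ifP => // ->.
Qed.

Lemma derives_children s (ch ch' : {ffun 'I_(sum_arity ar s) -> stree}) :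
  (forall i, derives (ch i) (ch' i)) ->
  derives (@Node _ (@sum_arity A _ ar) s ch) (@Node _ (@sum_arity A _ ar) s ch').
Proof.
move=> H.
(* A step changes a single child; [js] lists the positions already finished. *)
have F (js : seq 'I_(sum_arity ar s)) :
    derives (@Node _ (@sum_arity A _ ar) s ch)
      (@Node _ (@sum_arity A _ ar) s [ffun j => if j \in js then ch' j else ch j]).
  elim: js => [|i js IH].
    have -> : [ffun j => if j \in [::] then ch' j else ch j] = ch.
      by apply/ffunP => j; rewrite ffunE.
    exact: rt_refl.
  have [ij|nij] := boolP (i \in js).
    have -> : [ffun j => if j \in i :: js then ch' j else ch j] =
        [ffun j => if j \in js then ch' j else ch j].
      by apply/ffunP => j; rewrite !ffunE inE; case: eqP => // ->; rewrite ij.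
    exact: IH.
  apply: rt_trans IH _.
  have /derives_child : derives ([ffun j => if j \in js then ch' j else ch j] i) (ch' i).
    by rewrite ffunE (negbTE nij).
  congr (derives _ (Node _ _)); apply/ffunP => j; rewrite !ffunE inE.
  by case: eqP => // ->.
have := F (enum 'I_(sum_arity ar s)); congr (derives _ (Node _ _)).
by apply/ffunP => j; rewrite ffunE mem_enum.
Qed.

Lemma gen_derives T u : gen T u -> derives T (lift_tree 'I_(nonterms G) u).
Proof.
elim=> {T u} [a ch ch' _ IH|B t u H _ IH].
  by rewrite /=; apply: derives_children => i; rewrite ffunE.
by apply: rt_trans IH; apply: rt_step; exact: derive_rule.
Qed.

Lemma gen_lift u : gen (lift_tree 'I_(nonterms G) u) u.
Proof.
elim/rtree_ind': u => a ch IH /=.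
by apply: gen_node => i; rewrite ffunE.
Qed.

Lemma derive_step_gen T T' u : derive_step T T' -> gen T' u -> gen T u.
Proof.
move=> st; elim: st u => {T T'} [B t H|s ch i t _ IH] u; first exact: gen_rule.
case: s ch i t IH => [a|B] ch i t IH /gen_inv /=; last by case: i {IH}.
case=> ch' -> H; apply: gen_node => j; have := H j; rewrite ffunE.
by case: eqP => // ->; exact: IH.
Qed.

(** A derivation is turned into [gen] backwards: the terminal tree at its end generates itself, and
    [gen] is closed under undoing a step. *)
Lemma langP t : lang G t <-> gen (nonterm_tree ar (axiom G)) t.
Proof.
split; last exact: gen_derives.
move=> /(clos_rt_rt1n _ _ _ _).
move E : (lift_tree _ t) => v H; elim: H E => {v} [x <-|x y z st _ IH /IH].
  exact: gen_lift.
exact: derive_step_gen.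
Qed.

End Derivations.

Section RawTree.
Variables (tau : signature) (k n : nat).
Notation gtree := (rtree (@sum_arity _ 'I_n (@fo_ar tau k))).

Lemma lbl_inj : injective (@lbl tau k n).
Proof. by case=> [a|b] [a'|b'] //= [] => [/scode_inj ->|/ord_inj ->]. Qed.

Lemma raw_tree_inj : injective (@raw_tree tau k n).
Proof.
move=> t; elim/rtree_ind': t => s ch IH [s' ch'] /= [].
move=> /lbl_inj es; subst s' => /map_enum_inj ech.
by congr Node; apply/ffunP => i; apply: IH; exact: ech.
Qed.

Lemma raw_nonterm (B : 'I_n) : raw_tree (nonterm_tree (@fo_ar tau k) B) = leaf_rt B.
Proof.
rewrite /= /leaf_rt; congr RNode.
by apply: size0nil; rewrite size_map size_enum_ord.
Qed.

Lemma raw_subs_self (t : gtree) : raw_tree t \in raw_subs t.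
Proof. by case: t => s ch; rewrite /= inE eqxx. Qed.

Lemma raw_subs_tree (t : gtree) r : r \in raw_subs t -> exists t' : gtree, r = raw_tree t'.
Proof.
elim/rtree_ind': t => s ch IH /=; rewrite inE => /orP[/eqP ->|].
  by exists (Node s ch).
by case/flatten_mapP => i _ /IH.
Qed.

End RawTree.

Lemma tuplesP m ts (WI : seq (entry * nat)) tp :
  reflect (exists ws, [/\ size ts <= m, {subset ws <= WI},
             [seq wi.1.1.1 | wi : entry * nat <- ws] = ts
           & [seq (wi.1.1.2, wi.2) | wi : entry * nat <- ws] = tp])
    (tp \in tuples m ts WI).
Proof.
apply: (iffP idP).
- elim: m ts tp => [|m IH] [|t ts] tp //=; try by rewrite inE => /eqP ->; exists [::].
  case/flatten_mapP => wi; rewrite mem_filter => /andP[/eqP et wiW] /mapP[tp'].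
  move=> /IH[ws [sm sub e1 e2]] ->; exists (wi :: ws); split=> //=.
  + by move=> x; rewrite inE => /orP[/eqP ->|/sub].
  + by rewrite et e1.
  + by rewrite e2.
- case=> ws [sm sub e1 e2]; rewrite -e2 -{}e1 in sm *; rewrite size_map in sm => {ts tp e2}.
  elim: ws m sm sub => [|wi ws IH] [|m] //= sm sub.
  apply/flatten_mapP; exists wi; first by rewrite mem_filter eqxx sub // inE eqxx.
  apply/mapP; exists [seq (wi.1.1.2, wi.2) | wi : entry * nat <- ws] => //.
  by apply: IH => // x xin; apply: sub; rewrite inE xin orbT.
Qed.

(** * Correctness of the saturation *)

Lemma onth_lt (T : Type) (s : seq T) i x : onth s i = Some x -> i < size s.
Proof. by move=> e; rewrite ltnNge; apply/negP => le; rewrite onth_default in e. Qed.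

Lemma onth_rcons_old (T : Type) (s : seq T) y i x :
  onth s i = Some x -> onth (rcons s y) i = Some x.
Proof. by move=> e; rewrite -cats1 onth_cat (onth_lt e). Qed.

Lemma onth_rcons_new (T : Type) (s : seq T) y : onth (rcons s y) (size s) = Some y.
Proof. by rewrite -cats1 onth_cat ltnn subnn. Qed.

Lemma unfolds_rcons (A : Type) (ar : A -> nat) (g : term_graph ar) nd i u :
  unfolds g i u -> unfolds (rcons g nd) i u.
Proof.
elim=> {u} {}i a js ch e _ IH; apply: unfolds_node IH.
exact: onth_rcons_old.
Qed.

(** A copied node has the same children and so the same unfolding; this is the case of an entry
    obtained from a rule. *)
Lemma unfolds_copy (A : Type) (ar : A -> nat) (g : term_graph ar) nd i u :
  unfolds g i u -> onth g i = Some nd -> unfolds (rcons g nd) (size g) u.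
Proof.
case=> {u} {}i a js ch e U e'; rewrite e' in e; case: e => e.
apply: (unfolds_node (js := js)); first by rewrite onth_rcons_new e.
by move=> c; apply: unfolds_rcons.
Qed.

Lemma unfolds_lt (A : Type) (ar : A -> nat) (g : term_graph ar) i u :
  unfolds g i u -> i < size g.
Proof. by case=> {u} {}i a js ch e _; exact: onth_lt e. Qed.

Section Saturate.
Variables (tau : signature) (k : nat) (I : instance tau k).
Let As := pos I ++ neg I.
Let G := grammar I.
Notation gtree := (rtree (@sum_arity _ 'I_(nonterms G) (@fo_ar tau k))).
Notation tgraph := (term_graph (@fo_ar tau k)).

Definition the_points : seq point := points k (map (@raw_struct tau) As).

Definition the_rules : seq (nat * rt) * seq rt :=
  ([seq (nat_of_ord r.1, raw_tree r.2) | r <- rules G],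
   flatten [seq raw_subs r.2 | r <- rules G]).

Definition raw_node (nd : {a : fo_symb tau k & {ffun 'I_(fo_ar a) -> nat}}) : node :=
  (scode (tag nd), [seq tagged nd i | i <- enum 'I_(fo_ar (tag nd))]).

(** One and the same [o] is derived, valued and unfolded, so the graph at an accepting entry really
    represents a separator. *)
Definition entry_ok (g : tgraph) (i : nat) (en : entry) : Prop :=
  exists (T : gtree) o nd,
    [/\ en.1.1 = raw_tree T, gen T (obj_tree o), is_value As o en.1.2
      & [/\ onth g i = Some nd, raw_node nd = en.2 & unfolds g i (obj_tree o)]].

Lemma entry_ok_rcons g nd i en : entry_ok g i en -> entry_ok (rcons g nd) i en.
Proof.
move=> [T [o [nd' [e1 H1 H2 [e2 e3 H3]]]]]; exists T, o, nd'; split=> //.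
by split=> //; [exact: onth_rcons_old|exact: unfolds_rcons].
Qed.

(* The newest entry comes first in [W] and last in the graph, so that the entry
   at the head of [W] sits at position [size W - 1] of the graph. *)
Inductive sound : seq entry -> tgraph -> Prop :=
| sound_nil : sound [::] [::]
| sound_cons W g en nd : sound W g -> raw_node nd = en.2 ->
    entry_ok (rcons g nd) (size g) en -> sound (en :: W) (rcons g nd).

Lemma sound_size W g : sound W g -> size g = size W.
Proof. by elim=> // {}W {}g en nd _ IH _ _; rewrite size_rcons IH. Qed.

Lemma sound_numbered W g en i : sound W g -> (en, i) \in numbered W -> entry_ok g i en.
Proof.
elim=> // {}W {}g en' nd S IH e ok /=; rewrite inE => /orP[/eqP[-> ->]|/IH h].
  by rewrite -(sound_size S).
exact: entry_ok_rcons.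
Qed.

Lemma mem_numbered W en : en \in W -> exists i, (en, i) \in numbered W.
Proof.
elim: W => //= en' W IH; rewrite inE => /orP[/eqP ->|/IH[i h]].
  by exists (size W); rewrite inE eqxx.
by exists i; rewrite inE h orbT.
Qed.

Lemma in_rules_raw b t : (b, t) \in the_rules.1 ->
  exists B (T : gtree), [/\ List.In (B, T) (rules G), b = nat_of_ord B & t = raw_tree T].
Proof.
rewrite /the_rules /=; elim: (rules G) => //= -[B T] rs IH.
rewrite inE => /orP[/eqP[-> ->]|/IH[B' [T' [h -> ->]]]].
  by exists B, T; split=> //; left.
by exists B', T'; split=> //; right.
Qed.

Lemma raw_in_rules B (T : gtree) : List.In (B, T) (rules G) ->
  (nat_of_ord B, raw_tree T) \in the_rules.1 /\ {subset raw_subs T <= the_rules.2}.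
Proof.
rewrite /the_rules /=; elim: (rules G) => //= r rs IH [->|/IH[h1 h2]].
  by split=> [|x xin]; rewrite ?inE ?eqxx // mem_cat xin.
split=> [|x /h2 xin]; first by rewrite inE h1 orbT.
by rewrite mem_cat xin orbT.
Qed.

Lemma in_subs_raw t : t \in the_rules.2 -> exists T : gtree, t = raw_tree T.
Proof.
rewrite /the_rules /=; elim: (rules G) => //= r rs IH.
by rewrite mem_cat => /orP[/raw_subs_tree|/IH].
Qed.

Lemma chain_sound W g en : sound W g -> en \in chain_cands the_rules.1 W ->
  exists nd, raw_node nd = en.2 /\ entry_ok (rcons g nd) (size g) en.
Proof.
move=> S /flatten_mapP[[b t] /in_rules_raw[B [T [BT -> ->]]]].
case/mapP=> en0; rewrite mem_filter => /andP[/eqP et /mem_numbered[i ini]] ->.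
have [T0 [o [nd [e1 H1 H2 [e2 e3 H3]]]]] := sound_numbered S ini.
rewrite et in e1; have := raw_tree_inj e1 => eT; subst T0.
exists nd; split=> //; exists (nonterm_tree _ B), o, nd; split=> //=.
- by rewrite -(raw_nonterm tau k).
- exact: gen_rule BT H1.
- by split=> //; [exact: onth_rcons_new|exact: unfolds_copy H3 e2].
Qed.

Variable m : nat.
Hypothesis m_ar : forall a : fo_symb tau k, fo_ar a <= m.

Lemma node_sound W g en : sound W g -> en \in node_cands k m the_points the_rules.2 W ->
  exists nd, raw_node nd = en.2 /\ entry_ok (rcons g nd) (size g) en.
Proof.
move=> S /flatten_mapP[t]; rewrite mem_filter => /andP[lt /in_subs_raw[T eT]].
case/mapP=> tp; rewrite mem_filter => /andP[ok /tuplesP[ws [_ sub e1 e2]]] ->.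
subst t; case: T lt ok e1 => -[a|B] ch //= _ ok e1.
have sws : size ws = fo_ar a.
  by rewrite -(size_map (fun wi : entry * nat => wi.1.1.1)) e1 size_map size_enum_ord.
pose wi0 : entry * nat := ((leaf_rt 0, value0, ([::], [::])), 0).
pose w (i : 'I_(fo_ar a)) := nth wi0 ws i.
have win i : w i \in numbered W by apply: sub; apply: mem_nth; rewrite sws.
have wE : ws = [seq w i | i <- enum 'I_(fo_ar a)].
  apply: (@eq_from_nth _ wi0); first by rewrite size_map size_enum_ord.
  by move=> i; rewrite sws => li; rewrite (@nth_map_ord _ _ _ _ (Ordinal li)).
have H (i : 'I_(fo_ar a)) : exists o, [/\ gen (ch i) (obj_tree o),
    is_value As o (w i).1.1.2 & unfolds g (w i).2 (obj_tree o)].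
  have wini : ((w i).1, (w i).2) \in numbered W by rewrite -surjective_pairing.
  have [T [o [nd [eT H1 H2 [_ _ H3]]]]] := sound_numbered S wini.
  exists o; split=> //; suff -> : ch i = T by [].
  apply: raw_tree_inj; rewrite -eT.
  by have := congr1 (fun s => nth (leaf_rt 0) s i) e1; rewrite wE -map_comp !nth_map_ord.
(* The witnesses of the single children are collected into one family, choice being available over
   finitely many positions. *)
have [os Hos] := fin_all_exists H => {H}.
pose os' : {ffun 'I_(fo_ar a) -> _} := [ffun i => os i].
have tp1 : [seq q.1 | q <- tp] = [seq (w i).1.1.2 | i <- enum 'I_(fo_ar a)].
  by rewrite -e2 wE -!map_comp.
have tp2 : [seq q.2 | q <- tp] = [seq (w i).2 | i <- enum 'I_(fo_ar a)].
  by rewrite -e2 wE -!map_comp.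
have [o b] : exists o, built os' o.
  apply: sorts_built; move: ok; rewrite /okc tp1 size_map size_enum_ord => /eqP <-.
  rewrite -map_comp; apply: eq_map => i /=; rewrite ffunE.
  by have [_ [e _ _ _] _] := Hos i; rewrite e.
pose nd : {a : fo_symb tau k & {ffun 'I_(fo_ar a) -> nat}} :=
  existT _ a [ffun i => (w i).2].
exists nd; split.
  by rewrite /raw_node /= tp2; congr (_, _); apply: eq_map => i; rewrite ffunE.
exists (@Node _ (@sum_arity _ _ (@fo_ar tau k)) (inl a) ch), o, nd; split=> //.
- rewrite (built_tree b); apply: gen_node => i; rewrite !ffunE.
  by have [] := Hos i.
- rewrite tp1; apply: combine_ok b _ => i; rewrite ffunE.
  by have [] := Hos i.
- split; first exact: onth_rcons_new.
    by rewrite /raw_node /= tp2; congr (_, _); apply: eq_map => i; rewrite ffunE.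
  rewrite (built_tree b); apply: (unfolds_node (js := [ffun i => (w i).2])).
    exact: onth_rcons_new.
  by move=> c; rewrite !ffunE; apply: unfolds_rcons; have [] := Hos c.
Qed.

Notation step := (sat_step k m the_points the_rules).

Lemma head_mem (T : eqType) (x0 : T) s : ~~ nilp s -> head x0 s \in s.
Proof. by case: s => //= x s _; rewrite inE eqxx. Qed.

Lemma step_cases W : step W = W \/ exists en, [/\ step W = en :: W,
  en \in chain_cands the_rules.1 W ++ node_cands k m the_points the_rules.2 W
  & en.1 \notin map fst W].
Proof.
rewrite /sat_step; set new := filter _ _; case: ifP => nn; first by left.
right; eexists; split; first by [].
  have := head_mem ((leaf_rt 0, value0), ([::], [::])) (negbT nn).
  by rewrite mem_filter => /andP[].
have := head_mem ((leaf_rt 0, value0), ([::], [::])) (negbT nn).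
rewrite mem_filter => /andP[/hasPn h _]; apply/negP => /mapP[en' /h].
by move=> ne e; rewrite e eqxx in ne.
Qed.

Lemma step_sound W g : sound W g -> exists g', sound (step W) g'.
Proof.
move=> S; have [->|[en [-> + _]]] := step_cases W; first by exists g.
rewrite mem_cat => h.
have [nd [e ok]] : exists nd, raw_node nd = en.2 /\ entry_ok (rcons g nd) (size g) en.
  by case/orP: h => h; [exact: chain_sound S h|exact: node_sound S h].
by exists (rcons g nd); exact: sound_cons S e ok.
Qed.

Lemma iter_sound j : exists g, sound (iter j step [::]) g.
Proof.
elim: j => [|j [g S]]; first by exists [::]; exact: sound_nil.
exact: step_sound S.
Qed.

Lemma step_keys W : uniq (map fst W) -> uniq (map fst (step W)).
Proof.
by have [->|[en [-> _ nin]]] := step_cases W => //= ->; rewrite nin.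
Qed.

Lemma iter_keys j : uniq (map fst (iter j step [::])).
Proof. by elim: j => // j IH; exact: step_keys. Qed.

(** Every step that changes anything adds exactly one entry, so a closed set is reached or the
    length keeps pace with the number of steps. *)
Lemma iter_full j : step (iter j step [::]) = iter j step [::] \/
  size (iter j step [::]) = j.
Proof.
elim: j => [|j IH]; first by right.
rewrite iterS; case: IH => [e|IH]; first by left; rewrite !e.
have [e|[en [e _ _]]] := step_cases (iter j step [::]); first by left; rewrite !e.
by right; rewrite e /= IH.
Qed.

Lemma iter_size j : size (iter j step [::]) <= j.
Proof.
elim: j => // j IH; rewrite iterS.
by have [->|[en [-> _ _]]] := step_cases (iter j step [::]); [exact: leqW|].
Qed.

Lemma closed_mem W en : step W = W ->
  en \in chain_cands the_rules.1 W ++ node_cands k m the_points the_rules.2 W ->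
  exists2 en', en' \in W & en'.1 = en.1.
Proof.
move=> cl h; case E : (has (fun en' : entry => en'.1 == en.1) W).
  by have /hasP[en' h' /eqP e] := E; exists en'.
have : en \in [seq en : entry <- chain_cands the_rules.1 W
    ++ node_cands k m the_points the_rules.2 W
    | ~~ has (fun en' : entry => en'.1 == en.1) W] by rewrite mem_filter E.
move: cl; rewrite /sat_step; case: (filter _ _) => //= en1 l /(congr1 size) /=.
by lia.
Qed.

(** Children as a plain list, to extract them from an equation between nodes without dependent
    equality. *)
Definition kids (A : Type) (ar : A -> nat) (t : rtree ar) : seq (rtree ar) :=
  let: Node a ch := t in [seq ch i | i <- enum 'I_(ar a)].

(** Induction on the derivation. The entry found has the value of [o], although its node may
    represent another object with that value. The second alternative is for the axiom, which need
    not occur in any right-hand side. *)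
Lemma complete W : step W = W ->
  forall (T : gtree) u o, gen T u -> u = obj_tree o ->
    {subset raw_subs T <= the_rules.2} \/ (exists B, T = nonterm_tree _ B) ->
    exists2 en, en \in W & en.1.1 = raw_tree T /\ is_value As o en.1.2.
Proof.
move=> cl T u o H; elim: H o => {T u} [a ch ch' Hch IH|B T u BT _ IH] o eu sub.
  case: sub => [sub|[B eB]]; last first.
    by have := congr1 (@raw_tree _ _ _) eB; rewrite raw_nonterm.
  have [a' [os b]] := obj_built o.
  rewrite (built_tree b) in eu.
  have ea : a' = a.
    by have := congr1 (fun t : rtree _ => let: Node a _ := t in a) eu.
  subst a'.
  have ech i : ch' i = obj_tree (os i).
    have /map_enum_inj -> := congr1 (@kids _ _) eu.
    by rewrite ffunE.
  have IHi i : exists wi : entry * nat, [/\ wi \in numbered W,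
      wi.1.1.1 = raw_tree (ch i) & is_value As (os i) wi.1.1.2].
    have [|en h1 [h2 h3]] := IH i (os i) (ech i); last first.
      by have [j hj] := mem_numbered h1; exists (en, j).
    left=> x xin; apply: sub; rewrite /= inE; apply/orP; right.
    by apply/flatten_mapP; exists i => //; rewrite mem_enum.
  have [wi Hwi] := fin_all_exists IHi.
  pose tp := [seq ((wi i).1.1.2, (wi i).2) | i <- enum 'I_(fo_ar a)].
  have tp1 : [seq q.1 | q <- tp] = [seq (wi i).1.1.2 | i <- enum 'I_(fo_ar a)].
    by rewrite -map_comp.
  pose t0 : gtree := @Node _ (@sum_arity _ _ (@fo_ar tau k)) (inl a) ch.
  pose cand : entry := ((raw_tree t0, combine k the_points (scode a) [seq q.1 | q <- tp]),
    (scode a, [seq q.2 | q <- tp])).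
  have [|en' h4 h5] := @closed_mem W cand cl; last first.
    exists en' => //; rewrite h5; split=> //=.
    by rewrite tp1; apply: combine_ok b _ => i; have [] := Hwi i.
  rewrite mem_cat; apply/orP; right; apply/flatten_mapP; exists (raw_tree t0).
    by rewrite mem_filter sub //; exact: raw_subs_self.
  apply/mapP; exists tp => //; rewrite mem_filter; apply/andP; split.
    rewrite /okc tp1 size_map size_enum_ord -map_comp.
    have [<- _] := built_sorts b; apply/eqP; apply: eq_map => i /=.
    by have [_ _ [-> _ _ _]] := Hwi i.
  apply/tuplesP; exists [seq wi i | i <- enum 'I_(fo_ar a)]; split.
  - by rewrite /= size_map size_enum_ord.
  - by move=> x /mapP[i _ ->]; have [] := Hwi i.
  - by rewrite -map_comp; apply: eq_map => i /=; have [] := Hwi i.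
  - by rewrite -map_comp.
have [r1 r2] := raw_in_rules BT.
have [|en h1 [h2 h3]] := IH o eu; first by left.
have [|en' h4 h5] := @closed_mem W ((leaf_rt B, en.1.2), en.2) cl.
  rewrite mem_cat; apply/orP; left; apply/flatten_mapP; exists (nat_of_ord B, raw_tree T) => //.
  by apply/mapP; exists en => //; rewrite mem_filter h2 eqxx.
by exists en' => //; rewrite h5 raw_nonterm.
Qed.

End Saturate.

(** * Correctness of the answer *)

Section AnswerCorrect.
Variables (tau : signature) (k : nat) (I : instance tau k).
Let As := pos I ++ neg I.
Let G := grammar I.
Let acc := accepting k (map (@raw_struct tau) (pos I)) (map (@raw_struct tau) (neg I))
  (axiom G).

Lemma in_pos_As A : List.In A (pos I) -> List.In A As.
Proof. by move=> h; apply: List.in_or_app; left. Qed.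

Lemma in_neg_As A : List.In A (neg I) -> List.In A As.
Proof. by move=> h; apply: List.in_or_app; right. Qed.

Lemma accepting_sound (g : term_graph (@fo_ar tau k)) i en : entry_ok I g i en -> acc en ->
  exists phi, unfolds g i (formula_tree phi) /\ separator I phi.
Proof.
move=> [T [o [nd [eT H [es ef _ V] [_ _ U]]]]].
case/and5P=> /eqP aT /eqP so fo ap an.
case: o H es ef V U => [phi|t] H es ef V U; last by rewrite es in so.
exists phi; split=> //.
have eTn : T = nonterm_tree _ (axiom G).
  by apply: raw_tree_inj; rewrite -eT aT raw_nonterm.
split.
- apply/eqP/set0Pn => -[x xin]; move: fo; rewrite ef /nilp size_eq0 => /eqP fo.
  have : nat_of_ord x \in fv_list (inl phi : formula tau k + term tau k).
    by rewrite mem_filter fv_nat_ord xin mem_iota /=.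
  by rewrite fo.
- by apply/langP; rewrite -eTn.
- move=> A iA e; have /allP/(_ (raw_point e) (points_raw e iA)) := ap.
  by rewrite (V _ _ (in_pos_As iA)) /=; case: (sat e phi).
- move=> B iB M; have /allP/(_ _ (in_raw iB)) := an.
  case/hasP=> p /(@pointsP _ _ [:: B])[A [e [iA ->]]].
  have eA : A = B by case: iA.
  subst A; rewrite (V _ _ (in_neg_As iB)) /=.
  by rewrite M.
Qed.

Lemma accepting_complete en phi : separator I phi ->
  en.1.1 = raw_tree (nonterm_tree (@fo_ar tau k) (axiom G)) ->
  is_value As (inl phi) en.1.2 -> acc en.
Proof.
move=> [se _ Hp Hn] eT [es ef _ V]; apply/and5P; split.
- by rewrite eT raw_nonterm.
- by rewrite es.
- rewrite ef /nilp size_eq0; apply/eqP/eqP; rewrite -[_ == _]negbK -has_filter.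
  apply/hasPn => y _; apply/negP => /mapP[x].
  by rewrite mem_enum /= se inE.
- apply/allP => p /pointsP[A [e [iA ->]]].
  by rewrite (V _ _ (in_pos_As iA)) /= Hp.
- apply/allP => r /raw_in[B iB ->].
  have [M|] := boolP [forall e : assignment k B, sat e phi].
    by case: (Hn B iB) => e; have /forallP := M; apply.
  rewrite negb_forall => /existsP[e ne]; apply/hasP; exists (raw_point e).
    by apply: (@points_raw _ _ [:: B]); left.
  by rewrite (V _ _ (in_neg_As iB)) /= (negbTE ne).
Qed.

Lemma sound_nodes W g : sound I W g ->
  map (@raw_node tau k) g = [seq en.2 | en : entry <- rev W].
Proof.
elim=> // {}W {}g en nd _ IH e _.
by rewrite map_rcons IH rev_cons map_rcons e.
Qed.

Lemma sound_suffix W1 W2 g : sound I (W1 ++ W2) g -> exists g', sound I W2 g'.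
Proof.
elim: W1 g => [|en W1 IH] g S; first by exists g.
inversion S; subst; apply: IH; eassumption.
Qed.

Lemma enc_raw_node nd : enc_node (@raw_node tau k nd) =
  enc_symb (tag nd) ++ flatten [seq enc_nat (tagged nd i) | i <- enum 'I_(fo_ar (tag nd))].
Proof.
by rewrite /enc_node /raw_node /= map_cat flatten_cat -enc_scode -map_comp.
Qed.

(** Acceptance inspects only the tree and the value of an entry, and completeness supplies an entry
    with those of any separator; this justifies the answer No. Otherwise the suffix from the
    accepting entry on is itself sound, with the root of its graph at that entry. *)
Lemma answer_correct m W g : (forall a : fo_symb tau k, fo_ar a <= m) ->
  sat_step k m (the_points I) (the_rules I) W = W -> sound I W g ->
  exists ans, answer k (map (@raw_struct tau) (pos I)) (map (@raw_struct tau) (neg I))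
    (axiom G) W = enc_answer ans /\ correct_answer I ans.
Proof.
move=> Hm cl S; rewrite /answer -/acc.
have [W1 eW] := drop_until_suffix acc W.
case E : (drop_until acc W) => [|en W'] /=.
  exists None; split=> // -[phi sep].
  have [_ /langP H _ _] := sep.
  have [|en enW [e1 e2]] := complete Hm cl H (o := inl phi) erefl; first by right; exists (axiom G).
  have := accepting_complete sep e1 e2.
  have /hasPn/(_ en enW) /negP // : ~~ has acc W.
  elim: (W) E => //= en1 W2 IH; by case: (acc en1).
rewrite E in eW; rewrite eW in S.
have [g' S'] := sound_suffix S.
have ae : acc en.
  elim: (W) E => //= en1 W2 IH; by case: ifP => // h [<-].
exists (Some g'); split.
  rewrite /enc_answer /enc_term_graph /enc_seq (sound_size S') /=.
  congr [:: true, true & _ ++ flatten _].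
  have := sound_nodes S' => /(congr1 (map enc_node)); rewrite -!map_comp => e.
  transitivity [seq enc_node (raw_node nd) | nd <- g']; first exact: esym e.
  by apply: eq_map => nd; exact: enc_raw_node.
inversion S' as [|W2 g2 en2 nd S2 e ok]; subst.
have [phi [U sep]] := accepting_sound ok ae.
by exists phi; split=> //; rewrite /represents size_rcons.
Qed.

End AnswerCorrect.

(** * Running time *)

Lemma sz_in {T : eqType} {ET : Enc T} (x : T) (l : seq T) : x \in l -> sz x <= sz l.
Proof. by case/splitPr => l1 l2; apply: (sz_mem (l1 := l1) (l2 := l2)). Qed.

Lemma sz_seq_le {T : eqType} {ET : Enc T} (l : seq T) B :
  (forall x, x \in l -> sz x <= B) -> sz l <= (size l * B.+1).+1.
Proof.
move=> H; rewrite -{1}[l]map_id; apply: sz_map_le => l1 x l2 e; apply: H.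
by rewrite e mem_cat inE eqxx orbT.
Qed.

(** Codes are prefix-free, so padding them to length [M] keeps them distinct, and there are [2 ^ M]
    words of that length. *)
Lemma size_uniq_codes (T : eqType) (ET : Enc T) (s : seq T) M :
  injective (enc : T -> bintree) -> uniq s -> (forall x, x \in s -> sz x <= M) ->
  size s <= 2 ^ M.
Proof.
move=> inj us H.
pose (f := fun x : T => [tuple nth false (code (enc x)) i | i < M]).
have f_inj : {in s &, injective f}.
  move=> x y /H lx /H ly /(congr1 (fun t : M.-tuple bool => nth false t)) e; apply: inj.
  have pad (c : seq bool) i : i < M -> nth false (c ++ nseq (M - size c) false) i = nth false c i.
    move=> li; rewrite nth_cat nth_nseq; case: ltnP => // le.
    by rewrite if_same nth_default.
  have [] // := @code_prefix (enc x) (enc y)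
    (nseq (M - size (code (enc x))) false) (nseq (M - size (code (enc y))) false).
  have sx : size (code (enc x) ++ nseq (M - size (code (enc x))) false) = M.
    by rewrite size_cat size_nseq subnKC.
  apply: (@eq_from_nth _ false).
    by rewrite sx size_cat size_nseq subnKC.
  move=> i; rewrite sx => li; rewrite !pad //.
  have := congr1 (fun g => g i) e.
  by rewrite /f -[i]/(nat_of_ord (Ordinal li)) -!tnth_nth !tnth_mktuple.
rewrite -(size_map f); have /card_uniqP <- : uniq (map f s) by rewrite map_inj_in_uniq.
by apply: leq_trans (max_card _) _; rewrite card_tuple card_bool.
Qed.

Lemma unfolds_kids (A : Type) (ar : A -> nat) (g : term_graph ar) nd i u :
  unfolds g i u -> onth g i = Some nd -> forall c, tagged nd c < size g.
Proof.
case=> {u} {}i a js ch e U e'; rewrite e' in e; case: e => ->.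
by move=> c /=; exact: unfolds_lt (U c).
Qed.

Section Sizes.
Variables (tau : signature) (k m : nat).
Hypothesis m_ar : forall a : fo_symb tau k, fo_ar a <= m.

(** An instance is coded by its bit string, as the machine receives it. Polynomial time in [I] thus
    includes parsing, and functions of the components of [I] are transferred from the decoders. *)
Instance enc_instD : Enc (instance tau k) := fun I => enc (enc_instance I).

Lemma PT_bits : PT (fun I : instance tau k => enc_instance I).
Proof. exact: PT_castr (PT_id _). Qed.

Lemma PT_raw_pos : PT (fun I : instance tau k => map (@raw_struct tau) (pos I)).
Proof.
apply: (PT_castr (f := fun I : instance tau k => (in_pos tau (enc_instance I)).1)).
  by move=> I; rewrite in_posE.
by apply: PT_fst; apply: PT_comp PT_bits (PT_in_pos _).
Qed.

Lemma PT_raw_neg : PT (fun I : instance tau k => map (@raw_struct tau) (neg I)).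
Proof.
apply: (PT_castr (f := fun I : instance tau k => (in_neg tau (enc_instance I)).1)).
  by move=> I; rewrite in_negE.
by apply: PT_fst; apply: PT_comp PT_bits (PT_in_neg _).
Qed.

Lemma PT_axiom : PT (fun I : instance tau k => nat_of_ord (axiom (grammar I))).
Proof.
apply: (PT_castr (f := fun I : instance tau k => in_axiom tau (enc_instance I))).
  by move=> I; rewrite in_axiomE.
by apply: PT_comp PT_bits (PT_in_axiom _).
Qed.

Lemma PT_the_points : PT (@the_points tau k).
Proof.
apply: (PT_castr (f := fun I : instance tau k =>
  points k (map (@raw_struct tau) (pos I) ++ map (@raw_struct tau) (neg I)))).
  by move=> I; rewrite -map_cat.
by apply: PT_points; apply: PT_cat; [exact: PT_raw_pos|exact: PT_raw_neg].
Qed.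

Lemma PT_the_rules : PT (@the_rules tau k).
Proof.
apply: (PT_castr (f := fun I : instance tau k => in_rules tau (enc_instance I))).
  by move=> I; rewrite in_rulesE.
by apply: PT_comp PT_bits (PT_in_rules _).
Qed.

(** A denotation at a point is a truth value or an element of the domain, hence at most the size of
    the point, which contains the greatest element in unary. The factor 3 counts the point once and
    the unary denotation twice. *)
Lemma value_sz As (o : formula tau k + term tau k) v : is_value As o v ->
  sz v <= 3 * sz (points k (map (@raw_struct tau) As)) + sz (iota 0 k) + 5.
Proof.
move=> [es ef ev V]; case: v es ef ev V => [[s fl] vs] /= es ef ev V; rewrite {}es {}ef {s fl} in ev V *.
have H p : p \in points k (map (@raw_struct tau) As) -> vget p ((obj_sort o, fv_list o), vs) <= sz p.
  move/pointsP=> [A [e [iA ->]]]; rewrite V // !sz_pair sz_nat.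
  by case: o {ev V} => [p'|t] /=; [case: (sat _ _); lia|have := ltn_ord (eval e t); lia].
have le1 : sz (fv_list o) <= sz (iota 0 k).
  rewrite /fv_list; elim: (iota 0 k) => //= y l IH; rewrite sz_cons.
  by case: ifP => _; rewrite ?sz_cons; pose proof (sz_gt0 y); lia.
have le2 : sz vs <= 3 * sz (points k (map (@raw_struct tau) As)).
  rewrite {1}ev; elim: (points _ _) H => //= p l IH H; rewrite !sz_cons sz_pair sz_nat.
  have h1 := H p (mem_head _ _).
  have h2 : sz [seq (p0, vget p0 (obj_sort o, fv_list o, vs)) | p0 <- l] <= 3 * sz l.
    by apply: IH => q qin; apply: H; rewrite inE qin orbT.
  by lia.
by rewrite !sz_pair sz_nat; case: o {H ev V} le1 le2 => [?|?] /=; lia.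
Qed.

Lemma scode_sz : exists S, forall a : fo_symb tau k, sz (scode a) <= S.
Proof.
exists (2 * (#|rel_sym tau| + #|fn_sym tau| + k) + 25).
have one (t i n : nat) : t <= 8 -> i < n -> sz [:: t; i] <= 2 * n + 25.
  by rewrite !sz_cons !sz_nat sz_nil; lia.
have R0 (t : nat) : t <= 8 -> sz [:: t] <= 25 by rewrite sz_cons sz_nat sz_nil; lia.
case=> [R|f|||||x|x|x]; rewrite /scode.
- by apply: leq_trans (one 0 _ #|rel_sym tau| isT (ltn_ord (enum_rank R))) _; lia.
- by apply: leq_trans (one 1 _ #|fn_sym tau| isT (ltn_ord (enum_rank f))) _; lia.
- by apply: leq_trans (R0 2 isT) (leq_addl _ _).
- by apply: leq_trans (R0 3 isT) (leq_addl _ _).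
- by apply: leq_trans (R0 4 isT) (leq_addl _ _).
- by apply: leq_trans (R0 5 isT) (leq_addl _ _).
- by apply: leq_trans (one 6 _ _ isT (ltn_ord _)) _; lia.
- by apply: leq_trans (one 7 _ _ isT (ltn_ord _)) _; lia.
- by apply: leq_trans (one 8 _ _ isT (ltn_ord _)) _; lia.
Qed.

Definition key_roots (I : instance tau k) : seq rt :=
  (the_rules I).2 ++ [seq leaf_rt r.1 | r <- (the_rules I).1].

Notation iterates I j := (iter j (sat_step k m (the_points I) (the_rules I)) [::]).

Lemma iter_roots (I : instance tau k) j en : en \in iterates I j -> en.1.1 \in key_roots I.
Proof.
elim: j en => // j IH en; rewrite iterS.
have [->|[en' [-> h _]]] := step_cases I m (iterates I j); first exact: IH.
rewrite inE => /orP[/eqP ->|/IH //]; move: h; rewrite !mem_cat => /orP[]; last first.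
  by case/flatten_mapP => t; rewrite mem_filter => /andP[_ ts] /mapP[tp _ ->]; rewrite /= ts.
case/flatten_mapP => r rin /mapP[en1 _ ->]; apply/orP; right.
by apply/mapP; exists r.
Qed.

Lemma iter_ok (I : instance tau k) j en : en \in iterates I j -> exists g i,
  entry_ok I g i en /\ size g <= j.
Proof.
move=> h; have [g S] := iter_sound I m j; have [i /(sound_numbered S) ok] := mem_numbered h.
by exists g, i; split=> //; rewrite (sound_size S); exact: iter_size.
Qed.

(** The bound does not depend on [j]: a key is one of the fixed trees with the value of some formula
    or term. *)
Lemma key_bound : exists e, forall (I : instance tau k) j en, en \in iterates I j -> sz en.1 <= peval e (sz I).
Proof.
have Pr : PT key_roots.
  have P := PT_the_rules; apply: PT_cat; first exact: PT_snd.
  by apply: PT_map; [rewrite /leaf_rt; pt|exact: PT_fst].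
have br := PT_size Pr; have bp := PT_size PT_the_points.
have [e He] : pbound (fun I : instance tau k =>
    (sz (key_roots I) + (3 * sz (the_points I) + sz (iota 0 k) + 5)).+1).
  by auto 20 with pb.
exists e => I j en h; apply: leq_trans (He I).
have [g [i [[T [o [nd [_ _ V _]]]] _]]] := iter_ok h.
rewrite [en.1]surjective_pairing sz_pair ltnS leq_add //.
  exact: sz_in (iter_roots h).
exact: value_sz V.
Qed.

Lemma iterates_bound : exists e, forall (I : instance tau k) F j, j <= F ->
  sz (iterates I j) <= peval e (sz (I, F)).
Proof.
have [e He] := key_bound; have [S HS] := scode_sz.
(* The key, then the symbol code of size at most [S], then at most [m] pointers, each below the
   number of entries and so of size at most that of [(I, F)]. *)
pose (B := fun s : nat => peval e s + (S + (m * s.+1).+1).+1).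
have [e' He'] : pbound (fun x : instance tau k * nat => (sz x * (B (sz x)).+2).+1).
  by rewrite /B; auto 20 with pb.
exists e' => I F j lj; apply: leq_trans (He' (I, F)).
apply: leq_trans (@sz_seq_le _ _ _ (B (sz (I, F))).+1 _) _; last first.
  rewrite ltnS leq_mul2r; apply/orP; right.
  apply: leq_trans (iter_size _ _ _) (leq_trans lj _).
  by rewrite sz_pair sz_nat; lia.
move=> en h.
have sze : sz en = (sz en.1 + sz en.2).+1 by rewrite {1}[en]surjective_pairing sz_pair.
rewrite -[leqLHS]/(sz en) sze ltnS; apply: leq_add.
  by apply: leq_trans (He _ _ _ h) _; apply: peval_mono; rewrite sz_pair; lia.
have [g [i [[T [o [nd [_ _ _ [e1 <- U]]]]] lg]]] := iter_ok h.
have szn : sz (raw_node nd) = (sz (scode (tag nd)) +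
    sz [seq tagged nd i | i <- enum 'I_(fo_ar (tag nd))]).+1 by exact: sz_pair.
rewrite -[leqLHS]/(sz (raw_node nd)) szn ltnS; apply: leq_add => //.
apply: leq_trans (@sz_map_le _ _ _ _ _ (sz (I, F)) _) _.
  move=> l1 c l2 _; have := unfolds_kids U e1 c.
  by rewrite sz_pair !sz_nat; lia.
by rewrite ltnS size_enum_ord leq_mul2r m_ar orbT.
Qed.

Lemma PT_iterates : PT (fun x : instance tau k * nat => iterates x.1 x.2).
Proof.
have [e He] := iterates_bound.
apply: PT_iter; [by exists e => -[I F] j; exact: He| |pt|pt].
have P : PT (fun p : instance tau k * nat * seq entry => p.1.1) by pt.
by apply: PT_sat_step; [exact: PT_comp P PT_the_points|exact: PT_comp P PT_the_rules|pt].
Qed.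

Definition synthesize (I : instance tau k) (F : nat) : seq bool :=
  answer k (map (@raw_struct tau) (pos I)) (map (@raw_struct tau) (neg I))
    (axiom (grammar I)) (iterates I F).

Lemma PT_synthesize : PT (fun x : instance tau k * nat => synthesize x.1 x.2).
Proof.
have P : PT (fun p : instance tau k * nat => p.1) by pt.
apply: PT_answer; [exact: PT_comp P PT_raw_pos|exact: PT_comp P PT_raw_neg|
  exact: PT_comp P PT_axiom|exact: PT_iterates].
Qed.

(** An iterate that is not closed would have [F] entries with distinct keys, more than there are
    codes of the bounded length. *)
Lemma synthesize_correct : exists e, forall (I : instance tau k) F, 2 ^ peval e (sz I) < F ->
  exists ans, synthesize I F = enc_answer ans /\ correct_answer I ans.
Proof.
have [e He] := key_bound; exists e => I F lF.
have [g S] := iter_sound I m F.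
apply: (answer_correct m_ar _ S).
have [//|eF] := iter_full I m F.
have inj : injective (enc : rt * value -> bintree) by pt.
have H : size (map fst (iterates I F)) <= 2 ^ peval e (sz I).
  apply: (size_uniq_codes inj (iter_keys I m F)) => x /mapP[en h ->].
  exact: He h.
by rewrite size_map eF leqNgt lF in H.
Qed.

End Sizes.

(** * Reading the input and writing the output *)

Definition read_bits : com :=
  Seq (move_tape RI RT) (Seq (Push RS false)
    (While RT (Seq (Push RS false) (Push RS true)) (Seq push_true (Push RS true)))).

(** The code of a list is pushed from its end, so the input is reversed onto [RT] first and the code
    of the empty list is pushed before any bit. *)
Lemma exec_read w : exec read_bits (init_store w) (20 * size w + 10) (st (code (enc w))).
Proof.
have H1 := @exec_move RI RT (init_store w).
have H3 t v : exec (While RT (Seq (Push RS false) (Push RS true)) (Seq push_true (Push RS true)))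
    (Store [::] (code (enc v)) t [::] [::] [::] [::]) (9 * size t + 1)
    (st (code (enc (catrev t v)))).
  elim: t v => [|b t IH] v; first exact: exec_while_nil.
  apply: (@exec_weaken _ _ (8 + (9 * size t + 1)).+1); first by rewrite /=; lia.
  apply: (@exec_while_cons RT _ _ _ b t _
    (Store [::] (code (enc (b :: v))) t [::] [::] [::] [::])) => //.
  case: b.
    have Hp : exec push_true (Store [::] (code (enc v)) t [::] [::] [::] [::]) 6
        (Store [::] (code (BNode BLeaf BLeaf) ++ code (enc v)) t [::] [::] [::] [::]).
      by apply: exec_seq_le (exec_push _ _ _)
        (exec_seq (exec_push _ _ _) (exec_push _ _ _)) _.
    by apply: exec_seq_le Hp (exec_push _ _ _) _.
  by apply: exec_seq_le (exec_push _ _ _) (exec_push _ _ _) _.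
have {}H1 : exec (move_tape RI RT) (init_store w) (3 * size w + 1)
    (Store [::] [::] (rev w) [::] [::] [::] [::]).
  by rewrite -[rev w]cats0 -catrevE; exact: H1.
have {}H3 := H3 (rev w) [::]; rewrite size_rev catrevE revK cats0 in H3.
have H2 := @exec_push RS false (Store [::] [::] (rev w) [::] [::] [::] [::]).
by apply: exec_seq_le H1 (exec_seq (H2 _) H3) _ => //; lia.
Qed.

Definition write_bits : com :=
  Seq (Push RK true) (While RK Skip
    (If RS Skip Skip
      (If RS Skip (Seq (Push RO false) (Push RK true))
         (Seq (If RS Skip Skip Skip) (Seq (If RS Skip Skip Skip)
            (Seq (Push RO true) (Push RK true))))))).

Lemma exec_write v : exists s, s_out s = rev v /\
  exec write_bits (st (code (enc v))) (20 * size v + 10) s.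
Proof.
have H v0 o : exists s, s_out s = catrev v0 o /\
    exec (While RK Skip (If RS Skip Skip
      (If RS Skip (Seq (Push RO false) (Push RK true))
         (Seq (If RS Skip Skip Skip) (Seq (If RS Skip Skip Skip)
            (Seq (Push RO true) (Push RK true)))))))
      (Store [::] (code (enc v0)) [::] [::] [::] [:: true] o) (20 * size v0 + 5) s.
  elim: v0 o => [|b v0 IH] o.
    exists (Store [::] [::] [::] [::] [::] [::] o); split=> //.
    apply: (@exec_weaken _ _ (2 + 1).+1) => //.
    apply: (@exec_while_cons RK _ _ _ true [::]) => //; last exact: exec_while_nil.
    by apply: (@exec_if_cons RS _ _ _ _ false [::]) => //; exact: exec_skip.
  have [s [e Hs]] := IH (b :: o); exists s; split=> //.
  apply: (@exec_weaken _ _ (15 + (20 * size v0 + 5)).+1); first by rewrite /=; lia.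
  apply: (@exec_while_cons RK _ _ _ true [::]) Hs => //.
  apply: (@exec_if_cons RS _ _ _ _ true (code (code_bool b) ++ code (enc v0)) 14) => //.
  case: b {e IH}.
    apply: (@exec_if_cons RS _ _ _ _ true [:: false, false & code (enc v0)] 13) => //.
    have pop s0 : exec (If RS Skip Skip Skip)
        (Store [::] (false :: s0) [::] [::] [::] [::] o) 2
        (Store [::] s0 [::] [::] [::] [::] o).
      by apply: (@exec_if_cons RS _ _ _ _ false s0 1) => //; exact: exec_skip.
    have p1 s0 : exec (Push RO true) (Store [::] s0 [::] [::] [::] [::] o) 2
        (Store [::] s0 [::] [::] [::] [::] (true :: o)) by exact: exec_push.
    have p2 s0 : exec (Push RK true) (Store [::] s0 [::] [::] [::] [::] (true :: o)) 2
        (Store [::] s0 [::] [::] [::] [:: true] (true :: o)) by exact: exec_push.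
    by apply: exec_seq_le (pop _) (exec_seq (pop _) (exec_seq (p1 _) (p2 _))) _.
  apply: (@exec_if_cons RS _ _ _ _ false (code (enc v0)) 13) => //.
  have p1 s0 : exec (Push RO false) (Store [::] s0 [::] [::] [::] [::] o) 2
      (Store [::] s0 [::] [::] [::] [::] (false :: o)) by exact: exec_push.
  have p2 s0 : exec (Push RK true) (Store [::] s0 [::] [::] [::] [::] (false :: o)) 2
      (Store [::] s0 [::] [::] [::] [:: true] (false :: o)) by exact: exec_push.
  by apply: exec_seq_le (p1 _) (p2 _) _.
have [s [e Hs]] := H v [::]; exists s; split; first by rewrite e catrevE cats0.
have p s0 : exec (Push RK true) (st s0) 2 (Store [::] s0 [::] [::] [::] [:: true] [::]).
  exact: exec_push.
by apply: exec_seq_le (p _) Hs _; lia.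
Qed.

(** * Monomial and exponential bounds *)

Lemma peval_pow e : exists c d, forall n, peval e n <= c * n.+1 ^ d.
Proof.
elim: e => [|c|e1 [c1 [d1 H1]] e2 [c2 [d2 H2]]|e1 [c1 [d1 H1]] e2 [c2 [d2 H2]]].
- by exists 1, 1 => n; rewrite mul1n expn1 leqW.
- by exists c, 0 => n; rewrite expn0 muln1.
- exists (c1 + c2), (d1 + d2) => n; rewrite /= mulnDl leq_add //.
    apply: leq_trans (H1 n) _; rewrite leq_mul2l leq_pexp2l ?orbT //; exact: leq_addr.
  apply: leq_trans (H2 n) _; rewrite leq_mul2l leq_pexp2l ?orbT //; exact: leq_addl.
- exists (c1 * c2), (d1 + d2) => n /=; apply: leq_trans (leq_mul (H1 n) (H2 n)) _.
  by rewrite expnD mulnACA.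
Qed.

Lemma peval_monomial e : exists c d, forall n, peval e n <= c * n ^ d + c.
Proof.
have [c [d H]] := peval_pow e; exists (c * 2 ^ d), d => n.
(* For positive [n] one has [n.+1 ^ d <= 2 ^ d * n ^ d]; the additive constant covers [n = 0]. *)
apply: leq_trans (H n) _; case: n => [|n].
  by rewrite exp1n muln1 (leq_trans _ (leq_addl _ _)) // leq_pmulr // expn_gt0.
rewrite (leq_trans _ (leq_addr _ _)) // -mulnA leq_mul2l -expnMn; apply/orP; right.
by case: d {H} => // d; rewrite leq_exp2r //; lia.
Qed.

Section ExpBounds.
Variables (X : Type) (size_of : X -> nat).

Definition ebound (t : X -> nat) : Prop :=
  exists e, forall x, t x <= 2 ^ peval e (size_of x).

Lemma ebound_le t t' : (forall x, t x <= t' x) -> ebound t' -> ebound t.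
Proof. by move=> le [e H]; exists e => x; exact: leq_trans (le x) (H x). Qed.

Lemma ebound_pexp e : ebound (fun x => peval e (size_of x)).
Proof. by exists e => x; rewrite ltnW // ltn_expl. Qed.

Lemma ebound_const n : ebound (fun=> n).
Proof. exact: (ebound_pexp (PC n)). Qed.

Lemma ebound_exp e : ebound (fun x => 2 ^ peval e (size_of x)).
Proof. by exists e. Qed.

Lemma ebound_add t t' : ebound t -> ebound t' -> ebound (fun x => t x + t' x).
Proof.
move=> [e H] [e' H']; exists (PAdd (PAdd e e') (PC 1)) => x.
rewrite /= expnD muln2 -addnn leq_add //.
  by apply: leq_trans (H x) _; rewrite leq_pexp2l // leq_addr.
by apply: leq_trans (H' x) _; rewrite leq_pexp2l // leq_addl.
Qed.

Lemma ebound_mul t t' : ebound t -> ebound t' -> ebound (fun x => t x * t' x).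
Proof.
by move=> [e H] [e' H']; exists (PAdd e e') => x; rewrite /= expnD leq_mul.
Qed.

(** A polynomial in [2 ^ p(n)] is again of the form [2 ^ q(n)]: polynomial time on the pair of the
    instance and [F] becomes exponential time in the instance. *)
Lemma ebound_peval e t : ebound t -> ebound (fun x => peval e (t x)).
Proof.
move=> H; elim: e => //= [c|e1 H1 e2 H2|e1 H1 e2 H2]; first exact: ebound_const.
  exact: ebound_add.
exact: ebound_mul.
Qed.

End ExpBounds.

Lemma PT_peval (X : Type) (EX : Enc X) e (n : X -> nat) :
  PT n -> PT (fun x => peval e (n x)).
Proof.
move=> Pn; elim: e => //= [c|e1 H1 e2 H2|e1 H1 e2 H2]; [by pt|exact: PT_add|exact: PT_mul].
Qed.

Lemma sz_bits (w : seq bool) : sz w <= 4 * size w + 1.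
Proof.
elim: w => // b w IH; rewrite sz_cons /=.
have : sz b <= 3 by case: b.
by lia.
Qed.

(** * Assembly of the machine *)

Section Main.
Variables (tau : signature) (k : nat).
Notation len I := (size (enc_instance I)).
Existing Instance enc_instD.

(** The doubling that produces [F] lies outside [PT_foldl], since its result is not polynomially
    bounded. The bare loop [exec_fold] is used instead, which accepts an exponential [B]. *)
Lemma machine : exists (c : com) (t : instance tau k -> nat),
  ebound (fun I : instance tau k => len I) t /\
  forall I, exists ans, [/\ correct_answer I ans &
    exists s, s_out s = rev (enc_answer ans) /\
      exec c (init_store (enc_instance I)) (t I) s].
Proof.
have [m Hm] : exists m, forall a : fo_symb tau k, fo_ar a <= m.
  by have [M H] := sym_ar_le tau; exists M => a; rewrite -scode_ar.
have [e He] := synthesize_correct Hm.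
(* A word of length [n] has a code of size at most [4 * n + 1]; the successor makes [2 ^ P I] exceed
   the number of keys strictly. *)
pose P (I : instance tau k) := (peval e (4 * len I + 1)).+1.
have szI (I : instance tau k) : sz I <= 4 * len I + 1 by exact: sz_bits.
have [cA [tA [[eA HeA] HA]]] : PT (fun I : instance tau k => ((I, 1), nseq (P I) tt)).
  apply: PT_pair; first by pt.
  apply: PT_nseq; last by pt.
  apply: PT_succ; apply: PT_peval; apply: PT_add; last by pt.
  apply: PT_mul; first by pt.
  by apply: PT_size_seq; exact: PT_bits.
have [cF [tF [[eF HeF] HF]]] :
    PT (fun q : (instance tau k * nat) * unit => (q.1.1, q.1.2 + q.1.2)) by pt.
have PS := PT_synthesize Hm; have [eS HS] := PT_size PS.
have [cB [tB [[eB HeB] HB]]] := PS.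
pose f (x : instance tau k * nat) (_ : unit) := (x.1, x.2 + x.2).
have fE I a l : foldl f (I, a) l = (I, a * 2 ^ size l).
  elim: l a => [|u l IH] a; first by rewrite muln1.
  by rewrite /= IH addnn -muln2 expnS mulnA.
(* Bounds the code of [(I, 2 ^ j)] for [j <= P I], with room for the pairing with a list element
   inside the loop. *)
pose N (I : instance tau k) := 4 * len I + 2 * 2 ^ P I + 10.
pose B (I : instance tau k) := peval eF (N I) + N I + 2 * P I.
pose T (I : instance tau k) := (20 * len I + 10) + (peval eA (4 * len I + 1) +
  (210 * (P I).+1 * (B I).+1 + (peval eB (N I) + (20 * peval eS (N I) + 10)))).
exists (Seq read_bits (Seq cA (Seq (fold_tree cF) (Seq cB write_bits)))), T; split.
  have PE I : P I = peval (PAdd (psubst e (PAdd (PMul (PC 4) PX) (PC 1))) (PC 1)) (len I).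
    by rewrite /P -[LHS]addn1 [RHS]/= peval_subst.
  have e4 : ebound (fun I : instance tau k => len I) (fun I => 4 * len I + 1).
    exact: (@ebound_pexp _ _ (PAdd (PMul (PC 4) PX) (PC 1))).
  have eP : ebound (fun I : instance tau k => len I) P.
    by apply: ebound_le (@ebound_pexp _ _ _) => I; rewrite PE.
  have e2P : ebound (fun I : instance tau k => len I) (fun I => 2 ^ P I).
    by apply: ebound_le (@ebound_exp _ _ _) => I; rewrite PE.
  have c0 n : ebound (fun I : instance tau k => len I) (fun=> n) by exact: ebound_const.
  have el : ebound (fun I : instance tau k => len I) (fun I => len I).
    exact: (@ebound_pexp _ _ PX).
  have eN : ebound (fun I : instance tau k => len I) N.
    by apply: ebound_add => //; apply: ebound_add; apply: ebound_mul.
  have eB' : ebound (fun I : instance tau k => len I) B.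
    by apply: ebound_add; [apply: ebound_add => //; exact: ebound_peval|apply: ebound_mul].
  have succ t : ebound (fun I : instance tau k => len I) t ->
      ebound (fun I : instance tau k => len I) (fun I => (t I).+1).
    by move=> Ht; apply: ebound_le (ebound_add Ht (c0 1)) => I; rewrite addn1.
  apply: ebound_add; first by apply: ebound_add => //; exact: ebound_mul.
  apply: ebound_add; first exact: ebound_peval.
  apply: ebound_add.
    by apply: ebound_mul; [apply: ebound_mul => //|]; exact: succ.
  apply: ebound_add; first exact: ebound_peval.
  by apply: ebound_add => //; apply: ebound_mul => //; exact: ebound_peval.
move=> I; have [|ans [eans ok]] := He I (2 ^ P I).
  by rewrite ltn_exp2l // /P ltnS; apply: peval_mono.
exists ans; split=> //; rewrite -{}eans.
have [s [es Hs]] := exec_write (synthesize m I (2 ^ P I)).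
exists s; split=> //.
have szF j : j <= P I -> sz (I, 2 ^ j) <= N I.
  move=> lj; rewrite sz_pair sz_nat /N.
  have : 2 ^ j <= 2 ^ P I by rewrite leq_exp2l.
  by have := szI I; lia.
have F s0 : exec (fold_tree cF) (st (code (enc ((I, 1), nseq (P I) tt)) ++ s0))
    (210 * (P I).+1 * (B I).+1) (st (code (enc (I, 2 ^ P I)) ++ s0)).
  have Hl : csize (dlist (map enc (nseq (P I) tt))) <= B I.
    have -> : csize (dlist (map enc (nseq (P I) tt))) = sz (P I).
      by rewrite /sz /enc /enc_natD map_nseq.
    by rewrite sz_nat /B /N; lia.
  have eF2 : (I, 2 ^ P I) = foldl f (I, 1) (nseq (P I) tt).
    by rewrite fE size_nseq mul1n.
  rewrite eF2 -[in X in exec _ _ X](size_nseq (P I) tt).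
  apply: (exec_fold (ea := enc) (a := (I, 1)) (l := nseq (P I) tt)) => [l1 u l2 el s'|l1 l2 el|].
  - rewrite -cats1 foldl_cat fE mul1n /=.
    apply: exec_weaken (HF ((I, 2 ^ size l1), u) s').
    have lj : (size l1).+1 <= P I.
      by rewrite -(size_nseq (P I) tt) el size_cat /= addnS ltnS leq_addr.
    apply: leq_trans (HeF _) _; rewrite /B -addnA; apply: leq_trans (leq_addr _ _).
    apply: peval_mono.
    have h1 : 2 ^ size l1 < 2 ^ P I by rewrite ltn_exp2l.
    have h2 := szI I.
    rewrite !sz_pair sz_nat; have -> : sz u = 1 by case: u {el}.
    by rewrite /N; lia.
  - rewrite fE mul1n; apply: leq_trans (szF _ _) _.
      by rewrite -(size_nseq (P I) tt) el size_cat leq_addr.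
    by rewrite /B; lia.
  - exact: Hl.
have HA' := HA I [::]; rewrite !cats0 in HA'.
have {}F := F [::]; rewrite !cats0 in F.
have HB' := HB (I, 2 ^ P I) [::]; rewrite !cats0 in HB'.
apply: exec_seq_le (exec_read _) (exec_seq HA' (exec_seq F (exec_seq HB' Hs))) _.
rewrite /T leq_add2l; apply: leq_add.
  by apply: leq_trans (HeA _) _; exact: peval_mono.
rewrite leq_add2l; apply: leq_add.
  by apply: leq_trans (HeB _) _; apply: peval_mono; exact: szF.
rewrite leq_add2r leq_pmul2l //.
(* The answer has fewer bits than its code, whose size is polynomial in that of [(I, 2 ^ P I)]. *)
apply: leq_trans (leq_trans (HS (I, 2 ^ P I)) (peval_mono _ (szF _ (leqnn _)))).
by apply: leq_trans (ltnW (size_sz _)); rewrite -addnn leq_addr.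
Qed.

End Main.

Theorem theorem5p2 (tau : signature) (k : nat) :
  exists M : tm,
    solves_in_exptime M (@enc_instance tau k) (@enc_answer tau k)
      (@correct_answer tau k).
Proof.
have [com [t [[e He] H]]] := machine tau k.
have [c [d Hcd]] := peval_monomial e.
exists (com_tm com), c, d => I; have [ans [ok [s [es Hs]]]] := H I.
exists ans; split=> //; apply: com_tm_outputs es.
apply: exec_weaken Hs; apply: leq_trans (He I) _.
by rewrite leq_exp2l.
Qed.
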